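(* Let $\Sigma$ be a minimal surface in $\mathbb{R}^3$ with Gauss curvature $\mathcal{K}<0$ and unit normal vector field $\mathbf{n}$. Suppose there exist two distinct constant unit vector fields $\mathbf{V}_1$ and $\mathbf{V}_2$ in $\mathbb{R}^3$ such that the Chern-Ricci harmonic function $$\sum_{\mathbf{V}\in\{\mathbf{V}_1,-\mathbf{V}_1,\mathbf{V}_2,-\mathbf{V}_2\}}\ln\frac{\left(1-\mathbf{n}_{\mathbf{V}}\right)^2}{\sqrt{-\mathcal{K}}},\qquad \mathbf{n}_{\mathbf{V}}=\langle\mathbf{n},\mathbf{V}\rangle_{\mathbb{R}^3},$$ is constant. Then $\Sigma$ is congruent to (a part of) a member of the associate family connecting a generalized doubly periodic Scherk graph and a generalized singly periodic Scherk tower.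
   Context: A minimal surface means a connected, oriented, immersed surface in $\mathbb{R}^3$ with zero mean curvature. Congruent means equal up to an isometry of $\mathbb{R}^3$. The function in the claim is considered at the points where all the quantities $1-\mathbf{n}_{\mathbf{V}}$ appearing in it are positive; it is harmonic on the surface there. Weierstrass data: a non-planar minimal surface is (locally, or on its universal cover) given by a pair $(\mathbf{G},d\mathbf{h})$, where the meromorphic function $\mathbf{G}$ is the stereographic projection (from the north pole) of the Gauss map and $d\mathbf{h}$ is the holomorphic one-form with $\mathrm{Re}\, d\mathbf{h}=d\mathbf{x}_3$, via $$d\mathbf{x}_1=\mathrm{Re}\Big(\tfrac12\big(\tfrac1{\mathbf{G}}-\mathbf{G}\big)d\mathbf{h}\Big),\quad d\mathbf{x}_2=\mathrm{Re}\Big(\tfrac i2\big(\tfrac1{\mathbf{G}}+\mathbf{G}\big)d\mathbf{h}\Big),\quad d\mathbf{x}_3=\mathrm{Re}(d\mathbf{h}).$$ The associate family of a minimal surface with data $(\mathbf{G},d\mathbf{h})$ consists of the minimal surfaces with data $(\mathbf{G},e^{i\Theta}d\mathbf{h})$. The associate families of generalized Scherk surfaces are the families of minimal surfaces with Weierstrass data $$\frac{1}{\mathbf{G}}d\mathbf{h}=\frac{\rho\,e^{i\Theta}}{\left(\mathbf{G}^2-e^{2i\theta}\right)\left(\mathbf{G}^2-e^{-2i\theta}\right)}d\mathbf{G},\qquad \Theta\in[0,2\pi],$$ with fixed $\theta\in(0,\frac{\pi}{2})$ and scale $\rho>0$, defined on the universal cover of $(\mathbb{C}\cup\{\infty\})\setminus\{\pm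 e^{i\theta},\pm e^{-i\theta}\}$, with $\mathbf{G}$ the covering map. Here $\Theta=0$ gives the generalized (sheared) singly periodic Scherk tower and $\Theta=\frac{\pi}{2}$ its conjugate, the generalized doubly periodic Scherk graph.
   Formalization: The vectors are also assumed to satisfy V1 ≠ −V2, so that the four vectors ±V1, ±V2 are distinct; for V2 = −V1 the claim fails, since the catenoid with axis V1 makes the function constant but is not part of a Scherk member. *)

(* Defs.v *)
From HB Require Import structures.
From mathcomp Require Import all_boot all_order all_algebra.
From mathcomp Require Import complex.
From mathcomp Require Import all_classical all_reals all_analysis.
Set Implicit Arguments.
Unset Strict Implicit.
Unset Printing Implicit Defensive.
Import Order.TTheory GRing.Theory Num.Theory numFieldNormedType.Exports.
Local Open Scope classical_set_scope.
Local Open Scope complex_scope.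
Local Open Scope ring_scope.

Section Topology.

(* f restricts to a homeomorphism of the open set A onto an open set. *)
Definition open_embedding (T U : topologicalType) (A : set T) (f : T -> U) :=
  [/\ open A, set_inj A f, (forall x, A x -> {for x, continuous f})
    & forall W, W `<=` A -> open W -> open (f @` W)].

Definition local_homeo (T U : topologicalType) (f : T -> U) :=
  forall x, exists2 A, A x & open_embedding A f.

(* A covering of the subset B of U, surjective onto B. *)
Definition covering_map (T U : topologicalType) (f : T -> U) (B : set U) :=
  [/\ continuous f, range f = B
    & forall y, B y -> exists2 N, open_nbhs y N &
        exists (I : Type) (V : I -> set T),
          [/\ forall i, open_embedding (V i) f /\ f @` V i = N,
              trivIset setT V & f @^-1` N = \bigcup_i V i]].

Definition path_connected (R : realType) (T : topologicalType) :=
  forall x y : T, exists f : R -> T,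
    [/\ {within `[0, 1], continuous f}, f 0 = x & f 1 = y].

Definition simply_connected (R : realType) (T : topologicalType) :=
  path_connected R T /\
  forall f : R -> T, {within `[0, 1], continuous f} -> f 0 = f 1 ->
    exists H : R * R -> T,
      [/\ {within `[0, 1] `*` `[0, 1], continuous H},
          (forall t, 0 <= t <= 1 -> H (0, t) = f t /\ H (1, t) = f 0)
        & (forall s, 0 <= s <= 1 -> H (s, 0) = f 0 /\ H (s, 1) = f 0)].

End Topology.

Section Euclidean.
Context {R : realType}.
Implicit Types u v : 'rV[R]_3.

(* The library norm on row vectors is the sup norm, hence enorm. *)
Definition dot u v : R := \sum_k u 0 k * v 0 k.

Definition enorm u : R := Num.sqrt (dot u u).

(* Indices are taken modulo 3. *)
Definition cross u v : 'rV[R]_3 :=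
  \row_k (u 0 (k + 1) * v 0 (k + 2) - u 0 (k + 2) * v 0 (k + 1)).

Definition isometry (A : 'rV[R]_3 -> 'rV[R]_3) :=
  forall x y, enorm (A x - A y) = enorm (x - y).

End Euclidean.

Section Calculus.
Context {R : realType}.

Definition pd (W : normedModType R) (k : 'I_2) (f : 'rV[R]_2 -> W) :
  'rV[R]_2 -> W := fun u => 'D_('e_k) f u.

(* C^oo on the open set D: all iterated partial derivatives are
   differentiable. *)
Definition smooth_on (W : normedModType R) (D : set 'rV[R]_2)
    (f : 'rV[R]_2 -> W) :=
  forall (s : seq 'I_2) u, D u ->
    differentiable (foldr (fun k g => pd k g) f s) u.

Definition cdifferentiable (f : 'rV[R]_2 -> R[i]) (u : 'rV[R]_2) :=
  differentiable (fun v => complex.Re (f v)) u /\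
  differentiable (fun v => complex.Im (f v)) u.

Definition cpd (k : 'I_2) (f : 'rV[R]_2 -> R[i]) (u : 'rV[R]_2) : R[i] :=
  pd k (fun v => complex.Re (f v)) u +i* pd k (fun v => complex.Im (f v)) u.

Definition expi (t : R) : R[i] := cos t +i* sin t.

End Calculus.

Section Patch.
Context {R : realType}.
Variables (r : 'rV[R]_2 -> 'rV[R]_3) (u : 'rV[R]_2).

Definition patch_normal : 'rV[R]_3 :=
  let w := cross (pd 0 r u) (pd 1 r u) in (enorm w)^-1 *: w.

Definition first_form : 'M[R]_2 :=
  \matrix_(i, j) dot (pd i r u) (pd j r u).

Definition second_form : 'M[R]_2 :=
  \matrix_(i, j) dot (pd i (pd j r) u) patch_normal.

Definition shape_operator : 'M[R]_2 := second_form *m invmx first_form.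

Definition patch_gauss_curvature : R := \det shape_operator.

Definition patch_mean_curvature : R := \tr shape_operator / 2.

End Patch.

(* Connected, oriented surfaces immersed in R^3, given by local
   parametrizations [par i] of open pieces of [carrier].
   - Smoothness and regularity of [immersion \o par i] make the transition maps
     smooth (inverse function theorem).
   - [normal] is common to all charts, that is, the transition maps have
     positive Jacobian: this is the orientation.
   - Second countability is automatic: a connected Hausdorff surface carrying
     a Riemannian metric is metrizable and second countable. *)
Record surface (R : realType) := Surface {
  carrier :> topologicalType;
  immersion : carrier -> 'rV[R]_3;
  normal : carrier -> 'rV[R]_3;
  chart : Type;
  dom : chart -> set 'rV[R]_2;
  par : chart -> 'rV[R]_2 -> carrier;
  surface_hausdorff : hausdorff_space carrier;
  surface_connected : connected [set: carrier];
  par_embedding : forall i, open_embedding (dom i) (par i);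
  par_cover : forall p, exists i, (par i @` dom i) p;
  immersion_smooth : forall i, smooth_on (dom i) (immersion \o par i);
  immersion_regular : forall i u, dom i u ->
    row_free (\matrix_(k < 2) pd k (immersion \o par i) u);
  normalE : forall i u, dom i u ->
    normal (par i u) = patch_normal (immersion \o par i) u
}.

Section Surface.
Context {R : realType}.
Variable S : surface R.

Definition minimal := forall (i : chart S) u, dom i u ->
  patch_mean_curvature (@immersion R S \o par i) u = 0.

Definition is_gauss_curvature (K : S -> R) := forall (i : chart S) u, dom i u ->
  K (par i u) = patch_gauss_curvature (@immersion R S \o par i) u.

Definition chern_ricci (K : S -> R) (Vs : seq 'rV[R]_3) (p : S) : R :=
  \sum_(V <- Vs) ln ((1 - dot (normal p) V) ^+ 2 / Num.sqrt (- K p)).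

(* The Riemann sphere, with [None] as the point at infinity. *)
Definition riemann_sphere : topologicalType :=
  one_point_compactification (R[i] : numFieldType).

(* Stereographic projection of the normal from the north pole (0, 0, 1). The
   complex value is meaningful when the normal is not the north pole. *)
Definition gauss_value (p : S) : R[i] :=
  (normal p 0 0 +i* normal p 0 1) / (1 - normal p 0 2)%:C.

Definition gauss_map (p : S) : riemann_sphere :=
  if normal p 0 2 == 1 then None else Some (gauss_value p).

Definition tangent (p : S) (X : 'rV[R]_3) := dot (normal p) X = 0.

(* A complex one-form is a map [w p], real-linear on the tangent plane at p
   seen inside R^3; its values outside the tangent plane are irrelevant.
   The complex structure on the tangent plane is X |-> n x X, so that a form
   is holomorphic when it is complex-linear and closed. *)
Definition holomorphic_form (w : S -> 'rV[R]_3 -> R[i]) :=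
  [/\ forall p (a : R) X Y, tangent p X -> tangent p Y ->
        w p (a *: X + Y) = a%:C * w p X + w p Y,
      forall p X, tangent p X -> w p (cross (normal p) X) = 'i%C * w p X
    & forall (i : chart S) u, dom i u ->
        let coef k v := w (par i v) (pd k (@immersion R S \o par i) v) in
        (forall k, cdifferentiable (coef k) u) /\
        cpd 0 (coef 1) u = cpd 1 (coef 0) u].

(* [dh] together with the Gauss map G of S is Weierstrass data for S. The
   formulas for dx1 and dx2 are stated off the zeros and poles of G. *)
Definition weierstrass_data (dh : S -> 'rV[R]_3 -> R[i]) :=
  [/\ holomorphic_form dh,
      forall p X, tangent p X -> X 0 2 = complex.Re (dh p X)
    & forall p X, tangent p X ->
        let G := gauss_value p in normal p 0 2 != 1 -> G != 0 ->
        X 0 0 = complex.Re (2^-1 * (G^-1 - G) * dh p X) /\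
        X 0 1 = complex.Re ('i%C / 2 * (G^-1 + G) * dh p X)].

Definition scherk_ends (theta : R) : set riemann_sphere :=
  [set z | z = Some (expi theta) \/ z = Some (- expi theta) \/
           z = Some (expi (- theta)) \/ z = Some (- expi (- theta))].

(* The member with parameter Theta of the associate family of the generalized
   Scherk surfaces of angle theta and scale rho: S is the universal cover of
   the sphere minus four points, and G the covering map. The equation
   (1/G) dh = rho e^(i Theta) / ((G^2 - e^(2i theta)) (G^2 - e^(-2i theta))) dG
   is evaluated on the coordinate vectors of the charts, off the (isolated)
   zeros and poles of G. *)
Definition scherk_member (theta rho Theta : R) :=
  [/\ minimal,
      simply_connected R S,
      covering_map gauss_map (~` scherk_ends theta)
    & exists2 dh, weierstrass_data dh &
        forall (i : chart S) u k, dom i u ->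
          let p := par i u in let G := gauss_value p in
          normal p 0 2 != 1 -> G != 0 ->
          G^-1 * dh p (pd k (@immersion R S \o par i) u) =
          rho%:C * expi Theta
            / ((G ^+ 2 - expi (2 * theta)) * (G ^+ 2 - expi (- (2 * theta))))
          * cpd k (gauss_value \o par i) u].

End Surface.

(* S is congruent to a part of S'. The map to S' lives on a covering C of S:
   the members of the Scherk families are simply connected, whereas S may be a
   quotient of S' by deck transformations leaving the immersion invariant,
   as the embedded Scherk surfaces are. *)
Definition congruent_to_part (R : realType) (S S' : surface R) :=
  exists2 A : 'rV[R]_3 -> 'rV[R]_3, isometry A &
  exists (C : topologicalType) (pr : C -> S) (phi : C -> S'),
    [/\ connected [set: C], covering_map pr setT, local_homeo phi
      & forall c, A (immersion (pr c)) = immersion (phi c)].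

(* Main.v *)
(* Let [th] be half the angle between V1 and V2, and let z be the stereographic
   coordinate of the normal n seen from -V1, so that n = V1, -V1 are z = 0 and
   z = infinity while n = V2, -V2 are two real points pc > 0 and pa < 0 (in
   some order). Then 1 - <n,V1>^2 and 1 - <n,V2>^2 are, up to constants,
   |z|^2 / (1 + |z|^2)^2 and |(z - pa)(z - pc)|^2 / (1 + |z|^2)^2.
   On a minimal surface z is a local coordinate in which dX = Re (f N dz), with
   N a null vector quadratic in z, and K = - 4 / ((1 + |z|^2)^4 |f|^2). So the
   Chern-Ricci function is constant iff |f z (z - pa) (z - pc)| is. By the
   closedness of dX the function f z (z - pa) (z - pc) is holomorphic, hence it
   is a constant kappa, and f = kappa / (z (z - pa) (z - pc)) is the Weierstrass
   representation of a member of the Scherk family: the modulus of kappa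
   gives the scale and its argument the parameter of the associate family.
   The normal never takes the values V1, -V1, V2, -V2, since the curvature
   would vanish there.
   The universal cover of the plane minus pa, 0, pc is a tree of closed
   half-planes glued along the four intervals of the real axis, on which the
   Scherk immersion is a real part of a sum of logarithms. The congruence lives
   on a component of the fibre product of z : S -> C and this covering. *)
From HB Require Import structures.
Require Import Defs.
From mathcomp Require Import all_boot all_order all_algebra.
From mathcomp Require Import complex.
From mathcomp Require Import all_classical all_reals all_analysis.
From mathcomp Require Import ring lra.
Set Implicit Arguments.
Unset Strict Implicit.
Unset Printing Implicit Defensive.
Import Order.TTheory GRing.Theory Num.Theory numFieldNormedType.Exports.
Local Open Scope classical_set_scope.
Local Open Scope complex_scope.
Local Open Scope ring_scope.


(** * Differential calculus in the plane *)

Section RealCalculus.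
Context {R : realType}.
Implicit Types (f g : 'rV[R]_2 -> R) (u v : 'rV[R]_2) (a b : 'I_2 -> R).

(** The charts of the surface are arbitrary, not conformal. So z is handled as a map [zeta] on the
    chart with complex partials [b k], the immersion has partials [rev (f * b k)], and holomorphy of
    a function q of z reads q_0 b_1 = q_1 b_0. When |q| is constant, conj(q) dq is purely imaginary
    and complex-linear, so dq = 0; two immersions are then compared by a vanishing gradient along
    segments. The hypothesis speaks only of points where all 1 - <n,V> are positive. Before z may be
    used near other points, these must be excluded by a limit argument ([normal_avoids]). Each point
    yields its own rho and Theta, and Theta is determined only modulo 2 pi. Parameters at
    neighbouring points are therefore compared through [kappa], and connectedness makes one pair
    valid everywhere. Since all punctures are real in z, conjugation preserves the punctured plane,
    and every sheet of the universal cover is parametrized by the same closed upper half-plane.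
    Simple connectedness is proved by pushing a loop out of its outermost sheets, one generation at
    a time. *)

Lemma ord2P (k : 'I_2) : k = 0 \/ k = 1.
Proof. by case: k => -[|[|//]] ?; [left|right]; exact/val_inj. Qed.

(** Differentiability is bundled with the gradient so that each calculus rule delivers both; the
    gradient is a free parameter, normalized afterwards by [dd_ext]. *)
Definition dd f u a := differentiable f u /\ forall k, pd k f u = a k.

Definition linform a (h : 'rV[R]_2) : R := a 0 * h 0 0 + a 1 * h 0 1.

Lemma sum2 (V : zmodType) (F : 'I_2 -> V) : \sum_k F k = F 0 + F 1.
Proof. by rewrite big_ord_recl big_ord1; congr (F _ + F _); exact/val_inj. Qed.

Lemma rV2E (h : 'rV[R]_2) : h = h 0 0 *: 'e_0 + h 0 1 *: 'e_1.
Proof. by rewrite {1}[h]row_sum_delta sum2. Qed.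

Lemma diff_linform f u : differentiable f u ->
  'd f u = linform (fun k => pd k f u) :> (_ -> _).
Proof.
move=> df; apply/funext => h; rewrite {1}[h]rV2E linearD !linearZ/=.
by rewrite /linform /pd !deriveE// ![_ *: _]mulrC.
Qed.

Lemma coord_le_norm (h : 'rV[R]_2) k : `|h 0 k| <= `|h|.
Proof. by rewrite [leRHS]/Num.Def.normr/= mx_normrE; apply: (le_bigmax _ _ (0, k)). Qed.

Lemma norm_le_coord (h : 'rV[R]_2) e : `|h 0 0| <= e -> `|h 0 1| <= e -> `|h| <= e.
Proof.
move=> h0 h1; have e0 : 0 <= e by apply: le_trans h0.
rewrite /Num.Def.normr/= mx_normrE (bigmax_le _ e0)//= => -[i j] _ /=.
by rewrite (ord1 i); case: (ord2P j) => ->.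
Qed.

(** The Fréchet condition with an explicit candidate gradient. It makes [dd] visibly local and
    supplies the first-order estimates of [schwarz]. *)
Lemma ddP f u a : dd f u a <-> forall e, 0 < e -> \forall v \near u,
  `|f v - f u - linform a (v - u)| <= e * `|v - u|.
Proof.
split=> [[df fa] e e0|H].
  have /eqaddoP/(_ e e0) := diff_locally df; rewrite diff_linform// => H0.
  have {H0} : \forall h \near (0 : 'rV[R]_2),
     `|f (h + u) - f u - linform a h| <= e * `|h|.
    near=> h; have : `|(f \o shift u - (cst (f u) + linform (fun k => pd k f u))) h|
      <= e * `|h| by near: h; exact: H0.
    by rewrite !fctE/= opprD addrA /linform !fa.
  rewrite (near_shift u 0); apply: filterS => v.
  by rewrite /= sub0r subrK.
have lina : linear (linform a).
  move=> k x y; rewrite /linform !mxE /=.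
  change (k *: (a 0 * x 0 0 + a 1 * x 0 1)) with (k * (a 0 * x 0 0 + a 1 * x 0 1)).
  by ring.
pose L : {linear 'rV[R]_2 -> R} := HB.pack (linform a) (GRing.isLinear.Build _ _ _ _ _ lina).
have cL : continuous L.
  move=> v; rewrite /L/= /linform.
  by apply: (@continuousD _ _ _ (fun h : 'rV[R]_2 => a 0 * h 0 0) (fun h : 'rV[R]_2 => a 1 * h 0 1));
   apply: continuousM; try exact: cst_continuous; exact: coord_continuous.
have fE : forall e, 0 < e -> \forall h \near (0 : 'rV[R]_2),
    `|(f \o shift u - (cst (f u) + L)) h| <= e * `|h|.
  move=> e e0; have := H e e0; rewrite (near_shift 0 u).
  apply: filterS => v; rewrite /=. move=> Q. rewrite !fctE /=.
  rewrite subr0 addrK in Q. rewrite opprD addrA. exact: Q.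
have dE : 'd f u = L :> (_ -> _) by apply: diff_unique => //; apply/eqaddoP.
have df : differentiable f u.
  by apply/diff_locallyP; rewrite dE; split=> //; apply/eqaddoP.
split=> // k; rewrite /pd deriveE// dE /L/= /linform !mxE/=.
by case: (ord2P k) => -> /=; rewrite ?mulr1 ?mulr0 ?addr0 ?add0r.
Unshelve. all: by end_near. Qed.

Lemma near_ball u (P : set 'rV[R]_2) : (\forall v \near u, P v) ->
  exists2 d : R, 0 < d & forall v, ball u d v -> P v.
Proof. by move=> /nbhs_ballP[d dp Hd]; exists d. Qed.

Lemma near_and (T : topologicalType) (u : T) (P Q : T -> Prop) :
  (\forall v \near u, P v) -> (\forall v \near u, Q v) ->
  \forall v \near u, P v /\ Q v.
Proof. by move=> hP hQ; apply: filterS2 hP hQ. Qed.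

Lemma dd_ext f u a b : dd f u a -> (forall k, a k = b k) -> dd f u b.
Proof. by move=> [df pf] ab; split=> // k; rewrite pf. Qed.

Lemma dd_pd f u : differentiable f u -> dd f u (fun k => pd k f u).
Proof. by []. Qed.

Lemma dd_diff f u a : dd f u a -> differentiable f u.
Proof. by case. Qed.

Lemma dd_cont f u a : dd f u a -> {for u, continuous f}.
Proof. by move=> [/differentiable_continuous]. Qed.

Lemma dd_near f g u a : (\forall v \near u, f v = g v) -> dd f u a -> dd g u a.
Proof.
move=> fg /ddP H; apply/ddP => e /H.
have fgu := nbhs_singleton fg.
by apply: filterS2 fg => v <-; rewrite fgu.
Qed.

Lemma dd_cst (c : R) u : dd (fun=> c) u (fun=> 0).
Proof.
split=> [|k]; first exact: differentiable_cst.
exact: derive_cst.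
Qed.

Lemma dd_coord i u : dd (fun v => v 0 i) u (fun k => (i == k)%:R).
Proof.
apply/ddP => e e0; near=> v; rewrite /linform !mxE.
case: (ord2P i) => -> /=; rewrite ?mul1r ?mul0r ?addr0 ?add0r subrr normr0;
  by rewrite mulr_ge0// ltW.
Unshelve. all: by end_near. Qed.

Lemma ddD f g u a b : dd f u a -> dd g u b ->
  dd (fun v => f v + g v) u (fun k => a k + b k).
Proof.
move=> [df fa] [dg gb]; split=> [|k]; first exact: differentiableD.
by rewrite -fa -gb; apply: deriveD; exact: diff_derivable.
Qed.

Lemma ddN f u a : dd f u a -> dd (fun v => - f v) u (fun k => - a k).
Proof.
move=> [df fa]; split=> [|k]; first exact: differentiableN.
by rewrite -fa; apply: deriveN; exact: diff_derivable.
Qed.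

Lemma ddB f g u a b : dd f u a -> dd g u b ->
  dd (fun v => f v - g v) u (fun k => a k - b k).
Proof. by move=> ? ?; apply: ddD => //; exact: ddN. Qed.

Lemma ddM f g u a b : dd f u a -> dd g u b ->
  dd (fun v => f v * g v) u (fun k => a k * g u + f u * b k).
Proof.
move=> [df fa] [dg gb]; split=> [|k]; first exact: differentiableM.
rewrite -fa -gb /pd (_ : (fun v => f v * g v) = f * g)// deriveM; try exact: diff_derivable.
rewrite addrC; congr (_ + _); exact: mulrC.
Qed.

Lemma dd_comp1 (g : R -> R) f u a l : is_derive (f u) 1 g l -> dd f u a ->
  dd (fun v => g (f v)) u (fun k => l * a k).
Proof.
move=> [dg gl] [df fa]; have dg' : differentiable g (f u) by exact/derivable1_diffP.
have dgf : differentiable (g \o f) u by exact: differentiable_comp.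
have Eg x : 'd g (f u) x = x * l.
  by rewrite -[x in LHS]mulr1 [in LHS]linearZ/= -deriveE// gl.
split=> // k; rewrite -fa /pd (@deriveE _ _ _ (g \o f))// diff_comp//= Eg -deriveE//.
exact: mulrC.
Qed.

Lemma ddV f u a : f u != 0 -> dd f u a ->
  dd (fun v => (f v)^-1) u (fun k => - a k / f u ^+ 2).
Proof.
move=> fu0 df.
have : is_derive (f u) 1 (fun x : R => x^-1) (- (f u) ^- 2).
  apply: is_derive_eq; first exact: (@is_deriveV _ id).
  by rewrite /= scaleNr scaler1.
by move=> dV; apply: dd_ext (dd_comp1 dV df) _ => k; rewrite mulNr mulrC -mulNr.
Qed.

Lemma dd_sqrt f u a : 0 < f u -> dd f u a ->
  dd (fun v => Num.sqrt (f v)) u (fun k => a k / (2 * Num.sqrt (f u))).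
Proof.
move=> fu0 df; have dsq := is_derive1_sqrt fu0.
by apply: dd_ext (dd_comp1 dsq df) _ => k; rewrite mulrC.
Qed.

Lemma differentiable_row n (r : 'rV[R]_2 -> 'rV[R]_n.+1) u :
  differentiable r u <-> forall j, differentiable (fun v => r v 0 j) u.
Proof.
split=> [dr j|H].
  exact: (@differentiable_comp _ _ _ _ r (fun x : 'rV[R]_n.+1 => x 0 j) u dr (differentiable_coord _ _ _)).
rewrite (_ : r = \sum_(j < n.+1) (fun v => r v 0 j *: 'e_j)).
  by apply: differentiable_sum => j; apply: differentiableZl.
by apply/funext => v; rewrite {1}[r v]row_sum_delta fct_sumE.
Qed.

Lemma pd_row n (r : 'rV[R]_2 -> 'rV[R]_n.+1) u k j : differentiable r u ->
  pd k r u 0 j = pd k (fun v => r v 0 j) u.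
Proof. by move=> dr; rewrite /pd derive_mx ?mxE//; exact: diff_derivable. Qed.

Lemma dd_comp2 f (Z : 'rV[R]_2 -> 'rV[R]_2) u a (b : 'I_2 -> 'I_2 -> R) :
  dd f (Z u) a -> (forall i, dd (fun v => Z v 0 i) u (b i)) ->
  dd (fun v => f (Z v)) u (fun k => a 0 * b 0 k + a 1 * b 1 k).
Proof.
move=> [df fa] dZ; have dZ' : differentiable Z u.
  by apply/differentiable_row => j; have [] := dZ j.
have dfZ : differentiable (f \o Z) u by exact: differentiable_comp.
split=> // k; rewrite /pd deriveE// diff_comp//= -(deriveE _ dZ') diff_linform//.
rewrite /linform !fa; have e i : ('D_('e_k) Z u) 0 i = b i k.
  by rewrite -[LHS]/(pd k Z u 0 i) pd_row// (dZ i).2.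
by rewrite !e.
Qed.

Lemma dd_shift f u w a : dd f (u + w) a -> dd (fun v => f (v + w)) u a.
Proof.
move=> df; have H i : dd (fun v => (v + w) 0 i) u (fun k => (i == k)%:R).
  apply: (@dd_near (fun v => v 0 i + w 0 i)).
    by near=> v; rewrite mxE.
  by apply: dd_ext (ddD (dd_coord i u) (dd_cst _ _)) _ => k; rewrite addr0.
apply: dd_ext (dd_comp2 (Z := fun v => v + w) df H) _ => k.
by case: (ord2P k) => -> /=; rewrite !(mulr0, mulr1) ?addr0 ?add0r.
Unshelve. all: by end_near. Qed.

(** The one-variable mean value theorem applied to the restriction of [f] to the segment. *)
Lemma MVT2 f u v :
  (forall t : R, 0 <= t <= 1 -> differentiable f (u + t *: (v - u))) ->
  exists2 t : R, 0 < t < 1 &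
    f v - f u = linform (fun k => pd k f (u + t *: (v - u))) (v - u).
Proof.
move=> df; pose phi (t : R) := f (u + t *: (v - u)).
have dphi (t : R) : 0 <= t <= 1 ->
    is_derive t 1 phi (linform (fun k => pd k f (u + t *: (v - u))) (v - u)).
  move=> t01; have dl : is_diff t (fun s : R => u + s *: (v - u)) (fun s : R => s *: (v - u)).
    apply: is_diff_eq.
    by rewrite add0r.
  have dc : differentiable (f \o (fun s : R => u + s *: (v - u))) t.
    by apply: differentiable_comp; [apply: ex_diff|apply: df].
  split; first exact/derivable1_diffP.
  rewrite deriveE// diff_comp//=; last exact: df.
  by rewrite diff_val scale1r diff_linform//; exact: df.
have [||c c01 E] := @MVT _ phi
    (fun t => linform (fun k => pd k f (u + t *: (v - u))) (v - u)) 0 1 ltr01.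
- by move=> x; rewrite in_itv/= => /andP[x0 x1]; apply: dphi; rewrite !ltW.
- apply: continuous_in_subspaceT => t; rewrite inE/= in_itv/= => t01.
  by apply: differentiable_continuous; apply/derivable1_diffP; have [] := dphi t t01.
exists c; first by move: c01; rewrite in_itv.
by move: E; rewrite /phi scale1r scale0r addr0 (addrC u (v - u)) subrK subr0 mulr1.
Qed.

Lemma zero_pd_segment f u v :
  (forall t : R, 0 <= t <= 1 -> dd f (u + t *: (v - u)) (fun=> 0)) -> f v = f u.
Proof.
move=> H; have [t t01|t /andP[t0 t1] E] := @MVT2 f u v; first exact: dd_diff (H t t01).
have t01 : 0 <= t <= 1 by rewrite !ltW.
have [_ H'] := H t t01.
by apply/eqP; rewrite -subr_eq0 E /linform !H' !mul0r addr0.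
Qed.

Lemma ball_segment u v w (d t : R) : ball u d v -> ball u d w -> 0 <= t <= 1 ->
  ball u d (v + t *: (w - v)).
Proof.
rewrite -!ball_normE /= => vd wd /andP[t0 t1].
rewrite (_ : u - _ = (1 - t) *: (u - v) + t *: (u - w)); last first.
  by apply/rowP => i; rewrite !mxE; ring.
apply: le_lt_trans (ler_normD _ _) _; rewrite !normrZ (ger0_norm t0) ger0_norm ?subr_ge0//.
have [->|tn0] := eqVneq t 0; first by rewrite subr0 mul1r mul0r addr0.
have tp : 0 < t by rewrite lt0r tn0.
rewrite -[ltRHS](_ : (1 - t) * d + t * d = d); last by ring.
by rewrite ler_ltD ?ler_wpM2l ?subr_ge0 ?ltr_pM2l// ltW.
Qed.

(** The estimate shared by the two evaluations of the second difference in [schwarz]: [p] and [q]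
    are values of a first partial at two points whose linear approximations [A], [B] differ by
    [a1 * h]. The two conclusions are the same bound for a displacement along ['e_0] and along
    ['e_1]. *)
Lemma second_diff_bound (p q c A B h e a1 r : R) : 0 < h ->
  `|p - c - A| <= e * h -> `|q - c - B| <= e * h -> A - B = a1 * h ->
  `|(p - q) * (h * 1) + r * (h * 0) - h ^+ 2 * a1| <= 2 * e * h ^+ 2 /\
  `|r * (h * 0) + (p - q) * (h * 1) - h ^+ 2 * a1| <= 2 * e * h ^+ 2.
Proof.
move=> hp pA qB AB; rewrite !mulr1 !mulr0 addr0 add0r.
have -> : (p - q) * h - h ^+ 2 * a1 = h * ((p - c - A) - (q - c - B)).
  by rewrite expr2 -mulrA (mulrC h a1) -AB; ring.
rewrite normrM (gtr0_norm hp) (_ : 2 * e * h ^+ 2 = h * (e * h + e * h)); last by ring.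
by split; rewrite ler_wpM2l ?(ltW hp)// (le_trans (ler_normB _ _))// lerD.
Qed.

(** The second difference of [f] over a square of side [h] is [h ^+ 2] times either mixed
    derivative, up to [2 * e * h ^+ 2]: the mean value theorem is used in one direction and the
    linear approximation at [u] of a first partial in the other. *)
Lemma schwarz f u : (\forall v \near u, differentiable f v) ->
  differentiable (pd 0 f) u -> differentiable (pd 1 f) u ->
  pd 0 (pd 1 f) u = pd 1 (pd 0 f) u.
Proof.
move=> df d0 d1; apply/eqP; rewrite -subr_eq0 -normr_le0.
apply/ler_addgt0Pr => e4 e40; rewrite add0r.
(* Each of the two estimates of the second difference costs [2 * e]. *)
have [e eE] : exists e : R, e4 = 4 * e by exists (e4 / 4); field.
have e0 : 0 < e by move: e40; rewrite eE; lra.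
have [a aE] : exists a : 'I_2 -> R, forall k, pd k (pd 0 f) u = a k by exists (fun k => pd k (pd 0 f) u).
have [b bE] : exists b : 'I_2 -> R, forall k, pd k (pd 1 f) u = b k by exists (fun k => pd k (pd 1 f) u).
have /ddP/(_ e e0) H0 : dd (pd 0 f) u a by split.
have /ddP/(_ e e0) H1 : dd (pd 1 f) u b by split.
have [d dp Hd] := near_ball (near_and df (near_and H0 H1)).
have [h hE] : exists h : R, d = 2 * h by exists (d / 2); field.
have hp : 0 < h by move: dp; rewrite hE; lra.
have ballP x y : `|x| <= h -> `|y| <= h -> ball u d (u + x *: 'e_0 + y *: 'e_1).
  move=> xh yh; rewrite -ball_normE/=.
  apply: (@le_lt_trans _ _ h); last by rewrite hE; lra.
  apply: norm_le_coord; rewrite !mxE/= !(mulr1, mulr0, addr0, add0r).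
    by rewrite opprD addrA subrr add0r normrN.
  by rewrite opprD addrA subrr add0r normrN.
have bound k (i : 'I_2) (c : 'I_2 -> R) x y :
    (forall v, ball u d v -> `|pd i f v - pd i f u - linform c (v - u)| <= e * `|v - u|) ->
    0 <= x <= h -> 0 <= y <= h -> k = (x, y) ->
    `|pd i f (u + x *: 'e_0 + y *: 'e_1) - pd i f u - (c 0 * x + c 1 * y)| <= e * h.
  move=> H /andP[x0 xh] /andP[y0 yh] _.
  have Hb := ballP x y; rewrite !ger0_norm// in Hb.
  have := H _ (Hb xh yh); rewrite /linform !mxE/= !(mulr1, mulr0, addr0, add0r).
  rewrite (_ : u 0 0 + x - u 0 0 = x); last by ring.
  rewrite (_ : u 0 1 + y - u 0 1 = y); last by ring.
  move=> /le_trans; apply; rewrite ler_wpM2l ?(ltW e0)//.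
  by apply: norm_le_coord; rewrite !mxE/= !(mulr1, mulr0, addr0, add0r) [X in `|X|]addrAC subrr add0r ger0_norm.
pose S := f (u + h *: 'e_0 + h *: 'e_1) - f (u + h *: 'e_0 + 0 *: 'e_1) -
  f (u + 0 *: 'e_0 + h *: 'e_1) + f (u + 0 *: 'e_0 + 0 *: 'e_1).
have S0 : `|S - h ^+ 2 * a 1| <= 2 * e * h ^+ 2.
  pose g v := f (v + h *: 'e_1) - f (v + 0 *: 'e_1).
  have dg t : 0 <= t <= h -> dd g (u + t *: 'e_0)
     (fun k => pd k f (u + t *: 'e_0 + h *: 'e_1) - pd k f (u + t *: 'e_0 + 0 *: 'e_1)).
    move=> /andP[t0 th].
    by apply: ddB; apply: dd_shift; apply: dd_pd; apply: (Hd _ _).1;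
      apply: ballP; rewrite ?normr0 ?ger0_norm// ltW.
  have E0 : u + h *: 'e_0 - (u + 0 *: 'e_0) = h *: ('e_0 : 'rV[R]_2).
    by rewrite scale0r addr0 addrAC subrr add0r.
  have [t t01|t /andP[t0 t1] E] := @MVT2 g (u + 0 *: 'e_0) (u + h *: 'e_0).
    rewrite E0 scale0r addr0 scalerA; case/andP: t01 => t0 t1.
    by apply: dd_diff (dg _ _); rewrite mulr_ge0 ?ler_piMl//= ltW.
  rewrite E0 in E.
  rewrite scale0r addr0 scalerA in E.
  have th : 0 <= t * h <= h by rewrite mulr_ge0 ?ler_piMl//= ltW.
  have [_ Eg] := dg _ th.
  have SE : S = g (u + h *: 'e_0) - g (u + 0 *: 'e_0) by rewrite /S /g; ring.
  rewrite scale0r addr0 in SE.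
  rewrite SE E /linform !Eg !mxE/=.
  have hh : 0 <= h <= h by rewrite lexx ltW.
  have zh : 0 <= (0 : R) <= h by rewrite lexx ltW.
  have B1 := bound _ 0 a _ _ (fun v vb => (Hd v vb).2.1) th hh erefl.
  have B2 := bound _ 0 a _ _ (fun v vb => (Hd v vb).2.1) th zh erefl.
  have L : (a 0 * (t * h) + a 1 * h) - (a 0 * (t * h) + a 1 * 0) = a 1 * h by ring.
  exact: (second_diff_bound _ hp B1 B2 L).1.
have S1 : `|S - h ^+ 2 * b 0| <= 2 * e * h ^+ 2.
  pose g v := f (v + h *: 'e_0) - f (v + 0 *: 'e_0).
  have dg t : 0 <= t <= h -> dd g (u + t *: 'e_1)
     (fun k => pd k f (u + h *: 'e_0 + t *: 'e_1) - pd k f (u + 0 *: 'e_0 + t *: 'e_1)).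
    move=> /andP[t0 th].
    by rewrite ![u + _ *: 'e_0 + _]addrAC; apply: ddB; apply: dd_shift; apply: dd_pd; apply: (Hd _ _).1;
      rewrite addrAC; apply: ballP; rewrite ?normr0 ?ger0_norm// ltW.
  have E0 : u + h *: 'e_1 - (u + 0 *: 'e_1) = h *: ('e_1 : 'rV[R]_2).
    by rewrite scale0r addr0 addrAC subrr add0r.
  have [t t01|t /andP[t0 t1] E] := @MVT2 g (u + 0 *: 'e_1) (u + h *: 'e_1).
    rewrite E0 scale0r addr0 scalerA; case/andP: t01 => t0 t1.
    by apply: dd_diff (dg _ _); rewrite mulr_ge0 ?ler_piMl//= ltW.
  rewrite E0 in E.
  rewrite scale0r addr0 scalerA in E.
  have th : 0 <= t * h <= h by rewrite mulr_ge0 ?ler_piMl//= ltW.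
  have [_ Eg] := dg _ th.
  have SE : S = g (u + h *: 'e_1) - g (u + 0 *: 'e_1).
    by rewrite /S /g ![u + _ *: 'e_1 + _]addrAC; ring.
  rewrite scale0r addr0 in SE.
  rewrite SE E /linform !Eg !mxE/=.
  have hh : 0 <= h <= h by rewrite lexx ltW.
  have zh : 0 <= (0 : R) <= h by rewrite lexx ltW.
  have B1 := bound _ 1 b _ _ (fun v vb => (Hd v vb).2.2) hh th erefl.
  have B2 := bound _ 1 b _ _ (fun v vb => (Hd v vb).2.2) zh th erefl.
  have L : (b 0 * h + b 1 * (t * h)) - (b 0 * 0 + b 1 * (t * h)) = b 0 * h by ring.
  exact: (second_diff_bound _ hp B1 B2 L).2.
have h2 : 0 < h ^+ 2 by rewrite exprn_gt0.
rewrite bE aE.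
rewrite distrC -(ler_pM2l h2) -{1}(gtr0_norm h2) -normrM.
have -> : h ^+ 2 * (a 1 - b 0) = (S - h ^+ 2 * b 0) - (S - h ^+ 2 * a 1) by ring.
have -> : h ^+ 2 * e4 = 2 * e * h ^+ 2 + 2 * e * h ^+ 2 by rewrite eE; ring.
by rewrite (le_trans (ler_normB _ _))// lerD.
Qed.

End RealCalculus.

(** * The inverse function theorem in the plane *)

HB.instance Definition _ (R : realType) n := Complete.on 'rV[R]_n.+1.

Section LocalDiffeo.
Context {R : realType}.

Lemma le_half_le0 (x : R) : x <= x / 2 -> x <= 0.
Proof. lra. Qed.

(** Newton iteration with the inverse Jacobian frozen at [u0]: near [u0] the map
    [x |-> x - Jinv (Z x)] contracts distances by 1/2 ([key]). Injectivity is immediate, and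
    openness follows because the fixed points of [x |-> x + Jinv (y - Z x)] are the solutions of
    [Z x = y]. *)
Lemma local_diffeo (Z : 'rV[R]_2 -> 'rV[R]_2) (O : set 'rV[R]_2) u0 :
  let z i v := Z v 0 i in
  open O -> O u0 -> (forall v, O v -> forall i, differentiable (z i) v) ->
  (forall i k, {for u0, continuous (pd k (z i))}) ->
  pd 0 (z 0) u0 * pd 1 (z 1) u0 - pd 1 (z 0) u0 * pd 0 (z 1) u0 != 0 ->
  exists2 d, 0 < d & ball u0 d `<=` O /\ open_embedding (ball u0 d) Z.
Proof.
move=> z oO Ou0 dz cz det0; have [a aE] : exists a : 'I_2 -> 'I_2 -> R, forall i k, pd k (z i) u0 = a i k by exists (fun i k => pd k (z i) u0).
pose D := a 0 0 * a 1 1 - a 0 1 * a 1 0.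
have D0 : D != 0 by move: det0; rewrite !aE.
pose Jinv (y : 'rV[R]_2) : 'rV[R]_2 :=
  \row_i (if i == 0 then (a 1 1 * y 0 0 - a 0 1 * y 0 1) / D
          else (a 0 0 * y 0 1 - a 1 0 * y 0 0) / D).
(* A bound for the norm of [Jinv] in the sup norm, made positive by the added 1. *)
pose M := (`|a 0 0| + `|a 0 1| + `|a 1 0| + `|a 1 1| + 1) / `|D|.
have Mp : 0 < M by rewrite divr_gt0 ?normr_gt0// ltr_wpDl// ?addr_ge0.
have Jinvb y : `|Jinv y| <= M * `|y|.
  have H (p q : R) (i j : 'I_2) : `|p| + `|q| <= M * `|D| -> `|(p * y 0 i - q * y 0 j) / D| <= M * `|y|.
    move=> pq; rewrite normrM normfV ler_pdivrMr ?normr_gt0//.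
    rewrite (le_trans (ler_normB _ _))// !normrM mulrAC.
    apply: (@le_trans _ _ ((`|p| + `|q|) * `|y|)); last by rewrite ler_wpM2r.
    by rewrite mulrDl lerD// ler_wpM2l// coord_le_norm.
  have MD : M * `|D| = `|a 0 0| + `|a 0 1| + `|a 1 0| + `|a 1 1| + 1.
    by rewrite divfK// normr_eq0.
  have sum4 (p q r t : R) : 0 <= p -> 0 <= q -> 0 <= r -> 0 <= t ->
    t + q <= p + q + r + t + 1 /\ p + r <= p + q + r + t + 1.
    by clear; move=> *; split; lra.
  have [s1 s2] := sum4 _ _ _ _ (normr_ge0 (a 0 0)) (normr_ge0 (a 0 1)) (normr_ge0 (a 1 0)) (normr_ge0 (a 1 1)).
  by apply: norm_le_coord; rewrite mxE; [apply: (H (a 1 1) (a 0 1) 0 1)|apply: (H (a 0 0) (a 1 0) 1 0)];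
    rewrite MD.
(* Two partials, each off by at most [e], give an error [2 * e] per unit length, which [Jinv]
   magnifies at most [M] times: the product is 1/2. *)
pose e := (4 * M)^-1; have ep : 0 < e by rewrite invr_gt0 mulr_gt0.
have [d dp Hd] : exists2 d : R, 0 < d & forall v, ball u0 d v ->
    O v /\ forall i k, `|pd k (z i) v - a i k| <= e.
  have H i k : \forall v \near u0, `|pd k (z i) v - a i k| <= e.
    have /cvgrPdist_le/(_ e ep) := cz i k; rewrite aE.
    by apply: filterS => v; rewrite distrC.
  apply: near_ball; near=> v; split; first by near: v; exact: open_nbhs_nbhs.
  by move=> i k; case: (ord2P i) => ->; case: (ord2P k) => ->; near: v; exact: H.
have key x y : ball u0 d x -> ball u0 d y ->
    `|(x - y) - Jinv (Z x - Z y)| <= `|x - y| / 2.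
  move=> bx by_; have E i : `|(Z x - Z y) 0 i - linform (a i) (x - y)| <= 2 * e * `|x - y|.
    have bt (t : R) : 0 <= t <= 1 -> ball u0 d (y + t *: (x - y)) by exact: ball_segment.
    have [t t01|t /andP[t0 t1] E] := MVT2 (f := z i) (u := y) (v := x).
      by apply: dz; apply: (Hd _ _).1; apply: bt.
    have t01 : 0 <= t <= 1 by rewrite !ltW.
    have [_ Hpd] := Hd _ (bt t t01).
    rewrite !mxE -/(z i x) -/(z i y) E /linform.
    set p0 := pd 0 _ _; set p1 := pd 1 _ _.
    rewrite (_ : _ - _ = (p0 - a i 0) * (x - y) 0 0 + (p1 - a i 1) * (x - y) 0 1); last by ring.
    rewrite (_ : 2 * e * `|x - y| = e * `|x - y| + e * `|x - y|); last by ring.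
    rewrite (le_trans (ler_normD _ _))// !normrM.
    by rewrite lerD// ler_pM ?coord_le_norm//; apply: Hpd.
  have -> : (x - y) - Jinv (Z x - Z y) = - Jinv (\row_i ((Z x - Z y) 0 i - linform (a i) (x - y))).
    apply/rowP => i; rewrite !mxE /linform /=; case: (ord2P i) => -> /=; rewrite !mxE/=;
    by move: D0; rewrite /D => D0; field.
  rewrite normrN (le_trans (Jinvb _))//.
  apply: (@le_trans _ _ (M * (2 * e * `|x - y|))).
    by rewrite ler_wpM2l ?(ltW Mp)//; apply: norm_le_coord; rewrite mxE.
  by rewrite /e le_eqVlt; apply/orP; left; apply/eqP; field; rewrite gt_eqF.
have contz v : O v -> {for v, continuous Z}.
  move=> Ov; apply: differentiable_continuous; apply/differentiable_row => j; exact: dz.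
exists d => //; split; first by move=> v /Hd[].
split.
- exact: ball_open.
- move=> x y; rewrite !inE => bx by_ Zxy; have := key _ _ bx by_.
  rewrite Zxy subrr (_ : Jinv 0 = 0) ?subr0; last first.
    by apply/rowP => i; rewrite !mxE/= !mulr0 subr0 !mul0r; case: ifP.
  move=> H; apply/eqP; rewrite -subr_eq0 -normr_le0.
  exact: le_half_le0 H.
- by move=> v /Hd[Ov _]; apply: contz.
move=> W Wb oW; rewrite openE => _ [u Wu <-]; rewrite /interior.
have [r rp Hr] : exists2 r : R, 0 < r & forall v, ball u r v -> W v.
  by apply: near_ball; apply: open_nbhs_nbhs.
pose s := r / 2; have sp : 0 < s by rewrite divr_gt0.
pose U := [set v : 'rV[R]_2 | `|u - v| <= s].
have UW : U `<=` W.
  by move=> v /= uv; apply: Hr; rewrite -ball_normE/=; rewrite (le_lt_trans uv)// /s ltr_pdivrMr// ltr_pMr// ltr1n.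
(* For [y] within this distance of [Z u] the first Newton step from [u] is at most [s / 2], so that
   the iteration stays in the closed ball [U]. *)
apply/nbhs_ballP; exists (s / (2 * M)); first by rewrite /= divr_gt0// mulr_gt0.
move=> y; rewrite -ball_normE/= => /ltW yZu.
pose g x := x + Jinv (y - Z x).
have JinvB p q : Jinv (p - q) = Jinv p - Jinv q.
  by apply/rowP => i; rewrite !mxE; case: ifP => _; rewrite ?mxE; ring.
have gU : set_fun U U g.
  move=> x Ux; rewrite /U/=.
  have -> : u - g x = ((u - x) - Jinv (Z u - Z x)) + Jinv (Z u - y).
    rewrite /g !JinvB; move: (Jinv y) (Jinv (Z x)) (Jinv (Z u)) => A B C.
    by apply/rowP => i; rewrite !mxE; ring.
  rewrite (le_trans (ler_normD _ _))//.
  rewrite [leRHS](_ : s = s / 2 + s / 2); last by field.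
  rewrite lerD//; last first.
    rewrite (le_trans (Jinvb _))// -ler_pdivlMl//.
    by rewrite (le_trans yZu)// le_eqVlt; apply/orP; left; apply/eqP; field; rewrite gt_eqF.
  rewrite (le_trans (key _ _ _ _))//; [exact: Wb|by apply: Wb; apply: UW|].
  by rewrite ler_pM2r// invr_gt0.
pose gf : {fun U >-> U} := HB.pack g (isFun.Build _ _ U U g gU).
have gc : is_contraction gf.
  exists (NngNum (ltW (divr_gt0 (@ltr01 R) (ltr0n R 2)))); split=> /=; first lra.
  move=> [x x'] /= [Ux Ux'].
  have -> : g x - g x' = (x - x') - Jinv (Z x - Z x').
    rewrite /g !JinvB; move: (Jinv y) (Jinv (Z x)) (Jinv (Z x')) => A B C.
    by apply/rowP => i; rewrite !mxE; ring.
  by rewrite (le_trans (key _ _ _ _))//; try (apply: Wb; exact: UW); rewrite mulrC div1r.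
have [||x Ux gx] := banach_fixed_point gc.
- rewrite (_ : U = [set v | closed_ball_ (fun x => `|x|) u s v])//.
  exact: closed_closed_ball_.
- by exists u; rewrite /U /= subrr normr0 ltW.
exists x; first exact: UW.
have J0 : Jinv (y - Z x) = 0.
  by have := gx; rewrite /gf/= /g => /eqP; rewrite -subr_eq0 opprD addrA subrr add0r oppr_eq0 => /eqP.
have e0 := congr1 (fun v : 'rV[R]_2 => v 0 0) J0.
have e1 := congr1 (fun v : 'rV[R]_2 => v 0 1) J0.
rewrite !mxE/= in e0 e1.
have {e0} e0 := mulIf (invr_neq0 D0) (etrans e0 (esym (mul0r _))).
have {e1} e1 := mulIf (invr_neq0 D0) (etrans e1 (esym (mul0r _))).
apply/esym/eqP; rewrite -subr_eq0; apply/eqP/rowP => i.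
case: (ord2P i) => ->; rewrite !mxE; apply: (mulIf D0); rewrite mul0r /D.
- transitivity (a 0 0 * 0 + a 0 1 * 0 : R); last by rewrite !mulr0 addr0.
  by rewrite -{1}e0 -e1; ring.
- transitivity (a 1 0 * 0 + a 1 1 * 0 : R); last by rewrite !mulr0 addr0.
  by rewrite -{1}e0 -e1; ring.
Unshelve. all: by end_near. Qed.

End LocalDiffeo.

(** * Complex derivatives and the principal logarithm *)

Section ComplexCalculus.
Context {R : realType}.
Implicit Types (F G : 'rV[R]_2 -> R[i]) (u : 'rV[R]_2) (a b : 'I_2 -> R[i]).
Local Notation Re := complex.Re.
Local Notation Im := complex.Im.

Lemma cReM (x y : R[i]) : Re (x * y) = Re x * Re y - Im x * Im y.
Proof. by case: x; case: y. Qed.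
Lemma cImM (x y : R[i]) : Im (x * y) = Re x * Im y + Im x * Re y.
Proof. by case: x; case: y. Qed.
Lemma cReD (x y : R[i]) : Re (x + y) = Re x + Re y. Proof. by case: x; case: y. Qed.
Lemma cImD (x y : R[i]) : Im (x + y) = Im x + Im y. Proof. by case: x; case: y. Qed.
Lemma cReN (x : R[i]) : Re (- x) = - Re x. Proof. by case: x. Qed.
Lemma cImN (x : R[i]) : Im (- x) = - Im x. Proof. by case: x. Qed.
Lemma cReV (x : R[i]) : Re x^-1 = Re x / (Re x ^+ 2 + Im x ^+ 2). Proof. by case: x. Qed.
Lemma cImV (x : R[i]) : Im x^-1 = - Im x / (Re x ^+ 2 + Im x ^+ 2).
Proof. by case: x => p q; rewrite /GRing.inv/= mulNr. Qed.
Lemma eq_complexP (x y : R[i]) : Re x = Re y -> Im x = Im y -> x = y.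
Proof. by case: x; case: y => /= ? ? ? ? -> ->. Qed.
Lemma complex_neq0 (x : R[i]) : (x != 0) = (0 < Re x ^+ 2 + Im x ^+ 2).
Proof.
case: x => p q /=; rewrite eq_complex/= negb_and lt0r.
by rewrite addr_ge0 ?sqr_ge0// andbT paddr_eq0 ?sqr_ge0// !sqrf_eq0 negb_and.
Qed.

Definition cdd F u a := dd (fun v => Re (F v)) u (fun k => Re (a k)) /\
  dd (fun v => Im (F v)) u (fun k => Im (a k)).

Lemma cdd_cpd F u a : cdd F u a -> cdifferentiable F u /\ forall k, cpd k F u = a k.
Proof.
move=> [[d1 e1] [d2 e2]]; split=> // k; rewrite /cpd e1 e2; by case: (a k).
Qed.

Lemma cdd_ext F u a b : cdd F u a -> (forall k, a k = b k) -> cdd F u b.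
Proof. by move=> [h1 h2] ab; split; [apply: dd_ext h1 _|apply: dd_ext h2 _] => k; rewrite ab. Qed.

Lemma cdd_near F G u a : (\forall v \near u, F v = G v) -> cdd F u a -> cdd G u a.
Proof. by move=> FG [h1 h2]; split; [apply: dd_near h1|apply: dd_near h2]; apply: filterS FG => v ->. Qed.

Lemma cdd_fun F G u a : F =1 G -> cdd F u a -> cdd G u a.
Proof. by move=> FG; apply: cdd_near; apply: filterE. Qed.

Lemma cdd_cst (c : R[i]) u : cdd (fun=> c) u (fun=> 0).
Proof. by split; apply: dd_cst. Qed.

Lemma cddD F G u a b : cdd F u a -> cdd G u b ->
  cdd (fun v => F v + G v) u (fun k => a k + b k).
Proof.
move=> [f1 f2] [g1 g2]; split.
  apply: dd_ext (dd_near _ (ddD f1 g1)) _; last by move=> k; rewrite cReD.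
  by apply: filterE => v; rewrite cReD.
apply: dd_ext (dd_near _ (ddD f2 g2)) _; last by move=> k; rewrite cImD.
by apply: filterE => v; rewrite cImD.
Qed.

Lemma cddM F G u a b : cdd F u a -> cdd G u b ->
  cdd (fun v => F v * G v) u (fun k => a k * G u + F u * b k).
Proof.
move=> [f1 f2] [g1 g2]; split.
  apply: dd_ext (dd_near _ (ddB (ddM f1 g1) (ddM f2 g2))) _.
    by apply: filterE => v; rewrite cReM.
  by move=> k /=; rewrite cReD !cReM; ring.
apply: dd_ext (dd_near _ (ddD (ddM f1 g2) (ddM f2 g1))) _.
  by apply: filterE => v; rewrite cImM.
by move=> k /=; rewrite cImD !cImM; ring.
Qed.

Lemma cddZ c F u a : cdd F u a -> cdd (fun v => c * F v) u (fun k => c * a k).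
Proof. by move=> /(cddM (cdd_cst c u))/cdd_ext; apply=> k; rewrite mul0r add0r. Qed.

Lemma cddN F u a : cdd F u a -> cdd (fun v => - F v) u (fun k => - a k).
Proof.
move=> /(cddZ (-1))/cdd_ext h; apply: cdd_fun (h (fun k => - a k) _) => [v|k]; by rewrite mulN1r.
Qed.

Lemma cddV F u a : F u != 0 -> cdd F u a ->
  cdd (fun v => (F v)^-1) u (fun k => - a k / F u ^+ 2).
Proof.
move=> Fu0 [f1 f2]; have n0 : Re (F u) ^+ 2 + Im (F u) ^+ 2 != 0.
  by rewrite gt_eqF// -complex_neq0.
have dn := ddD (ddM f1 f1) (ddM f2 f2).
have dnV := ddV (n0 : Re (F u) * Re (F u) + Im (F u) * Im (F u) != 0) dn.
have E k : - a k / F u ^+ 2 = (- a k) * ((F u)^-1 * (F u)^-1) by rewrite -exprVn expr2.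
split.
  apply: dd_ext (dd_near _ (ddM f1 dnV)) _.
    by apply: filterE => v; rewrite cReV !expr2.
  move=> k; rewrite E !cReM !cImM !cReN !cImN cReV cImV !expr2.
  by move: n0; rewrite !expr2 => n0; field.
apply: dd_ext (dd_near _ (ddM (ddN f2) dnV)) _.
  by apply: filterE => v; rewrite cImV !expr2 mulNr.
move=> k; rewrite E !cImM !cReM !cReN !cImN cReV cImV !expr2.
by move: n0; rewrite !expr2 => n0; field.
Qed.

Lemma cdd_comp2 F (Z : 'rV[R]_2 -> 'rV[R]_2) u a (b : 'I_2 -> 'I_2 -> R) :
  cdd F (Z u) a -> (forall i, dd (fun v => Z v 0 i) u (b i)) ->
  cdd (fun v => F (Z v)) u (fun k => a 0 * (b 0 k)%:C + a 1 * (b 1 k)%:C).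
Proof.
move=> [f1 f2] dZ; split.
  by apply: dd_ext (dd_comp2 f1 dZ) _ => k; rewrite cReD !cReM/= !mulr0 !subr0.
by apply: dd_ext (dd_comp2 f2 dZ) _ => k; rewrite cImD !cImM/= !mulr0 !add0r.
Qed.

Definition cof u : R[i] := u 0 0 +i* u 0 1.

Definition rof (z : R[i]) : 'rV[R]_2 := \row_k (if k == 0 then Re z else Im z).

Lemma rofK : cancel rof cof. Proof. by case=> x y; rewrite /cof !mxE. Qed.
Lemma cofK : cancel cof rof.
Proof. by move=> u; apply/rowP => k; case: (ord2P k) => ->; rewrite mxE. Qed.

Definition dir (k : 'I_2) : R[i] := if k == 0 then 1 else 'i%C.

(** The Cauchy-Riemann equations: the partials along the two axes are [d] and i times [d], so [d] is
    the complex derivative. *)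
Definition hol F u d := cdd F u (fun k => d * dir k).

Lemma hol_ext F u d e : hol F u d -> d = e -> hol F u e.
Proof. by move=> h <-. Qed.

Lemma hol_near F G u d : (\forall v \near u, F v = G v) -> hol F u d -> hol G u d.
Proof. exact: cdd_near. Qed.

Lemma hol_fun F G u d : F =1 G -> hol F u d -> hol G u d.
Proof. exact: cdd_fun. Qed.

Lemma hol_cst c u : hol (fun=> c) u 0.
Proof. by apply: cdd_ext (cdd_cst c u) _ => k; rewrite mul0r. Qed.

Lemma hol_id u : hol cof u 1.
Proof.
split; [apply: dd_ext (dd_coord 0 u) _|apply: dd_ext (dd_coord 1 u) _] => k; rewrite mul1r;
  by case: (ord2P k) => ->.
Qed.

Lemma holD F G u d e : hol F u d -> hol G u e -> hol (fun v => F v + G v) u (d + e).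
Proof. by move=> /cddD f /f/cdd_ext; apply=> k; rewrite mulrDl. Qed.

Lemma holN F u d : hol F u d -> hol (fun v => - F v) u (- d).
Proof. by move=> /cddN/cdd_ext; apply=> k; rewrite mulNr. Qed.

Lemma holB F G u d e : hol F u d -> hol G u e -> hol (fun v => F v - G v) u (d - e).
Proof. by move=> ? ?; apply: holD => //; exact: holN. Qed.

Lemma holM F G u d e : hol F u d -> hol G u e ->
  hol (fun v => F v * G v) u (d * G u + F u * e).
Proof. by move=> /cddM f /f/cdd_ext; apply=> k; ring. Qed.

Lemma holZ c F u d : hol F u d -> hol (fun v => c * F v) u (c * d).
Proof. by move=> /(cddZ c)/cdd_ext; apply=> k; rewrite mulrA. Qed.

Lemma holV F u d : F u != 0 -> hol F u d -> hol (fun v => (F v)^-1) u (- d / F u ^+ 2).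
Proof. by move=> F0 /(cddV F0)/cdd_ext; apply=> k; rewrite -mulNr mulrAC. Qed.

(** Only the outer function is holomorphic; [Z] is any differentiable map, such as the Gauss
    coordinate in a non-conformal chart. *)
Lemma hol_comp F (Z : 'rV[R]_2 -> 'rV[R]_2) u d b :
  hol F (Z u) d -> cdd (fun v => cof (Z v)) u b -> cdd (fun v => F (Z v)) u (fun k => d * b k).
Proof.
move=> hF [z0 z1]; have := cdd_comp2 hF (b := fun i k => if i == 0 then Re (b k) else Im (b k)).
move=> /(_ _)/cdd_ext; apply=> [i|k].
  by case: (ord2P i) => ->; [exact: z0|exact: z1].
by rewrite /dir/=; case: (b k) => x y; apply: eq_complexP; rewrite ?(cReM, cReD, cImM, cImD)/=; ring.
Qed.

Lemma expi_add (s t : R) : expi (s + t) = expi s * expi t.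
Proof. by rewrite /expi cosD sinD; apply: eq_complexP; rewrite ?cReM ?cImM/=; ring. Qed.

Lemma expi0 : expi (0 : R) = 1.
Proof. by rewrite /expi cos0 sin0. Qed.

Definition normc2 (z : R[i]) : R := Re z ^+ 2 + Im z ^+ 2.

Lemma normc2M (x y : R[i]) : normc2 (x * y) = normc2 x * normc2 y.
Proof. by rewrite /normc2 cReM cImM; ring. Qed.

Lemma normc2_expi t : normc2 (expi t) = 1.
Proof. by rewrite /normc2 cos2Dsin2. Qed.

Definition slit_right (z : R[i]) := (Im z != 0) || (0 < Re z).

Definition modc (z : R[i]) := Num.sqrt (normc2 z).

(** The principal logarithm. The half-angle formula tan (arg z / 2) = Im z / (|z| + Re z) gives the
    argument by one expression on the whole plane cut along the negative axis. *)
Definition clogp (z : R[i]) : R[i] := ln (modc z) +i* (2 * atan (Im z / (modc z + Re z))).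

Lemma modc_gt0 z : z != 0 -> 0 < modc z.
Proof. by rewrite complex_neq0 => h; rewrite sqrtr_gt0. Qed.

Lemma modc_sq z : modc z ^+ 2 = Re z ^+ 2 + Im z ^+ 2.
Proof. by rewrite sqr_sqrtr// addr_ge0 ?sqr_ge0. Qed.

Lemma slit_right_modc z : slit_right z -> 0 < modc z + Re z.
Proof.
move=> /orP[y0|x0]; last by rewrite ltr_wpDl// sqrtr_ge0.
have : `|Re z| < modc z.
  rewrite -(@ltr_pXn2r _ 2)// ?nnegrE ?normr_ge0 ?sqrtr_ge0// modc_sq real_normK ?num_real//.
  by rewrite ltrDl lt0r sqr_ge0 sqrf_eq0 y0.
by rewrite ltr_norml => /andP[]; lra.
Qed.

Lemma hol_clogp u : slit_right (cof u) -> hol (fun v => clogp (cof v)) u (cof u)^-1.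
Proof.
move=> su; have rx := slit_right_modc su.
have z0 : cof u != 0.
  by apply: contraTneq su => ->; rewrite /slit_right /= eqxx ltxx.
have rp := modc_gt0 z0; have r2 := modc_sq (cof u).
have [[_ _] [_ _]] := hol_id u; have [d0 d1] := hol_id u.
have n0 : 0 < normc2 (cof u) by rewrite -complex_neq0.
have dn : dd (fun v => normc2 (cof v)) u (fun k => 2 * (Re (cof u) * Re (dir k) + Im (cof u) * Im (dir k))).
  apply: dd_ext (ddD (ddM d0 d0) (ddM d1 d1)) _ => k; rewrite !mul1r; ring.

have [r rE] : exists r, r = modc (cof u) by eexists.
have [x xE] : exists x, x = Re (cof u) by eexists.
have [y yE] : exists y, y = Im (cof u) by eexists.
rewrite -rE -xE -yE in rp r2 rx dn.
have rn0 : r != 0 by rewrite gt_eqF.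
have rxn0 : r + x != 0 by rewrite gt_eqF.
have dr : dd (fun v => modc (cof v)) u (fun k => (x * Re (dir k) + y * Im (dir k)) / r).
  by apply: dd_ext (dd_sqrt n0 dn) _ => k; rewrite -/(modc (cof u)) -rE; field.
have rp' := rp; rewrite rE in rp'.
have dln : dd (fun v => ln (modc (cof v))) u (fun k => (x * Re (dir k) + y * Im (dir k)) / r ^+ 2).
  by apply: dd_ext (dd_comp1 (is_derive1_ln rp') dr) _ => k; rewrite -rE; field.
have rxn0' := rxn0; rewrite rE xE in rxn0'.
have dt := ddM d1 (ddV rxn0' (ddD dr d0)).
have dat := ddM (dd_cst 2 u) (dd_comp1 (is_derive1_atan _) dt).
have E : 1 + (y * (r + x)^-1) ^+ 2 = 2 * r / (r + x).
  transitivity (((r + x) ^+ 2 + y ^+ 2) / (r + x) ^+ 2); first by field.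
  have -> : (r + x) ^+ 2 + y ^+ 2 = 2 * r * (r + x).
    by transitivity (r ^+ 2 + 2 * r * x + (x ^+ 2 + y ^+ 2)); [ring|rewrite -r2; ring].
  by field.
split.
  apply: dd_ext dln _ => k; rewrite cReM cReV cImV -xE -yE -r2; by case: (ord2P k) => -> /=; field.
apply: dd_ext dat _ => k; rewrite -rE -xE -yE E !mul1r [in RHS]cImM cReV cImV -xE -yE -r2 mul0r add0r.
have r2a : y ^+ 2 = (r - x) * (r + x) by transitivity (r ^+ 2 - x ^+ 2); [rewrite r2; ring|ring].
case: (ord2P k) => -> /=.
  by field; rewrite rn0 rxn0.
transitivity ((r * (r + x) - y ^+ 2) / (r ^+ 2 * (r + x))).
  by field; rewrite rn0 rxn0.
by rewrite r2a; field; rewrite rn0 rxn0.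
Qed.

End ComplexCalculus.

(** * Paths and homotopies *)

Section Topology.

Lemma continuous_near (X Y : topologicalType) (f g : X -> Y) x :
  (\forall y \near x, f y = g y) -> {for x, continuous f} -> {for x, continuous g}.
Proof.
move=> fg; rewrite /prop_for /continuous_at -(nbhs_singleton fg).
move=> cf A /cf H; rewrite nbhs_simpl /=.
by apply: filterS (filterI fg H) => y [/= <-].
Qed.

Lemma continuous_if {R : realType} (X Y : topologicalType) (phi : X -> R) (f g : X -> Y) x :
  {for x, continuous phi} ->
  (phi x <= 0 -> {for x, continuous f}) -> (0 <= phi x -> {for x, continuous g}) ->
  (phi x = 0 -> f x = g x) ->
  {for x, continuous (fun y => if phi y <= 0 then f y else g y)}.
Proof.
move=> cphi cf cg fg; have [p0|p0|p0] := ltgtP (phi x) 0.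
- apply: (@continuous_near _ _ f); last by apply: cf; exact: ltW.
  have : \forall y \near x, phi y < 0 by exact: (cvgr_lt _ cphi).
  by apply: filterS => y /ltW ->.
- apply: (@continuous_near _ _ g); last by apply: cg; exact: ltW.
  have : \forall y \near x, 0 < phi y by exact: (cvgr_gt _ cphi).
  by apply: filterS => y y0; rewrite leNgt y0.
have {}cf : {for x, continuous f} by apply: cf; rewrite p0.
have {}cg : {for x, continuous g} by apply: cg; rewrite p0.
move=> A; rewrite /= p0 lexx => Af.
have Ag : nbhs (g x) A by rewrite -fg.
have : nbhs x (f @^-1` A `&` g @^-1` A) by apply: filterI; [exact: cf|exact: cg].
apply: (@filterS _ (nbhs x)) => y [/= ? ?].
by case: ifP.
Qed.

Lemma continuous_open_embedding (X Y Z : topologicalType) (A : set X) (f : X -> Y) (F : Y -> Z) x :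
  open_embedding A f -> A x -> {for x, continuous (F \o f)} -> {for f x, continuous F}.
Proof.
move=> [oA _ _ opf] Ax cF B /cF; rewrite /= => BF.
have [W [oW Wx WB]] : exists W, [/\ open W, W x & W `<=` A `&` (F \o f) @^-1` B].
  have : nbhs x (A `&` (F \o f) @^-1` B) by apply: filterI => //; exact: open_nbhs_nbhs.
  by rewrite nbhsE => -[W [oW Wx] WB]; exists W.
rewrite nbhs_simpl nbhsE /=; exists (f @` W).
  by split; [apply: opf => // y /WB[]|exists x].
by move=> _ [y /WB[_ ?] <-].
Qed.

Lemma open_embedding_sub (X Y : topologicalType) (A B : set X) (f : X -> Y) :
  open B -> B `<=` A -> open_embedding A f -> open_embedding B f.
Proof.
move=> oB BA [oA injf cf opf]; split => //.
- by move=> x y; rewrite !inE => /BA Ax /BA Ay; apply: injf; rewrite inE.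
- by move=> x /BA; exact: cf.
- by move=> W /subset_trans/(_ BA); exact: opf.
Qed.

Lemma open_embedding_comp (X Y Z : topologicalType) (A : set X) (B : set Y)
    (f : X -> Y) (g : Y -> Z) :
  open_embedding A f -> open_embedding B g -> f @` A `<=` B -> open_embedding A (g \o f).
Proof.
move=> [oA injf cf opf] [oB injg cg og] AB; split=> //.
- move=> x y; rewrite !inE => Ax Ay /= gf; apply: injf; rewrite ?inE//.
  by apply: injg => //; rewrite inE; apply: AB; [exists x|exists y].
- by move=> x Ax; apply: continuous_comp; [exact: cf|apply: cg; apply: AB; exists x].
- move=> W WA oW; rewrite -image_comp; apply: og; last exact: opf.
  by apply: subset_trans AB; exact: image_subset.
Qed.

Lemma continuous_rV2 {R : realType} (X : topologicalType) (g : X -> 'rV[R]_2) x :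
  (forall k, {for x, continuous (fun y => g y 0 k)}) -> {for x, continuous g}.
Proof.
move=> cg A [P gP PA]; rewrite nbhs_simpl /=.
have H k : \forall y \near x, P 0 k (g y 0 k) by exact: (cg k _ (gP 0 k)).
have : \forall y \near x, P 0 0 (g y 0 0) /\ P 0 1 (g y 0 1) by exact: near_and.
apply: (@filterS _ (nbhs x)) => y [P0 P1]; apply: PA => i k.
by rewrite (ord1 i); case: (ord2P k) => ->.
Qed.

Lemma continuous_coord2 {R : realType} (X : topologicalType) (g : X -> 'rV[R]_2) x k :
  {for x, continuous g} -> {for x, continuous (fun y => g y 0 k)}.
Proof.
move=> cg; apply: (@continuous_comp _ _ _ g (fun v : 'rV[R]_2 => v 0 k)) => //.
exact: coord_continuous.
Qed.

End Topology.

Section RealContinuity.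
Context {R : realType} (X : topologicalType) (x : X).
Implicit Types f g : X -> R.

Lemma cont_cst (Y : topologicalType) (c : Y) : {for x, continuous (fun=> c)}.
Proof. exact: cst_continuous. Qed.
Lemma cont_add f g : {for x, continuous f} -> {for x, continuous g} ->
  {for x, continuous (fun y => f y + g y)}.
Proof. exact: continuousD. Qed.
Lemma cont_opp f : {for x, continuous f} -> {for x, continuous (fun y => - f y)}.
Proof. exact: continuousN. Qed.
Lemma cont_mul f g : {for x, continuous f} -> {for x, continuous g} ->
  {for x, continuous (fun y => f y * g y)}.
Proof. exact: continuousM. Qed.
Lemma cont_inv f : f x != 0 -> {for x, continuous f} -> {for x, continuous (fun y => (f y)^-1)}.
Proof. exact: continuousV. Qed.
Lemma cont_norm f : {for x, continuous f} -> {for x, continuous (fun y => `|f y|)}.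
Proof. exact: cvg_norm. Qed.
Lemma cont_min f g : {for x, continuous f} -> {for x, continuous g} ->
  {for x, continuous (fun y => Num.min (f y) (g y))}.
Proof. exact: continuous_min. Qed.
Lemma cont_max f g : {for x, continuous f} -> {for x, continuous g} ->
  {for x, continuous (fun y => Num.max (f y) (g y))}.
Proof. exact: continuous_max. Qed.
Lemma cont_pair (Y Z : topologicalType) (f : X -> Y) (g : X -> Z) :
  {for x, continuous f} -> {for x, continuous g} -> {for x, continuous (fun y => (f y, g y))}.
Proof. exact: cvg_pair. Qed.
Lemma cont_comp (Y Z : topologicalType) (f : X -> Y) (g : Y -> Z) :
  {for x, continuous f} -> {for f x, continuous g} -> {for x, continuous (fun y => g (f y))}.
Proof. exact: continuous_comp. Qed.
Lemma cont_fst (Y Z : topologicalType) (f : X -> Y * Z) :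
  {for x, continuous f} -> {for x, continuous (fun y => (f y).1)}.
Proof. by move=> cf; apply: (cont_comp cf); exact: cvg_fst. Qed.
Lemma cont_snd (Y Z : topologicalType) (f : X -> Y * Z) :
  {for x, continuous f} -> {for x, continuous (fun y => (f y).2)}.
Proof. by move=> cf; apply: (cont_comp cf); exact: cvg_snd. Qed.

(** The retraction of the line onto [0, 1]. Precomposing with it turns paths and homotopies that are
    continuous within the unit interval into globally continuous maps, which can be pasted without
    subspace topologies. *)
Definition clamp (z : R) := Num.min (Num.max z 0) 1.

Lemma cont_clamp f : {for x, continuous f} -> {for x, continuous (fun y => clamp (f y))}.
Proof. by move=> cf; apply: cont_min; [apply: cont_max|]; rewrite ?cf//; exact: cont_cst. Qed.

End RealContinuity.

Section Clamp.
Context {R : realType}.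
Implicit Types x : R.

Lemma clamp_id x : 0 <= x <= 1 -> clamp x = x.
Proof. by move=> /andP[x0 x1]; rewrite /clamp max_l// min_l. Qed.

Lemma clamp_le0 x : x <= 0 -> clamp x = 0.
Proof. by move=> x0; rewrite /clamp max_r// min_l. Qed.

Lemma clamp_ge1 x : 1 <= x -> clamp x = 1.
Proof. by move=> x0; rewrite /clamp max_l ?min_r// (le_trans _ x0). Qed.

Lemma clamp01 x : 0 <= clamp x <= 1.
Proof. by rewrite /clamp le_min le_max lexx orbT ler01 ge_min lexx orbT. Qed.

End Clamp.

Ltac cont :=
  lazymatch goal with
  | |- forall _, continuous_at _ _ => let x := fresh "x" in move=> x; cont
  | |- continuous_at ?x ?F => change {for x, continuous F}; cont
  | |- prop_for ?x (inPhantom (forall z, continuous_at z ?F)) =>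
    lazymatch F with
    | (fun y => y) => exact: cvg_id
    | id => exact: cvg_id
    | @fst _ _ => exact: cvg_fst
    | @snd _ _ => exact: cvg_snd
    | (fun _ => ?c) => exact: cont_cst
    | (fun y => @Algebra.add _ (@?f y) (@?g y)) => refine (@cont_add _ _ x f g _ _); cont
    | (fun y => @GRing.mul _ (@?f y) (@?g y)) => refine (@cont_mul _ _ x f g _ _); cont
    | (fun y => @Algebra.opp _ (@?f y)) => refine (@cont_opp _ _ x f _); cont
    | (fun y => @Num.norm _ _ (@?f y)) => refine (@cont_norm _ _ x f _); cont
    | (fun y => @Order.min _ _ (@?f y) (@?g y)) => refine (@cont_min _ _ x f g _ _); cont
    | (fun y => @Order.max _ _ (@?f y) (@?g y)) => refine (@cont_max _ _ x f g _ _); cont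
    | (fun y => @pair _ _ (@?f y) (@?g y)) => refine (@cont_pair _ x _ _ f g _ _); cont
    | (fun y => clamp (@?f y)) => refine (@cont_clamp _ _ x f _); cont
    | (fun y => @fst _ _ (@?f y)) => refine (@cont_fst _ x _ _ f _); cont
    | (fun y => @snd _ _ (@?f y)) => refine (@cont_snd _ x _ _ f _); cont
    | (fun y => @fun_of_matrix _ _ _ (@?f y) _ ?k) => refine (@continuous_coord2 _ _ f x k _); cont
    | (fun y => ?g (@?h y)) => first [ match goal with H : _ |- _ => exact: H end
       | match goal with H : _ |- _ => refine (@cont_comp _ x _ _ h g _ (H _)); cont end | idtac ]
    | _ => first [ match goal with H : _ |- _ => exact: H end | idtac ]
    end
  end.

Section PathsAndLoops.
Context {R : realType} (T : topologicalType).
Implicit Types f g : R -> T.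

Definition joined (x y : T) := exists f, [/\ continuous f, f 0 = x & f 1 = y].

Lemma joined_sym x y : joined x y -> joined y x.
Proof.
move=> [f [cf f0 f1]]; exists (fun t : R => f (1 - t)); split.
- by cont.
- by rewrite subr0.
- by rewrite subrr.
Qed.

Lemma joined_trans y x z : joined x y -> joined y z -> joined x z.
Proof.
move=> [f [cf f0 f1]] [g [cg g0 g1]].
exists (fun t : R => if t - 1 / 2 <= 0 then f (2 * t) else g (2 * t - 1)); split.
- move=> t; apply: (continuous_if (phi := fun t : R => t - 1 / 2) (f := fun t : R => f (2 * t))
    (g := fun t : R => g (2 * t - 1))); first by cont.
  + by move=> _; cont.
  + by move=> _; cont.
  + by move=> t0; rewrite (_ : 2 * t = 1) ?subrr ?f1 ?g0//; lra.
- by rewrite ifT ?mulr0 ?f0//; lra.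
- rewrite ifN; last by rewrite -ltNge; lra.
  by rewrite mulr1 -[2]/(1 + 1) addrK.
Qed.

Definition null f := exists H : R * R -> T, [/\ continuous H,
  (forall t, 0 <= t <= 1 -> H (0, t) = f t /\ H (1, t) = f 0)
  & (forall s, 0 <= s <= 1 -> H (s, 0) = f 0 /\ H (s, 1) = f 0)].

Lemma null_cst x : null (fun=> x).
Proof. by exists (fun=> x); split=> // y; exact: cst_continuous. Qed.

(* The homotopy first slides along the track [k] of the base point, then
   contracts [K (1, _)], and finally retracts [k]. *)
Lemma null_free (K : R * R -> T) : continuous K ->
  (forall s, 0 <= s <= 1 -> K (s, 0) = K (s, 1)) ->
  null (fun t => K (1, t)) -> null (fun t => K (0, t)).
Proof.
move=> cK K01 [H [cH H0 H1]].
(* It vanishes at both ends and equals 1 on the middle third. *)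
pose ramp (t : R) := clamp (Num.min (3 * t) (3 - 3 * t)).
have cramp : continuous ramp by rewrite /ramp; cont.
have ramp0 : ramp 0 = 0 by rewrite /ramp mulr0 subr0 clamp_le0// ge_min lexx.
have ramp1 : ramp 1 = 0 by rewrite /ramp mulr1 subrr clamp_le0// ge_min lexx orbT.
pose k (s : R) := K (s, 0).
have ck : continuous k by rewrite /k; cont.
(* On the unit interval [A (0, t)] is [K (0, t)], while [A (1, t)] follows the track, runs through
   [K (1, _)] in the middle third and returns along the track. *)
pose A (p : R * R) := K (clamp (Num.min (clamp p.1) (Num.min (3 * p.2) (3 - 3 * p.2))),
  clamp (p.2 + p.1 * (2 * p.2 - 1))).
have cA : continuous A by rewrite /A; cont.
pose B (p : R * R) := if p.2 - 1 / 3 <= 0 then k (ramp p.2) else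
  if p.2 - 2 / 3 <= 0 then H (clamp p.1, 3 * p.2 - 1) else k (ramp p.2).
have rampm t : 1 / 3 <= t <= 2 / 3 -> ramp t = 1.
  by move=> t12; rewrite /ramp clamp_ge1// le_min; apply/andP; split; lra.
have ckr (p : R * R) : {for p, continuous (fun p : R * R => k (ramp p.2))} by cont.
have z01 : 0 <= (0 : R) <= 1 by rewrite lexx ler01.
have o01 : 0 <= (1 : R) <= 1 by rewrite lexx ler01.
have k1 : k 1 = K (1, 1) by rewrite /k K01.
have cB : continuous B.
  move=> p; apply: (continuous_if (phi := fun p : R * R => p.2 - 1 / 3)
    (f := fun p : R * R => k (ramp p.2)) (g := fun p : R * R => if p.2 - 2 / 3 <= 0 then
       H (clamp p.1, 3 * p.2 - 1) else k (ramp p.2))); [by cont|by move=> _; exact: ckr| |].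
    move=> _; apply: (continuous_if (phi := fun p : R * R => p.2 - 2 / 3)
      (f := fun p : R * R => H (clamp p.1, 3 * p.2 - 1)) (g := fun p : R * R => k (ramp p.2)));
      [by cont| |by move=> _; exact: ckr|].
      by move=> _; cont.
    move=> p2; rewrite (_ : 3 * p.2 - 1 = 1); last by lra.
    by rewrite (H1 _ (clamp01 _)).2 rampm//; lra.
  move=> p2; rewrite ifT; last by lra.
  rewrite (_ : 3 * p.2 - 1 = 0); last by lra.
  by rewrite (H1 _ (clamp01 _)).1 rampm//; lra.
pose C (p : R * R) := k (ramp p.2 * (1 - p.1)).
have cC : continuous C by rewrite /C; cont.
have AB (t : R) : 0 <= t <= 1 -> A (1, t) = B (0, t).
  move=> /andP[t0 t1]; rewrite /A /B /= (clamp_id o01) mul1r (clamp_id z01).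
  have [t3|t3] := leP (t - 1 / 3) 0.
    rewrite (@clamp_le0 _ (t + _)); last by lra.
    rewrite /k /ramp; congr (K (clamp _, _)).
    by rewrite min_r// ge_min; apply/orP; left; lra.
  have [t4|t4] := leP (t - 2 / 3) 0.
    rewrite (H0 _ _).1; last by apply/andP; split; lra.
    rewrite (@clamp_ge1 _ (Num.min _ _)); last by rewrite !le_min lexx/=; apply/andP; split; lra.
    by rewrite clamp_id; [congr (K (_, _)); ring|apply/andP; split; lra].
  rewrite (@clamp_ge1 _ (t + _)); last by lra.
  rewrite -K01 ?clamp01// /k /ramp; congr (K (clamp _, _)).
  by rewrite min_r// ge_min; apply/orP; right; lra.
have BC (t : R) : B (1, t) = C (0, t).
  rewrite /B /C /= subr0 mulr1 (clamp_id o01).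
  case: ifP => // t3; case: ifP => // t4.
  by rewrite (H0 _ _).2 ?rampm ?k1//; apply/andP; split; lra.
(* The three homotopies one after the other, each in a third of the time [p.1]. *)
pose F (p : R * R) := if p.1 - 1 / 3 <= 0 then A (3 * p.1, clamp p.2) else
  if p.1 - 2 / 3 <= 0 then B (3 * p.1 - 1, clamp p.2) else C (3 * p.1 - 2, clamp p.2).
exists F; split.
- move=> p; apply: (continuous_if (phi := fun p : R * R => p.1 - 1 / 3)
    (f := fun p : R * R => A (3 * p.1, clamp p.2)) (g := fun p : R * R => if p.1 - 2 / 3 <= 0 then
       B (3 * p.1 - 1, clamp p.2) else C (3 * p.1 - 2, clamp p.2))); [by cont| | |].
  + by move=> _; cont.
  + move=> _; apply: (continuous_if (phi := fun p : R * R => p.1 - 2 / 3)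
      (f := fun p : R * R => B (3 * p.1 - 1, clamp p.2)) (g := fun p : R * R => C (3 * p.1 - 2, clamp p.2)));
      [by cont| | |].
    * by move=> _; cont.
    * by move=> _; cont.
    * move=> p1; rewrite (_ : 3 * p.1 - 1 = 1); last by lra.
      by rewrite (_ : 3 * p.1 - 2 = 0) ?BC//; lra.
  + move=> p1; rewrite ifT; last by lra.
    rewrite (_ : 3 * p.1 - 1 = 0); last by lra.
    by rewrite (_ : 3 * p.1 = 1) ?AB ?clamp01//; lra.
- move=> t t01; rewrite /F/= ifT; last by lra.
  rewrite ifN; last by rewrite -ltNge; lra.
  rewrite ifN; last by rewrite -ltNge; lra.
  rewrite mulr0 clamp_id//; split.
    rewrite /A /= (clamp_id z01) mul0r addr0 (clamp_id t01).
    rewrite min_l ?(clamp_id z01)// le_min; case/andP: t01 => ? ?.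
    by apply/andP; split; lra.
  by rewrite /C /= (_ : 3 * 1 - 2 = 1) ?subrr ?mulr0//; ring.
- have side (s t : R) : 0 <= s <= 1 -> (t == 0) || (t == 1) -> F (s, t) = K (0, 0).
    move=> s01 t01; have t01' : 0 <= t <= 1.
      by case/orP: t01 => /eqP->; rewrite lexx ler01.
    have rt : ramp t = 0 by case/orP: t01 => /eqP->.
    rewrite /F/= (clamp_id t01'); case: ifPn => s1.
      rewrite /A /= -[clamp (Num.min (clamp _) _)]/(clamp _).
      have -> : clamp (Num.min (clamp (3 * s)) (Num.min (3 * t) (3 - 3 * t))) = 0.
        rewrite clamp_le0// !ge_min; apply/orP; right.
        by case/orP: t01 => /eqP->; apply/orP; [left|right]; lra.
      case/orP: t01 => /eqP->.
        by rewrite clamp_le0//; case/andP: s01 => ? ?; lra.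
      by rewrite clamp_ge1 -?K01//; case/andP: s01 => ? ?; lra.
    case: ifPn => s2.
      rewrite /B/=; case/orP: t01 => /eqP t0.
        by rewrite ifT ?t0 ?ramp0//; lra.
      rewrite ifN; last by rewrite t0 -ltNge; lra.
      rewrite ifN; last by rewrite t0 -ltNge; lra.
      by rewrite rt.
    by rewrite /C/= rt mul0r.
  by move=> s s01; rewrite !side ?eqxx ?orbT.
Qed.

End PathsAndLoops.

(** * The universal cover as a tree of half-planes *)

Section Words.
Implicit Types (w : seq 'I_4) (i j : 'I_4).

Definition reduced w := sorted (fun i j => i != j) w.

(** Multiplication by the generator [j] in the free product of four groups of order two, on reduced
    words. Its graph is the 4-valent tree whose vertices are the sheets and whose edges of colour
    [j] are the lifts of arc [j]. *)
Definition wact j w := if w is k :: w' then if k == j then w' else j :: w else [:: j].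

Lemma reduced_behead j w : reduced (j :: w) -> reduced w.
Proof. exact: path_sorted. Qed.

Lemma reduced_wact j w : reduced w -> reduced (wact j w).
Proof.
case: w => [//|k w] /= kw; case: eqVneq => [_|kj]; first exact: path_sorted kw.
by rewrite /= eq_sym kj.
Qed.

Lemma wactK j w : reduced w -> wact j (wact j w) = w.
Proof.
case: w => [|k w] /=; first by rewrite eqxx.
case: eqVneq => [->|kj _] /=; last by rewrite eqxx.
by case: w => [//|l w] /= /andP[+ _]; rewrite eq_sym => /negbTE ->.
Qed.

Lemma odd_wact j w : odd (size (wact j w)) = ~~ odd (size w).
Proof. by case: w => [//|k w] /=; case: eqVneq => //= _; rewrite negbK. Qed.

Lemma wact_cons j w : reduced (j :: w) -> wact j w = j :: w.
Proof. by case: w => [//|k w] /= /andP[+ _]; rewrite eq_sym => /negbTE ->. Qed.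

(** Of two sheets adjacent across arc [j], one word is the other with [j] in front; statements
    symmetric in the two sheets reduce to the pair [w'], [j :: w']. *)
Lemma wact_shorter j w : reduced w ->
  (exists2 w', reduced (j :: w') & (w = w' /\ wact j w = j :: w') \/ (w = j :: w' /\ wact j w = w')).
Proof.
case: w => [|k w] rw; first by exists [::]; [|left].
have [kj|kj] := eqVneq k j; last first.
  by exists (k :: w); [rewrite /= eq_sym kj|left; rewrite /= (negbTE kj)].
by subst k; exists w => //; right; rewrite /= eqxx.
Qed.

(** Each lift of a slit plane contains exactly one upper half-plane, so even words label the sheets
    of the covering. *)
Definition even_word := {w | reduced w && ~~ odd (size w)}.

End Words.

Section TreeSpace.
Context {R : realType}.
Variables a b c : R.
Implicit Types (u z : 'rV[R]_2) (j : 'I_4) (v w : seq 'I_4).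

Definition arc j (x : R) : bool :=
  match val j with 0 => x < a | 1 => a < x < b | 2 => b < x < c | _ => c < x end.

Definition off_punctures u : bool := (u 0 1 != 0) || (u 0 0 \notin [:: a; b; c]).

Lemma off_puncturesE u : off_punctures u = (u 0 1 != 0) || (u 0 0 \notin [:: a; b; c]).
Proof. by []. Qed.

(** The two open half-planes joined through the single arc [j]: a simply connected set, over which
    the covering is trivial. *)
Definition slit j : set 'rV[R]_2 := [set u | (u 0 1 != 0) || arc j (u 0 0)].

Definition pnt (x y : R) : 'rV[R]_2 := \row_k (if k == 0 then x else y).

Lemma pnt0 x y : pnt x y 0 0 = x. Proof. by rewrite mxE. Qed.
Lemma pnt1 x y : pnt x y 0 1 = y. Proof. by rewrite mxE. Qed.
Definition pntE := (pnt0, pnt1).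
Lemma pnt_eta u : pnt (u 0 0) (u 0 1) = u.
Proof. by apply/rowP => k; case: (ord2P k) => ->; rewrite mxE. Qed.

Definition mirror u := pnt (u 0 0) (- u 0 1).
Definition foldp u := pnt (u 0 0) `|u 0 1|.

Lemma fold0 u : foldp u 0 0 = u 0 0. Proof. by rewrite /foldp pntE. Qed.
Lemma fold1 u : foldp u 0 1 = `|u 0 1|. Proof. by rewrite /foldp pntE. Qed.
Lemma mirror0 u : mirror u 0 0 = u 0 0. Proof. by rewrite /mirror pntE. Qed.
Lemma mirror1 u : mirror u 0 1 = - u 0 1. Proof. by rewrite /mirror pntE. Qed.

Lemma mirrorK : involutive mirror.
Proof. by move=> u; rewrite /mirror !pntE opprK pnt_eta. Qed.

Definition valid (q : seq 'I_4 * 'rV[R]_2) : bool :=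
  [&& reduced q.1, off_punctures q.2 &
   if q.2 0 1 == 0 then (if q.1 is k :: _ then ~~ arc k (q.2 0 0) else true)
   else (q.2 0 1 < 0) == odd (size q.1)].

(* A point is a reduced word (a sheet, i.e. a closed half-plane, upper for
   words of even length) together with its projection to the plane; on the arc
   shared by two sheets the shorter word is used. *)
Definition tree := {q | valid q}.

Definition word (t : tree) := (val t).1.
Definition proj (t : tree) := (val t).2.

Lemma valid_base : valid ([::], pnt 0 1).
Proof. by rewrite /valid /off_punctures /= pntE oner_eq0 ltr10. Qed.

Definition tree_base : tree := exist (fun q => valid q) _ valid_base.

Definition upper u := (0 <= u 0 1) && off_punctures u.

(** All sheets share one parameter domain, the closed upper half-plane without the punctures;
    [mirror] places the odd sheets below the axis. On the arc by which a sheet hangs from its parent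
    the normal form takes the word of the parent. Invalid pairs give the default [tree_base]. *)
Definition sheet v z : tree := insubd tree_base
  (if z 0 1 == 0 then (if v is k :: v' then if arc k (z 0 0) then (v', z) else (v, z) else (v, z))
   else (v, if odd (size v) then mirror z else z)).

(** The section of [proj] over [slit j] that starts on the upper sheet [w] and passes through arc
    [j] to the neighbouring lower sheet. *)
Definition psi w j u := if 0 <= u 0 1 then sheet w u else sheet (wact j w) (mirror u).

(** The final topology for the sections [psi w j] with [w] even, which turn out to be charts
    ([psi_embedding]). *)
Definition tree_open (A : set tree) := forall w j, reduced w -> ~~ odd (size w) ->
  open (slit j `&` psi w j @^-1` A).

HB.instance Definition _ := Choice.on tree.

Lemma open_lt_fun (X : topologicalType) (f g : X -> R) : continuous f -> continuous g ->
  open [set x | f x < g x].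
Proof.
move=> cf cg; rewrite openE => x /= fx.
have d0 : 0 < g x - f x by rewrite subr_gt0.
have cd : {for x, continuous (fun y => g y - f y)} by cont.
rewrite /interior; near=> y; rewrite /= -subr_gt0; near: y.
exact: cvgr_gt cd _ d0.
Unshelve. all: by end_near.
Qed.

Lemma open_off_axis : open [set u : 'rV[R]_2 | u 0 1 != 0].
Proof.
rewrite (_ : [set u | _] = [set u : 'rV[R]_2 | u 0 1 < 0] `|` [set u : 'rV[R]_2 | 0 < u 0 1]).
  by apply: openU; apply: open_lt_fun; cont; apply: continuous_coord2; cont.
by apply/seteqP; split=> u /=; rewrite neq_lt => /orP.
Qed.

Lemma open_slit j : open (slit j).
Proof.
have cc k : continuous (fun u : 'rV[R]_2 => u 0 k) by cont.
have ck (r : R) : continuous (fun _ : 'rV[R]_2 => r) by cont.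
rewrite (_ : slit j = [set u : 'rV[R]_2 | u 0 1 != 0] `|` [set u : 'rV[R]_2 | arc j (u 0 0)]); last first.
  by apply/seteqP; split=> u /= /orP.
apply: openU; first exact: open_off_axis.
case: j => -[|[|[|[|//]]]] jp; rewrite /arc /=; try exact: open_lt_fun.
- rewrite (_ : [set u | _] = [set u : 'rV[R]_2 | a < u 0 0] `&` [set u : 'rV[R]_2 | u 0 0 < b]).
    by apply: openI; apply: open_lt_fun.
  by apply/seteqP; split=> u /= /andP.
- rewrite (_ : [set u | _] = [set u : 'rV[R]_2 | b < u 0 0] `&` [set u : 'rV[R]_2 | u 0 0 < c]).
    by apply: openI; apply: open_lt_fun.
  by apply/seteqP; split=> u /= /andP.
Qed.

Lemma tree_openT : tree_open setT.
Proof. by move=> w j _ _; rewrite preimage_setT setIT; exact: open_slit. Qed.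

Lemma tree_openI : setI_closed tree_open.
Proof.
move=> A B oA oB w j rw ow; rewrite preimage_setI -(setIid (slit j)) setIACA.
by apply: openI; [exact: oA|exact: oB].
Qed.

Lemma tree_openU (I : Type) (f : I -> set tree) :
  (forall i, tree_open (f i)) -> tree_open (\bigcup_i f i).
Proof.
move=> of_f w j rw ow; rewrite preimage_bigcup setI_bigcupr.
by apply: bigcup_open => i _; exact: of_f.
Qed.

HB.instance Definition _ := isOpenTopological.Build tree tree_openT tree_openI tree_openU.

Hypotheses (ab : a < b) (bc : b < c).

Lemma arc_inj i j x : arc i x -> arc j x -> i = j.
Proof.
case: i => -[|[|[|[|//]]]] ip; case: j => -[|[|[|[|//]]]] jp; rewrite /arc /= => h1 h2;
  have ab' := ab; have bc' := bc;
  first [by apply: val_inj | exfalso; try (move/andP: h1 => [? ?]);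
    try (move/andP: h2 => [? ?]); lra].
Qed.

Lemma off_arc x y : off_punctures (pnt x y) -> exists j, slit j (pnt x y).
Proof.
rewrite /off_punctures /slit /= !pntE; have [y0|] := eqVneq y 0; last by exists 0.
rewrite !inE !negb_or /= => /and3P[xa xb xc].
have [xa'|xa'] := ltP x a; first by exists 0.
have {xa xa'} xa : a < x by rewrite lt_neqAle eq_sym xa.
have [xb'|xb'] := ltP x b; first by exists 1; rewrite /arc /= xa.
have {xb xb'} xb : b < x by rewrite lt_neqAle eq_sym xb.
have [xc'|xc'] := ltP x c; first by exists (inord 2); rewrite /arc /= inordK//= xb.
have {xc xc'} xc : c < x by rewrite lt_neqAle eq_sym xc.
by exists (inord 3); rewrite /arc /= inordK.
Qed.

Lemma arc_off j x : arc j x -> x \notin [:: a; b; c].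
Proof.
by rewrite !inE !negb_or; case: j => -[|[|[|[|//]]]] jp; rewrite /arc /= => h;
  have ab' := ab; have bc' := bc;
  try (move/andP: h => [? ?]); apply/and3P; split; apply/eqP; lra.
Qed.

Lemma slit_off j u : slit j u -> off_punctures u.
Proof. by rewrite /slit /off_punctures /= => /orP[->//|/arc_off ->]; rewrite orbT. Qed.

Lemma off_slit u : off_punctures u -> exists j, slit j u.
Proof. by rewrite -[u in off_punctures u]pnt_eta => /off_arc; rewrite pnt_eta. Qed.

Lemma off_fold u : off_punctures (foldp u) = off_punctures u.
Proof. by rewrite /off_punctures /foldp !pntE normr_eq0. Qed.

Lemma off_mirror u : off_punctures (mirror u) = off_punctures u.
Proof. by rewrite /off_punctures /mirror !pntE oppr_eq0. Qed.

Lemma slit_mirror j u : slit j (mirror u) = slit j u.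
Proof. by rewrite /slit /mirror /= !pntE oppr_eq0. Qed.

Lemma slit_fold j u : slit j (foldp u) = slit j u.
Proof. by rewrite /slit /foldp /= !pntE normr_eq0. Qed.

Lemma upper_fold u : off_punctures u -> upper (foldp u).
Proof. by move=> ou; rewrite /upper off_fold ou /foldp pntE normr_ge0. Qed.

Lemma fold_upper u : 0 <= u 0 1 -> foldp u = u.
Proof. by move=> u0; rewrite /foldp ger0_norm// pnt_eta. Qed.

Lemma fold_lower u : u 0 1 <= 0 -> foldp u = mirror u.
Proof. by move=> u0; rewrite /foldp ler0_norm. Qed.

Lemma mirror_real u : u 0 1 = 0 -> mirror u = u.
Proof. by move=> u0; rewrite /mirror u0 oppr0 -u0 pnt_eta. Qed.

Lemma fold_mirror u : foldp (mirror u) = foldp u.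
Proof. by rewrite /foldp /mirror !pntE normrN. Qed.

Lemma val_sheet v z : reduced v -> upper z -> val (sheet v z) =
  if z 0 1 == 0 then (if v is k :: v' then if arc k (z 0 0) then (v', z) else (v, z) else (v, z))
   else (v, if odd (size v) then mirror z else z).
Proof.
move=> rv /andP[z0 oz]; rewrite /sheet val_insubd ifT//.
have [y0|y0] := eqVneq (z 0 1) 0; last first.
  rewrite /valid /= rv /=; case: ifP => ov.
    by rewrite off_mirror oz /mirror pntE oppr_eq0 (negbTE y0) oppr_lt0 lt0r y0 z0.
  by rewrite oz (negbTE y0) ltNge z0.
case: v rv => [|k v] rv; first by rewrite /valid /= oz y0 eqxx.
case: ifPn => az; rewrite /valid /= oz y0 eqxx ?az; last by rewrite !andbT; exact: rv.
rewrite (reduced_behead rv)/=; case: v rv => [//|l v] /= /andP[kl _].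
by apply: contra kl => al; rewrite (arc_inj az al).
Qed.

Lemma proj_sheet v z : reduced v -> upper z ->
  proj (sheet v z) = if odd (size v) then mirror z else z.
Proof.
move=> rv uz; rewrite /proj val_sheet//; case: eqVneq => [z0|//].
by rewrite mirror_real// if_same; case: v rv => [//|k v] _; case: ifP.
Qed.

Lemma reduced_word t : reduced (word t).
Proof. by case: t => q /=; rewrite /valid /word /= => /and3P[]. Qed.

Lemma off_proj t : off_punctures (proj t).
Proof. by case: t => q /=; rewrite /valid /proj /= => /and3P[]. Qed.

Lemma sheet_word t : sheet (word t) (foldp (proj t)) = t.
Proof.
have uz := upper_fold (off_proj t); apply: val_inj; rewrite val_sheet//; last exact: reduced_word.
case: t uz => -[v u] vq; rewrite /word /proj /= => uz; move: (vq) => /and3P[/= rv ou].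
rewrite fold1 fold0 normr_eq0; have [u0|u0] := eqVneq (u 0 1) 0.
  rewrite fold_upper ?u0//; case: v rv vq uz => [//|k v] rv vq uz.
  by move=> /negbTE ->.
case: ltgtP u0 => // u0 _ /eqP <-.
  by rewrite fold_lower ?mirrorK// ltW.
by rewrite fold_upper ?ltW.
Qed.

(** By [wact_shorter] the two sheets are [j :: w'] and [w'], which the normal form in [sheet]
    identifies; reducedness keeps [w'] from being shortened once more. *)
Lemma sheet_glue j v z : reduced v -> upper z -> z 0 1 = 0 -> arc j (z 0 0) ->
  sheet (wact j v) z = sheet v z.
Proof.
move=> rv uz z0 az; have [w' rw H] := wact_shorter j rv.
suff E : sheet (j :: w') z = sheet w' z by case: H => -[-> ->].
apply: val_inj; rewrite !val_sheet//; last exact: reduced_behead rw.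
rewrite z0 eqxx az; case: w' rw {H} => [//|l w] /= /andP[jl _].
by case: ifPn => // al; rewrite (arc_inj az al) eqxx in jl.
Qed.

Lemma sheet_pos_inj v v' z : reduced v -> reduced v' -> upper z -> 0 < z 0 1 ->
  sheet v z = sheet v' z -> v = v'.
Proof.
move=> rv rv' uz z0 /(congr1 val); rewrite !val_sheet// gt_eqF//.
by case.
Qed.

Lemma word_real v z : reduced v -> upper z -> z 0 1 = 0 ->
  exists j, arc j (z 0 0) /\ (word (sheet v z) = v \/ v = wact j (word (sheet v z))).
Proof.
move=> rv uz z0; have /andP[_ oz] := uz; have [j] := off_slit oz.
rewrite /slit /= z0 eqxx /= => aj; exists j; split => //.
rewrite /word val_sheet// z0 eqxx; case: v rv => [|k v] rv; first by left.
case: ifPn => ak /=; [right|by left].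
by rewrite (arc_inj aj ak) wact_cons.
Qed.

Lemma proj_psi w j u : reduced w -> ~~ odd (size w) -> slit j u -> proj (psi w j u) = u.
Proof.
move=> rw ow su; have ou := slit_off su; rewrite /psi; case: leP => u0.
  by rewrite proj_sheet ?(negbTE ow)// /upper u0.
rewrite proj_sheet ?odd_wact ?ow ?mirrorK//; first exact: reduced_wact.
by rewrite /upper off_mirror ou andbT /mirror pntE oppr_ge0 ltW.
Qed.

(** If the word of [t] is odd, the section has to start on the neighbour across arc [j]. *)
Lemma psi_surj t j : slit j (proj t) ->
  exists2 w, reduced w /\ ~~ odd (size w) & t = psi w j (proj t).
Proof.
move=> st; have rt := reduced_word t; have ou := slit_off st.
have uf := upper_fold ou.
have pt : proj t = if odd (size (word t)) then mirror (foldp (proj t)) else foldp (proj t).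
  by rewrite -{1}(sheet_word t) proj_sheet.
have [ow|ow] := boolP (odd (size (word t))); rewrite ?ow ?(negbTE ow) in pt; last first.
  exists (word t) => //; rewrite /psi.
  rewrite [in 0 <= _]pt /foldp pntE normr_ge0 -{1}(sheet_word t); congr (sheet _ _).
  by rewrite -pt.
exists (wact j (word t)); first by split; [exact: reduced_wact|rewrite odd_wact ow].
have pt' : mirror (proj t) = foldp (proj t) by rewrite {1}pt mirrorK.
rewrite /psi; case: ifPn => u0; last by rewrite wactK// pt' sheet_word.
have p0 : proj t 0 1 = 0.
  apply/eqP; rewrite eq_le u0 andbT -oppr_ge0 -[- _](pnt1 (proj t 0 0)) -/(mirror _) pt'.
  by rewrite /foldp pntE normr_ge0.
rewrite sheet_glue//.
- by rewrite -{1}(sheet_word t) fold_upper.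
- by rewrite /upper u0 ou.
- by move: st; rewrite /slit /= p0 eqxx.
Qed.

(** Off the axis a point determines its sheet; on the axis it does so up to crossing arc [j], and a
    crossing is excluded by parity. *)
Lemma psi_label w w' j u : reduced w -> reduced w' -> ~~ odd (size w) -> ~~ odd (size w') ->
  slit j u -> psi w j u = psi w' j u -> w = w'.
Proof.
move=> rw rw' ow ow' su; have ou := slit_off su; rewrite /psi; case: ltgtP => u0.
- by apply: sheet_pos_inj => //; rewrite /upper ltW.
- move=> E; rewrite -(wactK j rw) -(wactK j rw'); congr wact.
  apply: sheet_pos_inj E; try exact: reduced_wact.
  + by rewrite /upper off_mirror ou andbT /mirror pntE oppr_ge0 ltW.
  + by rewrite /mirror pntE oppr_gt0.
- have uu : upper u by rewrite /upper -u0 lexx.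
  have aj : arc j (u 0 0) by move: su; rewrite /slit /= -u0 eqxx.
  have [i [ai Hi]] := word_real rw uu (esym u0).
  have [i' [ai' Hi']] := word_real rw' uu (esym u0).
  have ij := arc_inj ai aj; have ij' := arc_inj ai' aj; subst i i'.
  move=> E; rewrite -E in Hi'; set q := word _ in Hi Hi'.
  have eqo : odd (size w) = odd (size w') by rewrite (negbTE ow) (negbTE ow').
  case: Hi Hi' => Hi [] Hi'.
  + by rewrite -Hi -Hi'.
  + by move: eqo; rewrite Hi' odd_wact -Hi; case: odd.
  + by move: eqo; rewrite Hi odd_wact -Hi'; case: odd.
  + by rewrite Hi Hi'.
Qed.

Lemma open_pos : open [set u : 'rV[R]_2 | 0 < u 0 1].
Proof. by apply: open_lt_fun; cont; apply: continuous_coord2; cont. Qed.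

Lemma open_neg : open [set u : 'rV[R]_2 | u 0 1 < 0].
Proof. by apply: open_lt_fun; cont; apply: continuous_coord2; cont. Qed.

(** Two sections through a common point agree near it: off the axis they lie on the same sheet, on
    the axis they cross the same arc and so have the same label. *)
Lemma psi_open w j (W : set 'rV[R]_2) : reduced w -> ~~ odd (size w) ->
  W `<=` slit j -> open W -> open (psi w j @` W).
Proof.
move=> rw ow Wj oW; move=> w' i rw' ow'; rewrite openE => u [/= su [u' Wu' E]].
have uu' : u' = u by rewrite -(proj_psi rw ow (Wj _ Wu')) E proj_psi.
subst u'; rewrite /interior.
have H (O : set 'rV[R]_2) : open O -> O u ->
    (forall z, O z -> slit i z -> W z -> psi w j z = psi w' i z) ->
    nbhs u (slit i `&` psi w' i @^-1` (psi w j @` W)).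
  move=> oO Ou OE; have : nbhs u (O `&` (slit i `&` W)).
    apply: filterI; [|apply: filterI]; apply: open_nbhs_nbhs; split=> //.
    exact: open_slit.
  by apply: filterS => z [Oz [sz Wz]]; split => //=; exists z => //; rewrite OE.
have ou := slit_off su.
have [u0|u0|u0] := ltgtP (u 0 1) 0.
- apply: (H _ open_neg u0) => z /= z0 sz Wz; rewrite /psi !leNgt z0 /=; congr sheet.
  move: E; rewrite /psi !leNgt u0 /=; apply: sheet_pos_inj; try exact: reduced_wact.
    by rewrite /upper off_mirror ou mirror1 oppr_ge0 ltW.
  by rewrite mirror1 oppr_gt0.
- apply: (H _ open_pos u0) => z /= z0 sz Wz; rewrite /psi !ltW//; congr sheet.
  move: E; rewrite /psi !ltW//; apply: sheet_pos_inj => //.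
  by rewrite /upper ou ltW.
- have ai : arc i (u 0 0) by move: su; rewrite /slit /= u0 eqxx.
  have aj : arc j (u 0 0) by move: (Wj _ Wu'); rewrite /slit /= u0 eqxx.
  have ij := arc_inj ai aj; subst i.
  have ww : w = w' by apply: (@psi_label _ _ j u).
  by apply: (H _ openT) => // z _ _ _; rewrite ww.
Qed.

Lemma psi_embedding w j : reduced w -> ~~ odd (size w) -> open_embedding (slit j) (psi w j).
Proof.
move=> rw ow; split.
- exact: open_slit.
- move=> u u'; rewrite !inE => su su' E.
  by rewrite -(proj_psi rw ow su) E proj_psi.
- move=> u su A; rewrite {1}nbhsE => -[B [oB Bu] BA].
  have : nbhs u (slit j `&` psi w j @^-1` B) by apply: open_nbhs_nbhs; split; [exact: oB|].
  by apply: filterS => z [_ /BA].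
- by move=> W Wj oW; exact: psi_open.
Qed.

Lemma proj_continuous : continuous proj.
Proof.
move=> t; have [j sj] := off_slit (off_proj t); have [w [rw ow] ->] := psi_surj sj.
apply: (continuous_open_embedding (psi_embedding j rw ow)) => //.
apply: (@continuous_near _ _ id); last exact: cvg_id.
have : nbhs (proj t) (slit j) by apply: open_nbhs_nbhs; split=> //; exact: open_slit.
by apply: (@filterS _ (nbhs _)) => z sz /=; rewrite proj_psi.
Qed.

(** Points with distinct projections are separated in the plane, points of one fibre by the disjoint
    sheets over a slit plane. *)
Lemma tree_hausdorff : hausdorff_space tree.
Proof.
rewrite open_hausdorff => p q pq.
have [E|/eqP Npq] := eqVneq (proj p) (proj q); last first.
  have := @norm_hausdorff _ 'rV[R]_2; rewrite open_hausdorff => /(_ (proj p) (proj q)).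
  move=> /(_ (introN eqP Npq))[[A B] /= [Ap Bq] [oA oB AB]].
  have op (D : set 'rV[R]_2) : open D -> open (proj @^-1` D).
    by apply: open_comp => t _; exact: proj_continuous.
  exists (proj @^-1` A, proj @^-1` B) => /=.
    by split; apply/mem_set; [exact: set_mem Ap|exact: set_mem Bq].
  by split; [exact: op|exact: op|rewrite -preimage_setI (eqP AB) preimage_set0].
have [j sj] := off_slit (off_proj p).
have [w [rw ow] pE] := psi_surj sj.
have [w' [rw' ow'] qE] : exists2 w', reduced w' /\ ~~ odd (size w') & q = psi w' j (proj q).
  by apply: psi_surj; rewrite -E.
exists (psi w j @` slit j, psi w' j @` slit j) => /=.
  by split; apply/mem_set; [exists (proj p)|exists (proj q) => //; rewrite -E].
split; try (apply: psi_open => //; exact: open_slit).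
apply/eqP; rewrite -subset0 => t [[u su <-] [u' su' uE]].
have uu : u = u' by rewrite -(proj_psi rw ow su) -uE proj_psi.
subst u'; move/eqP: pq; apply.
by rewrite pE qE -E (psi_label rw' rw ow' ow su uE).
Qed.

Lemma proj_covering : covering_map proj [set u | off_punctures u].
Proof.
split; first exact: proj_continuous.
  apply/seteqP; split=> [_ [t _ <-]|u /= ou]; first exact: off_proj.
  have [j sj] := off_slit ou; exists (psi [::] j u) => //.
  exact: proj_psi.
move=> u /= /off_slit[j sj]; exists (slit j); first by split=> //; exact: open_slit.
exists even_word, (fun w : even_word => psi (val w) j @` slit j).
split.
- move=> [w /= /andP[rw ow]]; split; last first.
    apply/seteqP; split=> [_ [_ [z sz <-] <-]|z sz]; first by rewrite proj_psi.
    by exists (psi w j z); [exists z|rewrite proj_psi].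
  have [oS injS cS openS] := psi_embedding j rw ow; split.
  + exact: openS.
  + move=> _ _ /set_mem[z sz <-] /set_mem[z' sz' <-].
    by rewrite !proj_psi// => ->.
  + by move=> t _; exact: proj_continuous.
  + move=> W WV oW; have -> : proj @` W = slit j `&` psi w j @^-1` W.
      apply/seteqP; split=> [_ [t Wt <-]|z [sz Wz]]; last by exists (psi w j z) => //; rewrite proj_psi.
      by have [z sz zt] := WV _ Wt; rewrite -zt proj_psi//; split => //=; rewrite zt.
    exact: oW.
- move=> [w /= rw] [w' /= rw'] _ _ [t [[z sz <-] [z' sz' E]]].
  apply: val_inj => /=; move/andP: rw => [rw ow]; move/andP: rw' => [rw' ow'].
  have zz : z = z' by rewrite -(proj_psi rw ow sz) -E proj_psi.
  by subst z'; rewrite (psi_label rw' rw ow' ow sz E).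
- apply/seteqP; split=> [t /= st|t [[w /= /andP[rw ow]] _ [z sz <-]] /=].
    have [w [rw ow] tE] := psi_surj st.
    have rwo : reduced w && ~~ odd (size w) by rewrite rw.
    by exists (exist (fun w => reduced w && ~~ odd (size w)) w rwo) => //=; exists (proj t).
  by rewrite proj_psi.
Qed.

End TreeSpace.

(** * Simple connectedness of the tree of half-planes *)

Section TreeHomotopy.
Context {R : realType}.
Variables a b c : R.
Hypotheses (ab : a < b) (bc : b < c).
Implicit Types (u z : 'rV[R]_2) (j : 'I_4) (v w : seq 'I_4).
Local Notation tree := (tree a b c).
Local Notation arc := (arc a b c).
Local Notation off_punctures := (off_punctures a b c).
Local Notation upper := (upper a b c).
Local Notation sheet := (@sheet R a b c).
Local Notation psi := (@psi R a b c).
Local Notation word := (@word R a b c).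
Local Notation proj := (@proj R a b c).

Lemma cont_pnt (X : topologicalType) (f g : X -> R) x :
  {for x, continuous f} -> {for x, continuous g} -> {for x, continuous (fun y => pnt (f y) (g y))}.
Proof.
move=> cf cg; apply: continuous_rV2 => k; case: (ord2P k) => ->.
  by apply: continuous_near cf; apply: filterE => y; rewrite pnt0.
by apply: continuous_near cg; apply: filterE => y; rewrite pnt1.
Qed.

Lemma cont_fold (X : topologicalType) (f : X -> 'rV[R]_2) x :
  {for x, continuous f} -> {for x, continuous (fun y => foldp (f y))}.
Proof. by move=> cf; apply: cont_pnt; cont. Qed.

Lemma cont_mirror (X : topologicalType) (f : X -> 'rV[R]_2) x :
  {for x, continuous f} -> {for x, continuous (fun y => mirror (f y))}.
Proof. by move=> cf; apply: cont_pnt; cont. Qed.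

(* A map out of the tree is given by a family of maps on the closed half-plane,
   one for each sheet, that agree along the glued arcs. *)
Definition compatible (X Y : Type) (kap : seq 'I_4 -> X -> 'rV[R]_2 -> Y) :=
  forall v j x z, reduced v -> upper z -> z 0 1 = 0 -> arc j (z 0 0) ->
    kap (wact j v) x z = kap v x z.

Lemma compatible_sheet (X Y : Type) (kap : seq 'I_4 -> X -> 'rV[R]_2 -> Y) v x z :
  compatible kap -> reduced v -> upper z ->
  kap (word (sheet v z)) x (foldp (proj (sheet v z))) = kap v x z.
Proof.
move=> ck rv uz; have /andP[z0 oz] := uz.
have -> : foldp (proj (sheet v z)) = z.
  by rewrite proj_sheet//; case: ifP => _; rewrite ?fold_mirror fold_upper.
have [y0|y0] := eqVneq (z 0 1) 0; last first.
  by rewrite /word val_sheet// (negbTE y0).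
have [j [aj [->//|Hv]]] := word_real ab bc rv uz y0.
by rewrite [in RHS]Hv ck//; exact: reduced_word.
Qed.

(** In the chart [psi w j] the map is [kap w] above the axis and [kap (wact j w)] below it, and the
    two agree on arc [j]; openness of [psi w j] carries continuity back to the tree. *)
Lemma glue_continuous (X Y : topologicalType) (kap : seq 'I_4 -> X -> 'rV[R]_2 -> Y) :
  compatible kap ->
  (forall v x z, reduced v -> off_punctures z ->
     {for (x, z), continuous (fun p : X * 'rV[R]_2 => kap v p.1 (foldp p.2))}) ->
  continuous (fun p : X * tree => kap (word p.2) p.1 (foldp (proj p.2))).
Proof.
move=> ck cc [x0 t0].
have [j sj] := off_slit (off_proj t0); have [w [rw ow] tE] := psi_surj ab bc sj.
set G := fun p => _.
have cG : {for (x0, proj t0), continuous (fun p : X * 'rV[R]_2 => G (p.1, psi w j p.2))}.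
  pose F (p : X * 'rV[R]_2) := if - p.2 0 1 <= 0 then kap w p.1 (foldp p.2)
    else kap (wact j w) p.1 (foldp p.2).
  apply: (@continuous_near _ _ F).
    have : \forall p \near (x0, proj t0), slit a b c j p.2.
      apply: (cvg_snd (F := nbhs x0) (G := nbhs (proj t0))).
      by apply: open_nbhs_nbhs; split=> //; exact: open_slit.
    apply: (@filterS _ (nbhs (x0, proj t0))) => p sp; rewrite /F /G /= oppr_le0 /psi.
    have op := slit_off ab bc sp.
    case: leP => p0.
      by rewrite compatible_sheet ?fold_upper// /upper p0.
    rewrite compatible_sheet ?fold_lower ?ltW//; first exact: reduced_wact.
    by rewrite /upper off_mirror op mirror1 oppr_ge0 ltW.
  have os := off_proj t0.
  apply: (continuous_if (phi := fun p : X * 'rV[R]_2 => - p.2 0 1)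
    (f := fun p => kap w p.1 (foldp p.2)) (g := fun p => kap (wact j w) p.1 (foldp p.2))).
  - by cont.
  - by move=> _; exact: cc.
  - by move=> _; apply: cc => //; exact: reduced_wact.
  - move=> /eqP; rewrite oppr_eq0 /= => /eqP p0; rewrite ck// ?fold0 ?fold1 ?p0 ?normr0//.
      exact: upper_fold.
    by move: sj; rewrite /slit /= p0 eqxx.
move=> A GA; have GA' : nbhs (G (x0, psi w j (proj t0))) A by rewrite -tE.
have [[P Q] /= [Px Qu] PQ] := cG _ GA'.
have [_ _ _ opsi] := psi_embedding ab bc j rw ow.
have : nbhs (proj t0) (Q `&` slit a b c j).
  by apply: filterI => //; apply: open_nbhs_nbhs; split=> //; exact: open_slit.
rewrite nbhsE => -[B [oB Bt] BQ].
exists (P, psi w j @` B) => /=.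
  split=> //; apply: open_nbhs_nbhs; split; last by exists (proj t0).
  by apply: opsi => // u /BQ[].
move=> [x t] /= [Pxx [u Bu ut]]; rewrite -ut; apply: (PQ (x, u)); split=> //=.
by have [] := BQ _ Bu.
Qed.

(** An even sheet is read in its own chart, an odd one, reflected, in the chart of its even
    neighbour. *)
Lemma sheet_continuous v z : reduced v -> off_punctures z ->
  {for z, continuous (fun u => sheet v (foldp u))}.
Proof.
move=> rv oz; have [j sj] := off_slit oz; have sfj : slit a b c j (foldp z) by rewrite slit_fold.
have ns : \forall u \near z, slit a b c j u.
  by apply: open_nbhs_nbhs; split=> //; exact: open_slit.
have [ov|ov] := boolP (odd (size v)); last first.
  apply: (@continuous_near _ _ (fun u => psi v j (foldp u))).
    by apply: filterE => u; rewrite /psi fold1 normr_ge0.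
  apply: (cont_comp (f := @foldp R) (g := psi v j)); first by apply: cont_fold; cont.
  by have [_ _ cpsi _] := psi_embedding ab bc j rv ov; exact: cpsi.
have rw := reduced_wact j rv; have ow : ~~ odd (size (wact j v)) by rewrite odd_wact ov.
apply: (@continuous_near _ _ (fun u => psi (wact j v) j (mirror (foldp u)))).
  apply: filterS ns => u su; rewrite /psi mirror1 fold1 oppr_ge0.
  have uf := upper_fold (slit_off ab bc su).
  case: ifPn => [|_]; last by rewrite wactK// mirrorK.
  rewrite normr_le0 => /eqP u0; rewrite mirror_real ?fold1 ?u0 ?normr0//.
  rewrite (sheet_glue ab bc)//; first by rewrite fold1 u0 normr0.
  by move: su; rewrite fold0 /slit /= u0 eqxx.
apply: (cont_comp (f := fun u => mirror (foldp u)) (g := psi (wact j v) j)).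
  by apply: cont_mirror; apply: cont_fold; cont.
have [_ _ cpsi _] := psi_embedding ab bc j rw ow; apply: cpsi.
by rewrite slit_mirror.
Qed.

Definition dist1 z (p : R) := `|z 0 0 - p| + `|z 0 1|.

(** A continuous retraction of the punctured half-plane onto arc [j]. On a bounded arc it is the
    mean of the endpoints, each weighted by the distance of [z] to the other one; on an unbounded
    arc the endpoint is moved outwards by its distance to [z]. *)
Definition gate j z : R := match val j with
  | 0 => a - dist1 z a
  | 1 => (a * dist1 z b + b * dist1 z a) / (dist1 z a + dist1 z b)
  | 2 => (b * dist1 z c + c * dist1 z b) / (dist1 z b + dist1 z c)
  | _ => c + dist1 z c end.

Lemma dist1_gt0 z p : off_punctures z -> p \in [:: a; b; c] -> 0 < dist1 z p.
Proof.
rewrite /off_punctures /dist1 => /orP[y0 _|x0 pm].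
  by rewrite ltr_wpDl ?normr_gt0.
rewrite ltr_wpDr// normr_gt0 subr_eq0.
by apply: contra x0 => /eqP ->.
Qed.

Lemma convex_comb_between (p q d e : R) : p < q -> 0 < d -> 0 < e ->
  p < (p * e + q * d) / (d + e) < q.
Proof.
move=> pq d0 e0; have de : 0 < d + e by rewrite addr_gt0.
rewrite ltr_pdivlMr// ltr_pdivrMr//; apply/andP; split.
  by rewrite -subr_gt0 (_ : _ - _ = (q - p) * d); [rewrite mulr_gt0// subr_gt0|ring].
by rewrite -subr_gt0 (_ : _ - _ = (q - p) * e); [rewrite mulr_gt0// subr_gt0|ring].
Qed.

Lemma arc_gate j z : off_punctures z -> arc j (gate j z).
Proof.
move=> oz; have da : 0 < dist1 z a by rewrite dist1_gt0// !inE eqxx.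
have db : 0 < dist1 z b by rewrite dist1_gt0// !inE eqxx orbT.
have dc : 0 < dist1 z c by rewrite dist1_gt0// !inE eqxx !orbT.
case: j => -[|[|[|[|//]]]] jp; rewrite /arc /gate /=.
- by rewrite gtrBl.
- exact: convex_comb_between.
- exact: convex_comb_between.
- by rewrite ltrDl.
Qed.

Lemma gate_id j z : z 0 1 = 0 -> arc j (z 0 0) -> gate j z = z 0 0.
Proof.
have ab' := ab; have bc' := bc; rewrite /gate /dist1 => ->; rewrite normr0 !addr0.
case: j => -[|[|[|[|//]]]] jp; rewrite /arc /=.
- by move=> xa; rewrite ltr0_norm ?subr_lt0//; ring.
- move=> /andP[ax xb]; rewrite (gtr0_norm (x := _ - a)) ?subr_gt0//.
  rewrite (ltr0_norm (x := _ - b)) ?subr_lt0//.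
  by field; lra.
- move=> /andP[ax xb]; rewrite (gtr0_norm (x := _ - b)) ?subr_gt0//.
  rewrite (ltr0_norm (x := _ - c)) ?subr_lt0//.
  by field; lra.
- by move=> cx; rewrite gtr0_norm ?subr_gt0//; ring.
Qed.

Lemma cont_gate (X : topologicalType) (f : X -> 'rV[R]_2) j x :
  off_punctures (f x) -> {for x, continuous f} -> {for x, continuous (fun y => gate j (f y))}.
Proof.
move=> oz cf; have da : 0 < dist1 (f x) a by rewrite dist1_gt0// !inE eqxx.
have db : 0 < dist1 (f x) b by rewrite dist1_gt0// !inE eqxx orbT.
have dc : 0 < dist1 (f x) c by rewrite dist1_gt0// !inE eqxx !orbT.
have cd p : {for x, continuous (fun y => dist1 (f y) p)} by rewrite /dist1; cont.
have cda := cd a; have cdb := cd b; have cdc := cd c.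
case: j => -[|[|[|[|//]]]] jp; rewrite /gate /=; cont.
- by apply: cont_inv; [rewrite gt_eqF// addr_gt0|cont].
- by apply: cont_inv; [rewrite gt_eqF// addr_gt0|cont].
Qed.

(* Moves [z] to the gate along a segment bent upwards, so as to stay off the
   real axis in between. *)
Definition slide j (s : R) z := let g := gate j z in
  pnt ((1 - s) * z 0 0 + s * g) ((1 - s) * z 0 1 + s * (1 - s) * (`|z 0 0 - g| + `|z 0 1|)).

Lemma upper_slide j s z : 0 <= s <= 1 -> upper z -> upper (slide j s z).
Proof.
move=> /andP[s0 s1] /andP[z0 oz]; rewrite /upper /slide.
set g := gate j z; have ag : arc j g := arc_gate j oz.
have s1' : 0 <= 1 - s by rewrite subr_ge0.
have h1 : 0 <= (1 - s) * z 0 1 by rewrite mulr_ge0.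
have h2 : 0 <= s * (1 - s) * (`|z 0 0 - g| + `|z 0 1|) by rewrite !mulr_ge0// addr_ge0.
rewrite pnt1 addr_ge0//= /off_punctures !pntE.
have [/eqP|//] := eqVneq (_ + _) 0; rewrite /= paddr_eq0// => /andP[A0 B0].
have [s00|sn0] := eqVneq s 0.
  move: A0; rewrite s00 subr0 !mul1r mul0r addr0 => /eqP z00.
  by move: oz; rewrite /off_punctures z00 eqxx.
have [s1''|sn1] := eqVneq (1 - s) 0.
  rewrite s1'' mul0r add0r (_ : s = 1) ?mul1r; last by apply/esym/eqP; rewrite -subr_eq0 s1''.
  exact: (arc_off ab bc ag).
move: B0; rewrite !mulf_eq0 (negbTE sn0) (negbTE sn1) /= paddr_eq0// !normr_eq0 subr_eq0.
move=> /andP[/eqP-> _]; rewrite -mulrDl subrK mul1r.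
exact: (arc_off ab bc ag).
Qed.

Lemma slide0 j z : slide j 0 z = z.
Proof. by rewrite /slide subr0 !mul1r !mul0r !addr0 pnt_eta. Qed.

Lemma slide1 j z : slide j 1 z = pnt (gate j z) 0.
Proof. by rewrite /slide subrr mulr0 !mul0r !add0r mul1r. Qed.

Lemma slide_arc j s z : z 0 1 = 0 -> arc j (z 0 0) -> slide j s z = z.
Proof.
move=> z0 az; rewrite /slide gate_id// z0 subrr normr0 addr0 !mulr0 addr0.
by rewrite -mulrDl subrK mul1r -z0 pnt_eta.
Qed.

Lemma upper_gate j z : off_punctures z -> upper (pnt (gate j z) 0).
Proof.
move=> oz; rewrite /upper pnt1 lexx /= /off_punctures !pntE.
by rewrite (arc_off ab bc (arc_gate j oz)) orbT.
Qed.

(** Pushes the sheets of depth [n.+1] through their gates into their parents as [s] goes from 0 to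
    1, and fixes the sheets of depth at most [n]. Deeper sheets are collapsed at all times onto the
    gates of their ancestors, which extends the map continuously to the whole tree. *)
Fixpoint prune n v (s : R) z : tree :=
  if v is j :: v' then
    if size v' == n then sheet v (slide j (clamp s) z)
    else if (size v' < n)%N then sheet v z else prune n v' s (pnt (gate j z) 0)
  else sheet [::] z.

Lemma prune_small n v s z : (size v <= n)%N -> prune n v s z = sheet v z.
Proof. by case: v => [//|j v] /= vn; rewrite ltn_eqF// vn. Qed.

(** [slide] and [gate] fix arc [j] pointwise, so the outer sheet moves there as the inner one
    does. *)
Lemma prune_compatible n : compatible (prune n).
Proof.
move=> v j s z rv uz z0 az; have [w rw H] := wact_shorter j rv.
suff E : prune n (j :: w) s z = prune n w s z by case: H => -[-> ->].
have rw' := reduced_behead rw.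
have gl : sheet (j :: w) z = sheet w z by rewrite -(wact_cons rw) (sheet_glue ab bc).
rewrite /= slide_arc// gate_id// -z0 pnt_eta; case: ltngtP => wn.
- by rewrite prune_small// ltnW.
- by [].
- by rewrite prune_small ?wn.
Qed.

Lemma prune_continuous n v s z : reduced v -> off_punctures z ->
  {for (s, z), continuous (fun p : R * 'rV[R]_2 => prune n v p.1 (foldp p.2))}.
Proof.
suff H (X : topologicalType) (x : X) : reduced v -> forall (f : X -> R) (g : X -> 'rV[R]_2),
    {for x, continuous f} -> {for x, continuous g} -> (\forall y \near x, upper (g y)) ->
    {for x, continuous (fun y => prune n v (f y) (g y))}.
  move=> rv oz; apply: H => //.
  + by cont.
  + by apply: cont_fold; cont.
  have [j sj] := off_slit oz.
  have : \forall p \near (s, z), slit a b c j p.2.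
    apply: (cvg_snd (F := nbhs s) (G := nbhs z)).
    by apply: open_nbhs_nbhs; split=> //; exact: open_slit.
  by apply: filterS => p /(slit_off ab bc); exact: upper_fold.
have sc v' (g : X -> 'rV[R]_2) : reduced v' -> {for x, continuous g} ->
    (\forall y \near x, upper (g y)) -> {for x, continuous (fun y => sheet v' (g y))}.
  move=> rv' cg ug; have /andP[_ og] := nbhs_singleton ug.
  apply: (@continuous_near _ _ (fun y => sheet v' (foldp (g y)))).
    by move: (ug); apply: (@filterS _ (nbhs x)) => y /andP[g0 _]; rewrite fold_upper.
  by apply: (cont_comp (g := fun u => sheet v' (foldp u)) cg); exact: sheet_continuous.
elim: v => [|j v IH] rv f g cf cg ug /=; first exact: sc.
have /andP[_ og] := nbhs_singleton ug.
have cgate := cont_gate (j := j) og cg.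
case: (size v == n).
  apply: sc => //.
    by rewrite /slide /=; apply: cont_pnt; cont.
  by move: (ug); apply: (@filterS _ (nbhs x)) => y uy; apply: upper_slide => //; exact: clamp01.
case: (size v < n)%N; first exact: sc.
have H := IH (reduced_behead rv) f (fun y : X => pnt (gate j (g y)) 0).
refine (H cf _ _).
  by apply: cont_pnt; cont.
by move: (ug); apply: (@filterS _ (nbhs x)) => y /andP[_ oy]; exact: upper_gate.
Qed.

Lemma tree_continuous_kap (kap : seq 'I_4 -> R -> 'rV[R]_2 -> tree) :
  compatible kap ->
  (forall v s z, reduced v -> off_punctures z ->
     {for (s, z), continuous (fun p : R * 'rV[R]_2 => kap v p.1 (foldp p.2))}) ->
  continuous (fun p : R * tree => kap (word p.2) p.1 (foldp (proj p.2))).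
Proof. exact: glue_continuous. Qed.

Definition prune_map n (p : R * tree) := prune n (word p.2) p.1 (foldp (proj p.2)).

Lemma prune_map_continuous n : continuous (prune_map n).
Proof.
apply: tree_continuous_kap; first exact: prune_compatible.
by move=> v s z; exact: prune_continuous.
Qed.

Lemma size_sheet v z : reduced v -> upper z -> (size (word (sheet v z)) <= size v)%N.
Proof.
move=> rv uz; rewrite /word val_sheet//; case: eqP => // _.
by case: v rv => [//|k v] _; case: ifP => //= _.
Qed.

Lemma prune_map0 n t : (size (word t) <= n.+1)%N -> prune_map n (0, t) = t.
Proof.
rewrite /prune_map /= -[in RHS](sheet_word ab bc t); case: (word t) => [//|j v] /=.
rewrite ltnS leq_eqVlt => /orP[->|vn]; first by rewrite clamp_le0// slide0.
by rewrite ltn_eqF// vn.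
Qed.

Lemma prune_map1 n t : (size (word (prune_map n (1%R, t))) <= n)%N.
Proof.
rewrite /prune_map /=; have := upper_fold (off_proj t); have := reduced_word t.
elim: (word t) (foldp _) => [|j v IH] z rv uz; first exact: leq_trans (size_sheet _ _) _.
have /andP[_ oz] := uz; rewrite /=; case: eqP => [vn|_].
  rewrite clamp_ge1// slide1 /word val_sheet//; last exact: upper_gate.
  by rewrite pnt1 eqxx pnt0 arc_gate//= vn.
case: ifPn => vn; first by rewrite (leq_trans (size_sheet _ _)).
by apply: IH; [exact: reduced_behead rv|exact: upper_gate].
Qed.

(** The straight contraction of the closed upper half-plane to the point i; it leaves the axis, and
    with it the punctures, as soon as the time is positive. *)
Definition root_slide (s : R) z := pnt ((1 - clamp s) * z 0 0) ((1 - clamp s) * z 0 1 + clamp s).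

Definition root_map (p : R * tree) := sheet [::] (root_slide p.1 (foldp (proj p.2))).

Lemma upper_root_slide s z : upper z -> upper (root_slide s z).
Proof.
move=> /andP[z0 oz]; have /andP[s0 s1] := clamp01 s.
have h : 0 <= (1 - clamp s) * z 0 1 by rewrite mulr_ge0// subr_ge0.
rewrite /upper /root_slide pnt1 addr_ge0//= /off_punctures !pntE.
have [/eqP|//] := eqVneq (_ + _) 0; rewrite /= paddr_eq0// => /andP[A0 /eqP B0].
move: A0 oz; rewrite B0 subr0 !mul1r => /eqP z00.
by rewrite /off_punctures z00 eqxx.
Qed.

Lemma root_map_continuous : continuous root_map.
Proof.
apply: (@tree_continuous_kap (fun _ s z => sheet [::] (root_slide s z))) => [//|_ s z _ oz].
have [j sj] := off_slit oz.
have ns : \forall p \near (s, z), upper (root_slide p.1 (foldp p.2)).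
  have : \forall p \near (s, z), slit a b c j p.2.
    apply: (cvg_snd (F := nbhs s) (G := nbhs z)).
    by apply: open_nbhs_nbhs; split=> //; exact: open_slit.
  apply: (@filterS _ (nbhs (s, z))) => p /(slit_off ab bc) op.
  by apply: upper_root_slide; exact: upper_fold.
have /andP[_ on] := nbhs_singleton ns.
have cr : {for (s, z), continuous (fun p : R * 'rV[R]_2 => root_slide p.1 (foldp p.2))}.
  have cf : {for (s, z), continuous (fun p : R * 'rV[R]_2 => foldp p.2)} by apply: cont_fold; cont.
  by rewrite /root_slide; apply: cont_pnt; cont.
apply: (@continuous_near _ _ (fun p : R * 'rV[R]_2 => sheet [::] (foldp (root_slide p.1 (foldp p.2))))).
  by move: ns; apply: (@filterS _ (nbhs (s, z))) => p /andP[g0 _]; rewrite fold_upper.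
by apply: (cont_comp (g := fun u => sheet [::] (foldp u)) cr); exact: sheet_continuous.
Qed.

Lemma root_map0 t : word t = [::] -> root_map (0, t) = t.
Proof.
move=> t0; rewrite /root_map /= /root_slide clamp_le0// subr0 !mul1r addr0 pnt_eta.
by rewrite -{2}(sheet_word ab bc t) t0.
Qed.

Lemma root_map1 t t' : root_map (1, t) = root_map (1, t').
Proof. by rewrite /root_map /= /root_slide clamp_ge1// subrr !mul0r. Qed.

Lemma tree_joined t t' : joined (T := tree) (R := R) t t'.
Proof.
suff H n (u : tree) : (size (word u) <= n)%N -> joined (R := R) u (root_map (1, tree_base a b c)).
  by apply: joined_trans (H _ _ (leqnn _)) (joined_sym (H _ _ (leqnn _))).
elim: n u => [|n IH] u un.
  exists (fun s => root_map (s, u)); split.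
  + by have cr := root_map_continuous; cont.
  + by apply: root_map0; case: (word u) un.
  + exact: root_map1.
apply: joined_trans (IH _ (prune_map1 n u)).
exists (fun s => prune_map n (s, u)); split => //.
+ by have cr := @prune_map_continuous n; cont.
+ exact: prune_map0.
Qed.

(** Induction on the depth of the sheets met: pruning one generation is a free homotopy to a loop of
    smaller depth, and a loop of depth 0 contracts in the root half-plane. *)
Lemma null_bounded n (f : R -> tree) : continuous f -> f 0 = f 1 ->
  (forall t, (size (word (f t)) <= n)%N) -> null f.
Proof.
elim: n f => [|n IH] f cf f01 fn.
  have -> : f = (fun t => root_map (0, f t)).
    by apply/funext => t; rewrite root_map0//; case: (word (f t)) (fn t).
  apply: (null_free (K := fun p : R * R => root_map (p.1, f p.2))).
  + by have cr := root_map_continuous; cont.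
  + by move=> s _ /=; rewrite f01.
  + rewrite (_ : (fun t => _) = (fun=> root_map (1, f 0))); first exact: null_cst.
    by apply/funext => t; exact: root_map1.
have -> : f = (fun t => prune_map n (0, f t)).
  by apply/funext => t; rewrite prune_map0.
apply: (null_free (K := fun p : R * R => prune_map n (p.1, f p.2))).
+ by have cr := @prune_map_continuous n; cont.
+ by move=> s _ /=; rewrite f01.
+ apply: IH => //.
  * by have cr := @prune_map_continuous n; cont.
  * by rewrite f01.
  * by move=> t; exact: prune_map1.
Qed.

Lemma size_locally_bounded (t : tree) : exists M, \forall t' \near t, (size (word t') <= M)%N.
Proof.
have [j sj] := off_slit (off_proj t); have [w [rw ow] tE] := psi_surj ab bc sj.
have [oS _ _ opsi] := psi_embedding ab bc j rw ow.
exists (maxn (size w) (size (wact j w))).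
have : nbhs t (psi w j @` slit a b c j).
  apply: open_nbhs_nbhs; split; last by exists (proj t).
  by apply: opsi => //.
apply: (@filterS _ (nbhs t)) => _ [u su <-]; have ou := slit_off ab bc su.
rewrite /psi; case: leP => u0.
  by rewrite leq_max size_sheet// /upper u0.
rewrite leq_max orbC size_sheet//; first exact: reduced_wact.
by rewrite /upper off_mirror ou mirror1 oppr_ge0 ltW.
Qed.

(** The depth is locally bounded on the tree, hence bounded along a compact path. *)
Lemma loop_bounded (f : R -> tree) : continuous f ->
  exists n, forall t, 0 <= t <= 1 -> (size (word (f t)) <= n)%N.
Proof.
move=> cf; have /compact_near_coveringP := @segment_compact R 0 1.
move=> /(_ nat \oo (fun n t => (size (word (f t)) <= n)%N) _)[].
  move=> t _; have [M HM] := size_locally_bounded (f t).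
  have Hf : \forall s \near t, (size (word (f s)) <= M)%N by exact: cf HM.
  exists ([set s | (size (word (f s)) <= M)%N], [set n | (M <= n)%N]) => /=.
    by split=> //; exists M.
  by move=> [s n] /= [sM Mn]; exact: leq_trans sM Mn.
move=> n _ Hn; exists n => t t01; apply: (Hn n (leqnn n)).
by rewrite /= in_itv.
Qed.

Lemma continuous_clamped (T : topologicalType) (f : R -> T) :
  {within `[0, 1], continuous f} -> continuous (fun t => f (clamp t)).
Proof.
move=> cf t A /= fA.
have c01 : `[0, 1]%classic (clamp t) by rewrite /= in_itv /= clamp01.
have /= H := (subspace_continuousP _ f).1 cf (clamp t) c01 A fA.
rewrite nbhs_simpl /= in H.
 have cc : {for t, continuous (@clamp R)} by rewrite /clamp; cont.
have := cc _ H; rewrite nbhs_simpl /=; apply: (@filterS _ (nbhs t)) => s; apply.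
by rewrite /= in_itv /= clamp01.
Qed.

Lemma tree_simply_connected : simply_connected R tree.
Proof.
split=> [x y|f cf f01].
  have [f [cf f0 f1]] := tree_joined x y; exists f; split=> //.
  exact: continuous_subspaceT.
(* [null_bounded] asks for a depth bound at all real times, which the clamped loop inherits from
   [0, 1]. *)
have cg := continuous_clamped cf; pose g t := f (clamp t).
have [n gn] := loop_bounded cg.
have gf t : 0 <= t <= 1 -> g t = f t by move=> t01; rewrite /g clamp_id.
have z01 : 0 <= (0 : R) <= 1 by rewrite lexx ler01.
have o01 : 0 <= (1 : R) <= 1 by rewrite lexx ler01.
have [||H [cH H0 H1]] := @null_bounded n g cg.
- by rewrite !gf.
- by move=> t; have := gn (clamp t) (clamp01 t); rewrite /g (clamp_id (clamp01 t)).
exists H; split.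
- exact: continuous_subspaceT.
- by move=> t t01; have [-> ->] := H0 t t01; rewrite !gf.
- by move=> s s01; have [-> ->] := H1 s s01; rewrite gf.
Qed.

End TreeHomotopy.

(** * Logarithms on the tree *)

Section Logarithms.
Context {R : realType}.
Local Notation Re := complex.Re.
Local Notation Im := complex.Im.
Implicit Types (z p : R[i]) (u : 'rV[R]_2).

(** The logarithm cut along the positive axis, with argument between 0 and 2 pi; on the upper
    half-plane it agrees with [clogp] ([clogp_opp]). *)
Definition clogm z : R[i] := clogp (- z) + 0 +i* pi.

Definition slit_left z := (Im z != 0) || (Re z < 0).

Lemma hol_clogp_shift u p : slit_right (cof u - p) ->
  hol (fun v => clogp (cof v - p)) u (cof u - p)^-1.
Proof.
move=> su; pose Z (v : 'rV[R]_2) := rof (cof v - p).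
have hZ : cdd (fun v => cof (Z v)) u dir.
  apply: cdd_fun (cdd_ext (holB (hol_id u) (hol_cst p u)) _) => [v|k]; first by rewrite rofK.
  by rewrite subr0 mul1r.
have h : hol (fun v => clogp (cof v)) (Z u) (cof u - p)^-1.
  by rewrite -[cof u - p]rofK; apply: hol_clogp; rewrite rofK.
by apply: cdd_fun (hol_comp h hZ) => v; rewrite rofK.
Qed.

Lemma hol_clogm_shift u p : slit_left (cof u - p) ->
  hol (fun v => clogm (cof v - p)) u (cof u - p)^-1.
Proof.
move=> su; have z0 : cof u - p != 0.
  by apply: contraTneq su => ->; rewrite /slit_left /= eqxx ltxx.
pose Z (v : 'rV[R]_2) := rof (p - cof v).
have hZ : cdd (fun v => cof (Z v)) u (fun k => - dir k).
  apply: cdd_fun (cdd_ext (holB (hol_cst p u) (hol_id u)) _) => [v|k]; first by rewrite rofK.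
  by rewrite sub0r mulN1r.
have h : hol (fun v => clogp (cof v)) (Z u) (p - cof u)^-1.
  rewrite -[p - _]rofK; apply: hol_clogp; rewrite rofK -opprB.
  by move: su; rewrite /slit_left /slit_right cImN cReN oppr_eq0 oppr_gt0.
apply: cdd_fun (cdd_ext (cddD (hol_comp h hZ) (cdd_cst (0 +i* pi) u)) _) => [v|k].
  by rewrite /clogm rofK opprB.
by rewrite addr0 mulrN -mulNr -invrN opprB.
Qed.

Lemma modcN z : modc (- z) = modc z.
Proof. by rewrite /modc /normc2 cReN cImN !sqrrN. Qed.

Lemma clogp_conj z : Im (clogp (z^*)%C) = - Im (clogp z).
Proof.
case: z => x y; rewrite /clogp /= (_ : modc (x -i* y) = modc (x +i* y)).
  by rewrite mulNr atanN mulrN.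
by rewrite /modc /normc2 /= sqrrN.
Qed.

Lemma atan_inv (t : R) : 0 < t -> atan t = pi / 2 - atan t^-1.
Proof.
move=> t0; have ti : 0 < t^-1 by rewrite invr_gt0.
have h0 : 0 < atan t^-1 by rewrite -atan0; exact: lt_atan.
have h1 := atan_ltpi2 t^-1; have h2 := atan_ltpi2 t; have h3 := atan_gtNpi2 t.
apply: tan_inj; rewrite ?in_itv/=; try (apply/andP; split; lra).
rewrite atanK /tan sinB cosB sin_pihalf cos_pihalf !mul1r !mul0r subr0 add0r.
by rewrite -[RHS]invrK invf_div -/(tan _) atanK invrK.
Qed.

(** With r = |z| the half-angle tangents of z and - z are y / (r + x) and - y / (r - x). Since (r +
    x)(r - x) = y^2, each is minus the inverse of the other, and [atan_inv] applies. *)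
Lemma clogp_opp z : 0 < Im z -> Im (clogp z) = Im (clogp (- z)) + pi.
Proof.
move=> y0; have su : slit_right z by rewrite /slit_right gt_eqF.
have su' : slit_right (- z) by rewrite /slit_right cImN oppr_eq0 gt_eqF.
have h1 := slit_right_modc su; have h2 := slit_right_modc su'.
rewrite /clogp /= modcN cImN cReN mulNr atanN; rewrite modcN cReN in h2.
have -> : Im z / (modc z + Re z) = (Im z / (modc z - Re z))^-1.
  rewrite invf_div; apply/eqP; rewrite eqr_div ?lt0r_neq0//.
  have := modc_sq z; rewrite !expr2 => E; apply/eqP.
  by transitivity (modc z * modc z - Re z * Re z); [rewrite E; ring|ring].
have p0 : 0 < Im z / (modc z - Re z) by rewrite divr_gt0.
by rewrite (atan_inv p0); field.
Qed.

End Logarithms.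

Section LiftedLog.
Context {R : realType}.
Variables a b c : R.
Hypotheses (ab : a < b) (bc : b < c).
Local Notation Re := complex.Re.
Local Notation Im := complex.Im.
Local Notation arc := (arc a b c).
Local Notation psi := (@psi R a b c).
Local Notation word := (@word R a b c).
Local Notation proj := (@proj R a b c).
Local Notation upper := (upper a b c).

Definition puncture (k : 'I_3) : R := match val k with 0 => a | 1 => b | _ => c end.

(* Crossing [arc j] from the upper to the lower half-plane increases the
   winding about each of the punctures to the right of the arc. *)
Fixpoint winding (k : 'I_3) (v : seq 'I_4) : R :=
  if v is j :: v' then
    winding k v' + (if (j <= k)%N then (-1) ^+ odd (size v') else 0)
  else 0.

Lemma winding_wact k j v : reduced v ->
  winding k (wact j v) = winding k v + (if (j <= k)%N then (-1) ^+ odd (size v) else 0).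
Proof.
move=> rv; have [w rw [[-> ->]|[-> ->]]] := wact_shorter j rv; first by [].
rewrite /=; case: ifP => _; last by rewrite !addr0.
by rewrite -addrA; case: (odd _); rewrite /= !(expr0, expr1) ?subrr ?addNr addr0.
Qed.

(* The argument in [0, pi] on the closed upper half-plane. *)
Definition uarg (z : R[i]) : R := if (Im z == 0) && (Re z < 0) then pi else Im (clogp z).

Lemma uarg_off z : Im z != 0 -> uarg z = Im (clogp z).
Proof. by rewrite /uarg => /negbTE->. Qed.

(** The parameter stays in the upper half-plane, so on an odd sheet [uarg] is the argument of the
    conjugate point, whence the sign. The [unit] fills the slot for a homotopy parameter in
    [compatible]. *)
Definition lift_kap (k : 'I_3) (v : seq 'I_4) (_ : unit) (u : 'rV[R]_2) : R[i] :=
  let z := cof u - (puncture k)%:C in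
  ln (modc z) +i* ((-1) ^+ odd (size v) * uarg z + 2 * pi * winding k v).

Definition lift_log k (t : tree a b c) : R[i] := lift_kap k (word t) tt (foldp (proj t)).

Lemma arc_puncture (j : 'I_4) (k : 'I_3) x : arc j x ->
  if (j <= k)%N then x < puncture k else puncture k < x.
Proof.
have ab' := ab; have bc' := bc.
by case: j => -[|[|[|[|//]]]] jp; case: k => -[|[|[|//]]] kp; rewrite /arc /puncture /=;
  try (move=> /andP[? ?]); try (move=> ?); lra.
Qed.

(** To the left of the puncture [uarg] is pi, and its change of sign is a jump by 2 pi that
    [winding] compensates; to the right [uarg] is 0. *)
Lemma lift_compatible k : compatible a b c (lift_kap k).
Proof.
move=> v j x u rv uu u0 aj; rewrite /lift_kap winding_wact// odd_wact.
have := arc_puncture k aj; rewrite /uarg /= u0 subr0 eqxx /= subr_lt0.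
case: ifP => jk xp; congr (_ +i* _).
  by rewrite xp; case: (odd _); rewrite /= !(expr0, expr1); ring.
by rewrite ltNge ltW//= mul0r atan0 mulr0 !mulr0 addr0.
Qed.

(** Over [slit j] the cut must avoid arc [j]: it runs to the right of the puncture exactly when the
    arc lies to its left. *)
Definition branch (j : 'I_4) (k : 'I_3) (z : R[i]) : R[i] :=
  if (j <= k)%N then clogm z else clogp z.

Lemma lift_log_psi k w j u : reduced w -> ~~ odd (size w) -> slit a b c j u ->
  lift_log k (psi w j u) = branch j k (cof u - (puncture k)%:C) + 0 +i* (2 * pi * winding k w).
Proof.
move=> rw ow su; have ou := slit_off ab bc su.
set z := cof u - _.
have Rz : Re z = u 0 0 - puncture k by [].
have Iz : Im z = u 0 1 by rewrite /z /= subr0.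
have H v : reduced v -> forall x, upper x -> lift_log k (sheet a b c v x) = lift_kap k v tt x.
  by move=> rv x ux; rewrite /lift_log compatible_sheet//; exact: lift_compatible.
have mz : modc (cof (mirror u) - (puncture k)%:C) = modc z.
  by rewrite /modc /normc2 /= mirror0 mirror1 !subr0 sqrrN.
have cz : cof (mirror u) - (puncture k)%:C = (z^*)%C.
  by apply: eq_complexP; rewrite /= ?mirror0 ?mirror1 ?Iz//= ?subr0.
rewrite /psi; case: ltrgtP => y0.
- rewrite H//; last by rewrite /upper ltW.
  rewrite /lift_kap (negbTE ow) expr0 mul1r -/z uarg_off ?Iz ?gt_eqF//.
  rewrite /branch; case: ifP => _; apply: eq_complexP; rewrite /= ?addr0//.
    by rewrite modcN.
  by rewrite [LHS](_ : _ = Im (clogp z) + 2 * pi * winding k w)// clogp_opp ?Iz.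
- rewrite H; last 2 first.
  + exact: reduced_wact.
  + by rewrite /upper off_mirror ou mirror1 oppr_ge0 ltW.
  rewrite /lift_kap mz odd_wact ow expr1 winding_wact// (negbTE ow) expr0.
  have Icz : Im (z^*)%C = - u 0 1 by rewrite -Iz; case: (z).
  rewrite cz uarg_off ?Icz ?oppr_eq0 ?lt_eqF// clogp_conj mulN1r opprK.
  rewrite /branch; case: ifP => _; apply: eq_complexP; rewrite /= ?addr0//.
    by rewrite modcN.
  rewrite [X in X + _ = _](_ : _ = Im (clogp z))// -[X in _ = X + pi + _]/(Im (clogp (- z))).
  by rewrite (@clogp_opp _ (- z)) ?opprK ?cImN ?Iz ?oppr_gt0//; ring.
- rewrite H//; last by rewrite /upper -y0 lexx.
  rewrite /lift_kap (negbTE ow) expr0 mul1r -/z /uarg Iz -y0 eqxx /=.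
  have aj : arc j (u 0 0) by move: su; rewrite /slit /= -y0 eqxx.
  have := arc_puncture k aj; rewrite /branch; case: ifP => _ xp.
    rewrite subr_lt0 xp; apply: eq_complexP; rewrite /= ?addr0 ?modcN//.
    by rewrite -y0 subr0 oppr0 mul0r atan0 mulr0 add0r.
  by rewrite subr_lt0 ltNge ltW//=; apply: eq_complexP; rewrite /= ?addr0.
Qed.

Lemma hol_branch j k u : slit a b c j u ->
  hol (fun v => branch j k (cof v - (puncture k)%:C)) u (cof u - (puncture k)%:C)^-1.
Proof.
move=> su; rewrite /branch.
have H : if (j <= k)%N then (u 0 1 != 0) || (u 0 0 < puncture k)
         else (u 0 1 != 0) || (puncture k < u 0 0).
  move: su; rewrite /slit /=; case: (u 0 1 == 0) => /=; last by rewrite if_same.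
  exact: arc_puncture.
case: ifP H => _ H.
  by apply: hol_clogm_shift; rewrite /slit_left /= subr0 subr_lt0.
by apply: hol_clogp_shift; rewrite /slit_right /= subr0 subr_gt0.
Qed.

End LiftedLog.

(** * The sphere in stereographic coordinates *)

Section Vectors.
Context {R : realType}.
Implicit Types u v w : 'rV[R]_3.

Lemma ord3P (k : 'I_3) : [\/ k = 0, k = 1 | k = 2].
Proof.
by case: k => -[|[|[|//]]] ?; [constructor 1|constructor 2|constructor 3]; exact/val_inj.
Qed.

Lemma sum3 (V : zmodType) (F : 'I_3 -> V) : \sum_k F k = F 0 + F 1 + F 2.
Proof.
rewrite !big_ord_recl big_ord0 addr0 addrA.
by congr (F _ + F _ + F _); exact/val_inj.
Qed.

Lemma dot3 u v : dot u v = u 0 0 * v 0 0 + u 0 1 * v 0 1 + u 0 2 * v 0 2.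
Proof. by rewrite /dot sum3. Qed.

Lemma row3P u v : u 0 0 = v 0 0 -> u 0 1 = v 0 1 -> u 0 2 = v 0 2 -> u = v.
Proof. by move=> ? ? ?; apply/rowP => k; case: (ord3P k) => ->. Qed.

Lemma cross0 u v : cross u v 0 0 = u 0 1 * v 0 2 - u 0 2 * v 0 1.
Proof. by rewrite mxE !add0r. Qed.
Lemma cross1 u v : cross u v 0 1 = u 0 2 * v 0 0 - u 0 0 * v 0 2.
Proof.
by rewrite mxE; congr (u 0 _ * v 0 _ - u 0 _ * v 0 _); exact/val_inj.
Qed.
Lemma cross2 u v : cross u v 0 2 = u 0 0 * v 0 1 - u 0 1 * v 0 0.
Proof.
by rewrite mxE; congr (u 0 _ * v 0 _ - u 0 _ * v 0 _); exact/val_inj.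
Qed.
Definition crossE := (cross0, cross1, cross2).

Definition vec3 (x y z : R) : 'rV[R]_3 :=
  \row_k (if k == 0 then x else if k == 1 then y else z).
Lemma vec30 x y z : vec3 x y z 0 0 = x. Proof. by rewrite mxE. Qed.
Lemma vec31 x y z : vec3 x y z 0 1 = y. Proof. by rewrite mxE. Qed.
Lemma vec32 x y z : vec3 x y z 0 2 = z. Proof. by rewrite mxE. Qed.
Definition vec3E := (vec30, vec31, vec32).

Lemma crossZl k u v : cross (k *: u) v = k *: cross u v.
Proof. by apply: row3P; rewrite [RHS]mxE !crossE ![(k *: u) _ _]mxE; ring. Qed.

Lemma dotC u v : dot u v = dot v u.
Proof. by rewrite !dot3; ring. Qed.
Lemma dotDl u v w : dot (u + v) w = dot u w + dot v w.
Proof. by rewrite !dot3 !mxE; ring. Qed.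
Lemma dotZl k u v : dot (k *: u) v = k * dot u v.
Proof. by rewrite !dot3 !mxE; ring. Qed.
Lemma dotNl u v : dot (- u) v = - dot u v.
Proof. by rewrite !dot3 !mxE; ring. Qed.
Lemma dotNr u v : dot u (- v) = - dot u v.
Proof. by rewrite !dot3 !mxE; ring. Qed.
Lemma dot_ge0 u : 0 <= dot u u.
Proof. by rewrite dot3 !addr_ge0// -expr2 sqr_ge0. Qed.
Lemma dot_eq0 u : (dot u u == 0) = (u == 0).
Proof.
apply/eqP/eqP => [|->]; last by rewrite dot3 !mxE !mulr0 !addr0.
rewrite dot3 => /eqP; rewrite -!expr2 !paddr_eq0 ?addr_ge0 ?sqr_ge0// !sqrf_eq0.
by move=> /andP[/andP[/eqP ? /eqP ?] /eqP ?]; apply: row3P; rewrite mxE.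
Qed.
Lemma enorm_sq u : enorm u ^+ 2 = dot u u.
Proof. by rewrite /enorm sqr_sqrtr// dot_ge0. Qed.
Lemma enorm1 u : enorm u = 1 <-> dot u u = 1.
Proof.
rewrite -enorm_sq; split=> [->|/eqP]; first by rewrite expr1n.
by rewrite sqrp_eq1 ?sqrtr_ge0// => /eqP.
Qed.

Lemma row_addE u v k : (u + v) 0 k = u 0 k + v 0 k. Proof. by rewrite mxE. Qed.
Lemma row_oppE u k : (- u) 0 k = - u 0 k. Proof. by rewrite mxE. Qed.
Lemma row_scaleE (a : R) u k : (a *: u) 0 k = a * u 0 k. Proof. by rewrite mxE. Qed.
Definition rowE := (row_addE, row_oppE, row_scaleE).

End Vectors.

Section GaussPlane.
Context {R : realType}.
Variable th : R.
Implicit Types (u : 'rV[R]_2) (z w : R[i]).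
Local Notation Re := complex.Re.
Local Notation Im := complex.Im.
Local Notation co := (cos th).
Local Notation si := (sin th).

Definition rad u : R := 1 + u 0 0 ^+ 2 + u 0 1 ^+ 2.

Definition nun u : 'rV[R]_3 :=
  let d := 1 - u 0 0 ^+ 2 - u 0 1 ^+ 2 in
  vec3 (co * d - 2 * si * u 0 0) (si * d + 2 * co * u 0 0) (- (2 * u 0 1)).

(* The inverse of the stereographic projection from [-(cos th, sin th, 0)];
   it maps the upper half-plane to the hemisphere below the equator. *)
Definition nu u : 'rV[R]_3 := (rad u)^-1 *: nun u.

(* The null vector spanning, over [u], the complexified tangent plane. *)
Definition nullv z (k : 'I_3) : R[i] :=
  if k == 0 then si%:C * (1 - z ^+ 2) + (2 * co)%:C * z
  else if k == 1 then - co%:C * (1 - z ^+ 2) + (2 * si)%:C * z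
  else 'i%C * (1 + z ^+ 2).

Lemma nullvE z k : nullv z k =
  if k == 0 then si%:C * (1 - z ^+ 2) + (2 * co)%:C * z
  else if k == 1 then - co%:C * (1 - z ^+ 2) + (2 * si)%:C * z
  else 'i%C * (1 + z ^+ 2).
Proof. by []. Qed.

Definition rev (w : R[i]) (u : 'rV[R]_2) : 'rV[R]_3 := \row_k Re (w * nullv (cof u) k).

Lemma rad_gt0 u : 0 < rad u.
Proof. by rewrite /rad -addrA ltr_pwDl// addr_ge0 ?sqr_ge0. Qed.

Lemma rad_neq0 u : rad u != 0.
Proof. by rewrite gt_eqF// rad_gt0. Qed.

Lemma rev0 w u : rev w u 0 0 =
  Re w * (si * (1 - u 0 0 ^+ 2 + u 0 1 ^+ 2) + 2 * co * u 0 0)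
  - Im w * (- 2 * si * u 0 0 * u 0 1 + 2 * co * u 0 1).
Proof. by rewrite mxE cReM /nullv/= ?(cReM, cReD, cImM, cImD, cReN, cImN) /=; ring. Qed.
Lemma rev1 w u : rev w u 0 1 =
  Re w * (- co * (1 - u 0 0 ^+ 2 + u 0 1 ^+ 2) + 2 * si * u 0 0)
  - Im w * (2 * co * u 0 0 * u 0 1 + 2 * si * u 0 1).
Proof. by rewrite mxE cReM /nullv/= ?(cReM, cReD, cImM, cImD, cReN, cImN) /=; ring. Qed.
Lemma rev2 w u : rev w u 0 2 =
  Re w * (- 2 * u 0 0 * u 0 1) - Im w * (1 + u 0 0 ^+ 2 - u 0 1 ^+ 2).
Proof. by rewrite mxE cReM /nullv/= ?(cReM, cReD, cImM, cImD, cReN, cImN) /=; ring. Qed.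
Definition revE := (rev0, rev1, rev2).

Lemma cs : si ^+ 2 = 1 - co ^+ 2. Proof. exact: sin2cos2. Qed.

Lemma nun0 u : nun u 0 0 = co * (1 - u 0 0 ^+ 2 - u 0 1 ^+ 2) - 2 * si * u 0 0.
Proof. by rewrite vec30. Qed.
Lemma nun1 u : nun u 0 1 = si * (1 - u 0 0 ^+ 2 - u 0 1 ^+ 2) + 2 * co * u 0 0.
Proof. by rewrite vec31. Qed.
Lemma nun2 u : nun u 0 2 = - (2 * u 0 1).
Proof. by rewrite vec32. Qed.
Definition nunE := (nun0, nun1, nun2).

Lemma nuE u k : nu u 0 k = nun u 0 k / rad u.
Proof. by rewrite mxE mulrC. Qed.

Lemma dot_rev_nun w u : dot (rev w u) (nun u) = 0.
Proof. by rewrite dot3 !revE !nunE; ring: cs. Qed.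

Lemma dot_nun u : dot (nun u) (nun u) = rad u ^+ 2.
Proof. by rewrite dot3 !nunE /rad; ring: cs. Qed.

Lemma dot_rev w w' u :
  dot (rev w u) (rev w' u) = rad u ^+ 2 * (Re w * Re w' + Im w * Im w').
Proof. by rewrite dot3 !revE /rad; ring: cs. Qed.

Lemma cross_rev w w' u :
  cross (rev w u) (rev w' u) = (rad u * (Re w * Im w' - Im w * Re w')) *: nun u.
Proof.
by apply: row3P; rewrite !crossE !revE rowE !nunE /rad; ring: cs.
Qed.

Lemma rev_eq0 w u : rev w u = 0 -> w = 0.
Proof.
move=> w0; have : dot (rev w u) (rev w u) = 0 by rewrite w0 dot3 !mxE !mulr0 !addr0.
rewrite dot_rev => /eqP; rewrite mulf_eq0 sqrf_eq0 (negbTE (rad_neq0 u)) /=.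
rewrite -!expr2 paddr_eq0 ?sqr_ge0// !sqrf_eq0 => /andP[/eqP ? /eqP ?].
exact: eq_complexP.
Qed.

(* The coordinate, with respect to [rev], of a vector orthogonal to [nu u]. *)
Definition unrev (X : 'rV[R]_3) u : R[i] :=
  (dot X (rev 1 u) / rad u ^+ 2) +i* (dot X (rev 'i%C u) / rad u ^+ 2).

Lemma rev_unrev X u : dot X (nu u) = 0 -> X = rev (unrev X u) u.
Proof.
move=> Xn; apply/eqP; rewrite -subr_eq0 -dot_eq0; apply/eqP.
set Y := X - _; have r0 := rad_neq0 u.
have Y1 : dot Y (rev 1 u) = 0.
  by rewrite /Y dotDl dotNl dot_rev /=; field.
have Yi : dot Y (rev 'i%C u) = 0.
  by rewrite /Y dotDl dotNl dot_rev /=; field.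
have Yn : dot Y (nun u) = 0.
  rewrite /Y dotDl dotNl dot_rev_nun subr0; move: Xn; rewrite dotC dotZl dotC => /eqP.
  by rewrite mulf_eq0 invr_eq0 (negbTE r0) => /eqP.
clearbody Y.
(* The three vectors are orthogonal and all of length [rad u]; this is the expansion of [Y] in that
   basis. *)
have E : rad u ^+ 2 *: Y = dot Y (rev 1 u) *: rev 1 u + dot Y (rev 'i%C u) *: rev 'i%C u
     + dot Y (nun u) *: nun u.
  by apply: row3P; rewrite !rowE !dot3 !revE !nunE /rad /=; ring: cs.
rewrite Y1 Yi Yn !scale0r !addr0 in E.
have /eqP : rad u ^+ 2 *: Y = 0 by [].
by rewrite scaler_eq0 sqrf_eq0 (negbTE r0) => /eqP ->; rewrite dot3 !mxE !mulr0 !addr0.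
Qed.

Lemma unrev_rev w u : unrev (rev w u) u = w.
Proof.
by apply: eq_complexP; rewrite /unrev /= dot_rev /=; field; exact: rad_neq0.
Qed.

(* The stereographic projection inverse to [nu]. *)
Definition zet (n : 'rV[R]_3) : 'rV[R]_2 :=
  let d := 1 + (co * n 0 0 + si * n 0 1) in
  pnt ((co * n 0 1 - si * n 0 0) / d) (- n 0 2 / d).

Lemma nu_zet (n : 'rV[R]_3) : dot n n = 1 -> 1 + (co * n 0 0 + si * n 0 1) != 0 ->
  nu (zet n) = n.
Proof.
rewrite dot3 => nn d0; set m1 := co * n 0 0 + si * n 0 1 in d0 *.
pose m2 := co * n 0 1 - si * n 0 0.
have m12 : m2 ^+ 2 + n 0 2 ^+ 2 = 1 - m1 ^+ 2.
  rewrite -nn /m1 /m2; ring: cs.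
have Z0 : zet n 0 0 = m2 / (1 + m1) by rewrite pnt0.
have Z1 : zet n 0 1 = - n 0 2 / (1 + m1) by rewrite pnt1.
have n0E : n 0 0 = co * m1 - si * m2 by rewrite /m1 /m2; ring: cs.
have n1E : n 0 1 = si * m1 + co * m2 by rewrite /m1 /m2; ring: cs.
have S2 : zet n 0 0 ^+ 2 + zet n 0 1 ^+ 2 = (1 - m1) / (1 + m1).
  rewrite Z0 Z1; transitivity ((m2 ^+ 2 + n 0 2 ^+ 2) / (1 + m1) ^+ 2); first by field.
  by rewrite m12; field.
have radE : rad (zet n) = 2 / (1 + m1).
  by rewrite /rad -addrA S2; field.
have dE : 1 - zet n 0 0 ^+ 2 - zet n 0 1 ^+ 2 = 2 * m1 / (1 + m1).
  by rewrite -addrA -opprD S2; field.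
clearbody m1 m2.
by apply: row3P; rewrite !nuE !nunE ?dE radE ?Z0 ?Z1 ?n0E ?n1E; field.
Qed.

(** The conjugate expresses that the differential of [nu] is antilinear for the complex structure X
    |-> n x X of the tangent plane, which [rev] turns into multiplication by i ([cross_nu_rev]). *)
Lemma dd_nu (Z : 'rV[R]_2 -> 'rV[R]_2) u b j : cdd (fun v => cof (Z v)) u b ->
  dd (fun v => nu (Z v) 0 j) u
    (fun k => - 2 / rad (Z u) ^+ 2 * rev (b k)^*%C (Z u) 0 j).
Proof.
move=> [dx dy]; rewrite /= in dx dy; have r0 := rad_neq0 (Z u).
have drad : dd (fun v => rad (Z v)) u
    (fun k => 2 * (Z u 0 0 * Re (b k) + Z u 0 1 * Im (b k))).
  apply: dd_ext (ddD (ddD (dd_cst 1 u) (ddM dx dx)) (ddM dy dy)) _ => k /=; ring.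
have drV := ddV (f := fun v => rad (Z v)) r0 drad.
have dsq : dd (fun v => 1 - Z v 0 0 ^+ 2 - Z v 0 1 ^+ 2) u
    (fun k => - 2 * (Z u 0 0 * Re (b k) + Z u 0 1 * Im (b k))).
  apply: dd_ext (ddB (ddB (dd_cst 1 u) (ddM dx dx)) (ddM dy dy)) _ => k /=; ring.
have H (p q r : R) : nun (Z u) 0 j = p * (1 - Z u 0 0 ^+ 2 - Z u 0 1 ^+ 2) + q * Z u 0 0 + r * Z u 0 1 ->
    (forall v, nun v 0 j = p * (1 - v 0 0 ^+ 2 - v 0 1 ^+ 2) + q * v 0 0 + r * v 0 1) ->
    dd (fun v => nu (Z v) 0 j) u (fun k =>
      ((- 2 * p * (Z u 0 0 * Re (b k) + Z u 0 1 * Im (b k)) + q * Re (b k) + r * Im (b k)) * rad (Z u) -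
       nun (Z u) 0 j * (2 * (Z u 0 0 * Re (b k) + Z u 0 1 * Im (b k)))) / rad (Z u) ^+ 2).
  move=> _ nE; have dn := ddD (ddD (ddM (dd_cst p u) dsq) (ddM (dd_cst q u) dx)) (ddM (dd_cst r u) dy).
  apply: dd_ext (dd_near _ (ddM dn drV)) _.
    by apply: filterE => v /=; rewrite nuE nE.
  by move=> k /=; rewrite nE; field.
case: (ord3P j) => jE; subst j.
- apply: dd_ext (H co (- 2 * si) 0 _ _) _ => [|v|k].
  + by rewrite nunE; ring.
  + by rewrite nunE; ring.
  + rewrite [RHS]mulrAC; congr (_ / _); rewrite revE nunE /rad; case: (b k) => p q /=; ring.
- apply: dd_ext (H si (2 * co) 0 _ _) _ => [|v|k].
  + by rewrite nunE; ring.
  + by rewrite nunE; ring.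
  + rewrite [RHS]mulrAC; congr (_ / _); rewrite revE nunE /rad; case: (b k) => p q /=; ring.
- apply: dd_ext (H 0 0 (- 2) _ _) _ => [|v|k].
  + by rewrite nunE; ring.
  + by rewrite nunE; ring.
  + rewrite [RHS]mulrAC; congr (_ / _); rewrite revE nunE /rad; case: (b k) => p q /=; ring.
Qed.

Lemma cross_nu_rev w u : cross (nu u) (rev w u) = rev ('i%C * w) u.
Proof.
have r0 := rad_neq0 u; rewrite crossZl.
suff -> : cross (nun u) (rev w u) = rad u *: rev ('i%C * w) u.
  by rewrite scalerA mulVf// scale1r.
by apply: row3P; rewrite rowE !crossE !revE !nunE /rad cReM cImM /=; ring: cs.
Qed.

(* The Gauss map in the coordinate of [nu]. *)
Definition mob z : R[i] := expi th * (1 + 'i%C * z) / (1 - 'i%C * z).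

Lemma mobE z : mob z = expi th * (1 + 'i%C * z) / (1 - 'i%C * z).
Proof. by []. Qed.

Lemma nu2_eq1 u : (nu u 0 2 == 1) = (1 - 'i%C * cof u == 0).
Proof.
have r0 := rad_neq0 u; rewrite nuE nunE.
rewrite -[X in _ == X](divff r0) (inj_eq (mulIf (invr_neq0 r0))).
apply/eqP/eqP.
  rewrite /rad => E; have /eqP : u 0 0 ^+ 2 + (1 + u 0 1) ^+ 2 = 0.
    transitivity (1 + u 0 0 ^+ 2 + u 0 1 ^+ 2 + 2 * u 0 1); first by ring.
    by rewrite -E addNr.
  rewrite paddr_eq0 ?sqr_ge0// !sqrf_eq0 => /andP[/eqP x0 /eqP y0].
  by apply: eq_complexP; rewrite /= ?(cReD, cReN, cReM, cImD, cImN, cImM)/= x0; lra.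
move=> E; have := congr1 (@complex.Re R) E; have := congr1 (@complex.Im R) E.
rewrite /= ?(cReD, cReN, cReM, cImD, cImN, cImM)/= => x0 y0.
have -> : u 0 1 = -1 by lra.
rewrite /rad (_ : u 0 0 = 0); last by lra.
by rewrite (_ : u 0 1 = -1); [ring|lra].
Qed.

Lemma gauss_nu u : nu u 0 2 != 1 ->
  (nu u 0 0 +i* nu u 0 1) / (1 - nu u 0 2)%:C = mob (cof u).
Proof.
move=> n1; have := n1; rewrite nu2_eq1 => z1; have r0 := rad_neq0 u.
have n2 : (1 - nu u 0 2)%:C != 0 :> R[i].
  by rewrite eq_complex /= negb_and subr_eq0 eq_sym n1.
apply/eqP; rewrite /mob eqr_div//; apply/eqP; rewrite !nuE.
have -> : nun u 0 0 / rad u +i* (nun u 0 1 / rad u) = (nun u 0 0 +i* nun u 0 1) * ((rad u)^-1)%:C.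
  by apply: eq_complexP; rewrite ?(cReM, cImM)/=; ring.
have -> : (1 - nun u 0 2 / rad u)%:C = (rad u - nun u 0 2)%:C * ((rad u)^-1)%:C :> R[i].
  by rewrite -rmorphM /=; congr (_%:C); field.
rewrite mulrAC [RHS]mulrA; congr (_ * _); rewrite /expi.
by apply: eq_complexP; rewrite ?(cReM, cImM, cReD, cImD, cReN, cImN)/= !nunE /rad; ring.
Qed.

End GaussPlane.

(** * Smoothness and minimality of conformal patches *)

Section ConformalPatch.
Context {R : realType}.
Variable th : R.
Local Notation Re := complex.Re.
Local Notation Im := complex.Im.
Local Notation nu := (nu th).
Local Notation nullv := (nullv th).
Local Notation rev := (rev th).
Implicit Types (u : 'rV[R]_2) (D : set 'rV[R]_2) (r : 'rV[R]_2 -> 'rV[R]_3).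

(** A function listed with all its complex derivatives; this reduces [smooth_on] to an induction on
    the word of partial derivatives. *)
Definition tower D (F : nat -> 'rV[R]_2 -> R[i]) :=
  forall n u, D u -> hol (F n) u (F n.+1 u).

Definition dirs (s : seq 'I_2) : R[i] := \prod_(k <- s) dir k.

(** The iterated partial along [s] is the real part of [dirs s] times the derivative of order
    [size s]. *)
Lemma smooth_tower D (F : 'I_3 -> nat -> 'rV[R]_2 -> R[i]) r :
  open D -> (forall k, tower D (F k)) ->
  (forall u, D u -> forall k, r u 0 k = Re (F k 0 u)) -> smooth_on D r.
Proof.
move=> oD tF rF.
have H s u : D u -> forall k, (foldr (fun k g => pd k g) r s) u 0 k = Re (dirs s * F k (size s) u) /\
    dd (fun v => (foldr (fun k g => pd k g) r s) v 0 k) u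
      (fun i => Re (dirs (i :: s) * F k (size s).+1 u)).
  elim: s u => [|i s IH] u Du k.
    have nD : \forall v \near u, D v by apply: open_nbhs_nbhs.
    split; first by rewrite /dirs big_nil mul1r rF.
    have [h _] := tF k 0 _ Du; apply: dd_ext (dd_near _ h) _.
      by move: nD; apply: (@filterS _ (nbhs u)) => v Dv; rewrite rF.
    by move=> i; rewrite /dirs big_cons big_nil mulr1 mulrC.
  have E v : D v -> (foldr (fun k g => pd k g) r (i :: s)) v 0 k = Re (dirs (i :: s) * F k (size s).+1 v).
    move=> Dv; rewrite /= pd_row; first by have [_ [_ ->]] := IH v Dv k.
    by apply/differentiable_row => j; have [_ [dj _]] := IH v Dv j.
  split; first exact: E.
  have nD : \forall v \near u, D v by apply: open_nbhs_nbhs.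
  have [h _] := holZ (dirs (i :: s)) (tF k (size s).+1 _ Du).
  apply: dd_ext (dd_near _ h) _.
    by move: nD; apply: (@filterS _ (nbhs u)) => v Dv; rewrite E.
  by move=> l /=; rewrite {2}/dirs big_cons -/(dirs _); congr Re; ring.
move=> s u Du; apply/differentiable_row => k.
by have [_ [? _]] := H s u Du k.
Qed.

(** The n-th derivative of 1 / (z - p). *)
Definition tower_inv p n (z : R[i]) : R[i] :=
  (-1) ^+ n * (n`!)%:R * (z - p)^-1 ^+ n.+1.

Lemma hol_inv_pow p n u : cof u != p ->
  hol (fun v => (cof v - p)^-1 ^+ n.+1) u (- n.+1%:R * (cof u - p)^-1 ^+ n.+2).
Proof.
move=> up; have z0 : cof u - p != 0 by rewrite subr_eq0.
have h1 : hol (fun v => (cof v - p)^-1) u (- (cof u - p)^-1 ^+ 2).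
  apply: hol_ext (holV z0 (holB (hol_id u) (hol_cst p u))) _.
  by rewrite subr0 exprVn mulN1r.
elim: n => [|n IH]; first by apply: hol_ext h1 _; rewrite mulN1r.
apply: hol_fun (hol_ext (holM h1 IH) _) => [v|]; first by rewrite -exprS.
rewrite -[n.+2%:R]natr1; move: (cof u - p)^-1 => q; rewrite !exprS; ring.
Qed.

Lemma hol_tower_inv p n u : cof u != p ->
  hol (fun v => tower_inv p n (cof v)) u (tower_inv p n.+1 (cof u)).
Proof.
move=> up; apply: hol_ext (holZ _ (hol_inv_pow n up)) _.
by rewrite /tower_inv factS natrM (exprS (-1)); ring.
Qed.

Lemma tower_lin3 D (F G H : nat -> 'rV[R]_2 -> R[i]) (p q r : R[i]) :
  tower D F -> tower D G -> tower D H ->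
  tower D (fun n u => p * F n u + q * G n u + r * H n u).
Proof.
move=> tF tG tH n u Du; exact: holD (holD (holZ p (tF n u Du)) (holZ q (tG n u Du))) (holZ r (tH n u Du)).
Qed.

Lemma hol_nullv u k : exists n', hol (fun v => nullv (cof v) k) u n'.
Proof.
have hz := hol_id u; have hsq := holM hz hz.
have h1 c1 c2 c3 : hol (fun v => c1 * (c3 + cof v * cof v) + c2 * cof v) u _ :=
  holD (holZ c1 (holD (hol_cst c3 u) hsq)) (holZ c2 hz).
have nE (v : R[i]) : nullv v k = if k == 0 then - (sin th)%:C * (- 1 + v * v) + (2 * cos th)%:C * v
  else if k == 1 then (cos th)%:C * (- 1 + v * v) + (2 * sin th)%:C * v
  else 'i%C * (1 + v * v) + 0 * v.
  by rewrite !nullvE; case: eqP => _; [|case: eqP => _]; rewrite ?expr2; ring.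
by case: (ord3P k) => kE; subst k; eexists; apply: hol_fun (h1 _ _ _) => v; rewrite nE /=; reflexivity.
Qed.

Variables (D : set 'rV[R]_2) (r : 'rV[R]_2 -> 'rV[R]_3) (f : 'rV[R]_2 -> R[i]).
Hypothesis oD : open D.
Hypothesis dr : forall u, D u -> differentiable r u.
Hypothesis pr : forall u k, D u -> pd k r u = rev (f u * dir k) u.
Hypothesis f0 : forall u, D u -> f u != 0.
Hypothesis df : forall u, D u -> exists f', hol f u f'.

Lemma conformal_first_form u : D u ->
  first_form r u = (rad u ^+ 2 * normc2 (f u))%:M.
Proof.
move=> Du; apply/matrixP => i j; rewrite !mxE !pr// dot_rev /normc2.
by case: (ord2P i) => ->; case: (ord2P j) => ->; rewrite /= !(cReM, cImM)/= /dir/= ?mulr1n ?mulr0n; ring.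
Qed.

Lemma conformal_coef_neq0 u : D u -> rad u ^+ 2 * normc2 (f u) != 0.
Proof.
move=> Du; rewrite mulf_neq0 ?sqrf_eq0 ?rad_neq0//.
by have := f0 Du; rewrite complex_neq0 => /lt0r_neq0.
Qed.

Lemma conformal_regular u : D u -> row_free (\matrix_(k < 2) pd k r u).
Proof.
move=> Du; apply/row_freeP; set M := (\matrix_(k < 2) _).
exists ((rad u ^+ 2 * normc2 (f u))^-1 *: M^T).
rewrite -scalemxAr (_ : M *m M^T = first_form r u); last first.
  by apply/matrixP => i j; rewrite !mxE /dot; apply: eq_bigr => k _; rewrite !mxE.
by rewrite conformal_first_form// scale_scalar_mx mulVf// conformal_coef_neq0.
Qed.

Lemma conformal_normal u : D u -> patch_normal r u = nu u.
Proof.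
move=> Du; have n0 : 0 < normc2 (f u) by rewrite -complex_neq0 f0.
have [k kE k0] : exists2 k, cross (pd 0 r u) (pd 1 r u) = k *: nun th u & 0 < k.
  exists (rad u * normc2 (f u)); last by rewrite mulr_gt0// rad_gt0.
  rewrite !pr// cross_rev; congr (_ *: _).
  by rewrite /normc2 !(cReM, cImM) /dir /=; ring.
rewrite /patch_normal kE; cbv zeta.
have -> : enorm (k *: nun th u) = k * rad u.
  apply/eqP; rewrite -(@eqrXn2 _ 2)// ?sqrtr_ge0// ?mulr_ge0// ?ltW// ?rad_gt0//.
  by rewrite enorm_sq dotZl dotC dotZl dot_nun; apply/eqP; ring.
by rewrite scalerA; congr (_ *: _); field; rewrite rad_neq0 gt_eqF.
Qed.

(** The second partials are real parts of a complex number times [dir i * dir j], and 1 + i^2 = 0,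
    so the coordinates are harmonic. For a conformal metric the trace of the shape operator is a
    multiple of the normal component of the Laplacian. *)
Lemma conformal_minimal u : D u -> patch_mean_curvature r u = 0.
Proof.
move=> Du; rewrite /patch_mean_curvature /shape_operator conformal_first_form//.
have c0 := conformal_coef_neq0 Du; set lam := rad u ^+ 2 * _ in c0 *.
have -> : invmx (lam%:M : 'M[R]_2) = (lam^-1)%:M by rewrite invmx_scalar.
rewrite mul_mx_scalar mxtraceZ; suff -> : \tr (second_form r u) = 0 by rewrite mulr0 mul0r.
have [f' hf] := df Du.
have nD : \forall v \near u, D v by apply: open_nbhs_nbhs.
have hn := hol_nullv u.
have H k : exists n', forall i j, pd i (pd j r) u 0 k = Re (n' * dir i * dir j).
  have [n' hk] := hn k; exists (f' * nullv (cof u) k + f u * n') => i j.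
  have hh l n'' : hol (fun v => nullv (cof v) l) u n'' ->
      dd (fun v => pd j r v 0 l) u
        (fun i => Re (dir j * (f' * nullv (cof u) l + f u * n'') * dir i)).
    move=> hl; have [h _] := holZ (dir j) (holM hf hl); apply: dd_near h.
    by move: nD; apply: (@filterS _ (nbhs u)) => v Dv; rewrite pr// mxE; congr Re; ring.
  rewrite pd_row; last first.
    by apply/differentiable_row => l; have [n'' hl] := hn l; have [] := hh _ _ hl.
  by have [_ ->] := hh _ _ hk; congr Re; ring.
have E i j : second_form r u i j = dot (pd i (pd j r) u) (patch_normal r u) by rewrite mxE.
have -> : \tr (second_form r u) = second_form r u 0 0 + second_form r u 1 1 by rewrite /mxtrace sum2.
have [q Hq] : exists q : 'I_2 -> 'I_2 -> 'rV[R]_3, forall i j, pd i (pd j r) u = q i j.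
  by exists (fun i j => pd i (pd j r) u).
have {}H k : exists n', forall i j, q i j 0 k = Re (n' * dir i * dir j).
  by have [n' Hn] := H k; exists n' => i j; rewrite -Hq.
have [n0 H0] := H 0; have [n1 H1] := H 1; have [n2 H2] := H 2.
rewrite !E (Hq 0 0) (Hq 1 1) !dot3 !H0 !H1 !H2; move: (patch_normal r u) => n.
by rewrite /dir /= !(cReM, cImM) /=; ring.
Qed.

End ConformalPatch.

(** * The Scherk surfaces *)

Section Scherk.
Context {R : realType}.
Variables th rho Th : R.
Hypotheses (th_bounds : 0 < th < pi / 2) (rho0 : 0 < rho).
Local Notation Re := complex.Re.
Local Notation Im := complex.Im.
Local Notation co := (cos th).
Local Notation si := (sin th).
Local Notation nu := (nu th).
Local Notation nullv := (nullv th).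
Local Notation rev := (rev th).
Local Notation mob := (mob th).

Lemma co_gt0 : 0 < co.
Proof. by have /andP[h1 h2] := th_bounds; apply: cos_gt0_pihalf; rewrite h2; lra. Qed.

Lemma si_gt0 : 0 < si.
Proof. exact: sin_gt0_pihalf. Qed.

(* In the coordinate of [nu] the ends are [pa], [0], [pc] and infinity. *)
Definition pa : R := - (si / co).
Definition pc : R := co / si.

Lemma paE : pa = - (si / co). Proof. by []. Qed.
Lemma pcE : pc = co / si. Proof. by []. Qed.

Lemma pa_lt0 : pa < 0.
Proof. by rewrite /pa oppr_lt0 divr_gt0 ?si_gt0 ?co_gt0. Qed.

Lemma pc_gt0 : 0 < pc.
Proof. by rewrite /pc divr_gt0 ?si_gt0 ?co_gt0. Qed.

Local Notation tree := (tree pa 0 pc).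
Local Notation psi := (@psi R pa 0 pc).
Local Notation proj := (@proj R pa 0 pc).
Local Notation slit := (slit pa 0 pc).
Local Notation off_punctures := (off_punctures pa 0 pc).

Definition den (z : R[i]) : R[i] := z * ((z - pa%:C) * (z - pc%:C)).

Lemma denE z : den z = z * ((z - pa%:C) * (z - pc%:C)). Proof. by []. Qed.

(** With G = mob z one has dG = 2 i e^(i th) / (1 - i z)^2 dz, the third component of [nullv]
    divided by G is i e^(- i th) (1 - i z)^2, and the denominator of the Scherk equation is 16 e^(2
    i th) sin th cos th den / (1 - i z)^4. What remains is the factor 1 / (8 sin th cos th). *)
Definition kappa : R[i] := (rho / (8 * si * co))%:C * expi Th.

Definition coef_f (u : 'rV[R]_2) : R[i] := kappa / den (cof u).

Lemma off_den u : off_punctures u -> den (cof u) != 0.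
Proof.
move=> ou; rewrite /den !mulf_neq0 ?subr_eq0//.
- rewrite eq_complex /= negb_and orbC.
  by case/orP: ou => [->//|]; rewrite !inE !negb_or => /and3P[_ -> _]; rewrite orbT.
- rewrite eq_complex /= negb_and orbC.
  by case/orP: ou => [->//|]; rewrite !inE !negb_or => /and3P[-> _ _]; rewrite orbT.
- rewrite eq_complex /= negb_and orbC.
  by case/orP: ou => [->//|]; rewrite !inE !negb_or => /and3P[_ _ ->]; rewrite orbT.
Qed.

Lemma den_off u : den (cof u) != 0 -> off_punctures u.
Proof.
rewrite /den !mulf_eq0 !negb_or !subr_eq0 !eq_complex /= !negb_and off_puncturesE.
case: (u 0 1 == 0) => //=; rewrite !orbF !inE !negb_or => /andP[-> /andP[-> ->]] //.
Qed.

Lemma kappa_neq0 : kappa != 0.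
Proof.
rewrite mulf_neq0//.
  rewrite eq_complex /= eqxx andbT gt_eqF// divr_gt0// !mulr_gt0 ?co_gt0 ?si_gt0//.
by rewrite complex_neq0 -/(normc2 _) normc2_expi.
Qed.

(** The residue of [nullv / den] at the puncture [m], the indices being taken modulo 3. *)
Definition residue (m k : 'I_3) : R[i] :=
  let p l := (puncture pa 0 pc l)%:C in
  nullv (p m) k / ((p m - p (m + 1)) * (p m - p (m + 2))).

(** The numerator is quadratic and [den] is a cubic with simple roots, so there is no polynomial
    part. *)
Lemma partial_fractions z k : z != 0 -> z != pa%:C -> z != pc%:C ->
  residue 0 k / (z - pa%:C) + residue 1 k / (z - 0) + residue 2 k / (z - pc%:C) = nullv z k / den z.
Proof.
move=> z0 za zc.
have pa0 : pa%:C != 0 :> R[i] by rewrite eq_complex /= eqxx andbT lt_eqF// pa_lt0.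
have pc0 : pc%:C != 0 :> R[i] by rewrite eq_complex /= eqxx andbT gt_eqF// pc_gt0.
have pac : pa%:C != pc%:C :> R[i].
  by rewrite eq_complex /= eqxx andbT lt_eqF// (lt_trans pa_lt0) ?pc_gt0.
have [c0 [c1 [c2 nE]]] : exists c0 c1 c2, forall z, nullv z k = c0 + c1 * z + c2 * z ^+ 2.
  move: (fun z => nullvE th z k); case: (k == 0); [|case: (k == 1)] => nE.
  + by exists si%:C, (2 * co)%:C, (- si%:C) => x; rewrite nE; ring.
  + by exists (- co%:C), (2 * si)%:C, co%:C => x; rewrite nE; ring.
  + by exists 'i%C, 0, 'i%C => x; rewrite nE; ring.
have r0 : residue 0 k = nullv pa%:C k / ((pa%:C - 0) * (pa%:C - pc%:C)).
  by rewrite /residue; congr (_ / (_ * _)).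
have r1 : residue 1 k = nullv 0 k / ((0 - pc%:C) * (0 - pa%:C)).
  by rewrite /residue; congr (_ / (_ * _)).
have r2 : residue 2 k = nullv pc%:C k / ((pc%:C - pa%:C) * (pc%:C - 0)).
  by rewrite /residue; congr (_ / (_ * _)).
rewrite r0 r1 r2 /den !nE; move: pa0 pc0 pac za zc; move: (pa%:C) (pc%:C) => p q p0 q0 pq zp zq.
by field; rewrite !subr_eq0 z0 zp zq p0 q0 pq eq_sym pq.
Qed.

(* The real part of the integral of [kappa * nullv / den]. *)
Definition scherk_immersion (t : tree) : 'rV[R]_3 :=
  \row_k Re (kappa * residue 0 k * lift_log 0 t + kappa * residue 1 k * lift_log 1 t
    + kappa * residue 2 k * lift_log 2 t).

(** Order 0 is the lifted logarithm read in a chart; from order 1 on the derivatives are the same on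
    all sheets. *)
Definition log_tower w j (m : 'I_3) (n : nat) (u : 'rV[R]_2) : R[i] :=
  if n is n'.+1 then tower_inv (puncture pa 0 pc m)%:C n' (cof u)
  else branch j m (cof u - (puncture pa 0 pc m)%:C) + 0 +i* (2 * pi * winding m w).

Definition scherk_tower w j k n u : R[i] :=
  kappa * residue 0 k * log_tower w j 0 n u + kappa * residue 1 k * log_tower w j 1 n u
  + kappa * residue 2 k * log_tower w j 2 n u.

Lemma slit_neq_puncture j u m : slit j u -> cof u != (puncture pa 0 pc m)%:C.
Proof.
move=> /(slit_off pa_lt0 pc_gt0); rewrite eq_complex /= negb_and orbC.
case/orP => [->//|]; rewrite !inE !negb_or => /and3P[xa xb xc].
by rewrite /puncture; case: m => -[|[|[|//]]] mp /=; rewrite ?xa ?xb ?xc orbT.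
Qed.

Lemma scherk_tower_hol w j k : tower (slit j) (scherk_tower w j k).
Proof.
have H m : tower (slit j) (log_tower w j m).
  move=> [|n] u su; have up := slit_neq_puncture m su.
    apply: hol_ext (holD (hol_branch pa_lt0 pc_gt0 m su) (hol_cst _ u)) _.
    by rewrite addr0 /log_tower /tower_inv expr0 mul1r mul1r expr1.
  exact: hol_tower_inv.
exact: tower_lin3.
Qed.

Lemma scherk_immersion_psi w j u k : reduced w -> ~~ odd (size w) -> slit j u ->
  scherk_immersion (psi w j u) 0 k = Re (scherk_tower w j k 0 u).
Proof.
by move=> rw ow su; rewrite mxE /scherk_tower /log_tower !(lift_log_psi pa_lt0 pc_gt0).
Qed.

Lemma scherk_tower1 w j k u : slit j u ->
  scherk_tower w j k 1 u = coef_f u * nullv (cof u) k.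
Proof.
move=> su; have h m := slit_neq_puncture m su.
rewrite /coef_f mulrAC -mulrA -partial_fractions; [|exact: (h 1)|exact: (h 0)|exact: (h 2)].
by rewrite /scherk_tower /log_tower /tower_inv !expr0 !mul1r !expr1; ring.
Qed.

Definition scherk_chart := (even_word * 'I_4)%type.
Definition scherk_dom (i : scherk_chart) := slit i.2.
Definition scherk_par (i : scherk_chart) := psi (val i.1) i.2.

Lemma chart_word (i : scherk_chart) : reduced (val i.1) /\ ~~ odd (size (val i.1)).
Proof. by case: i => -[w /= /andP[]]. Qed.

Lemma scherk_smooth i : smooth_on (scherk_dom i) (scherk_immersion \o scherk_par i).
Proof.
have [rw ow] := chart_word i.
apply: (@smooth_tower _ _ (fun k => scherk_tower (val i.1) i.2 k)).
- exact: open_slit.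
- by move=> k; exact: scherk_tower_hol.
- by move=> u su k; rewrite /= scherk_immersion_psi.
Qed.

Lemma scherk_diff i u : scherk_dom i u -> differentiable (scherk_immersion \o scherk_par i) u.
Proof. exact: (scherk_smooth (i := i) [::]). Qed.

Lemma scherk_pd i u k : scherk_dom i u ->
  pd k (scherk_immersion \o scherk_par i) u = rev (coef_f u * dir k) u.
Proof.
move=> su; have [rw ow] := chart_word i.
apply/rowP => l; rewrite pd_row; last exact: scherk_diff.
have [h _] := @scherk_tower_hol (val i.1) i.2 l 0 u su.
have [_ ->] : dd (fun v => (scherk_immersion \o scherk_par i) v 0 l) u
    (fun k => Re (scherk_tower (val i.1) i.2 l 1 u * dir k)).
  apply: dd_near h; have : \forall v \near u, slit i.2 v.
    by apply: open_nbhs_nbhs; split=> //; exact: open_slit.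
  by apply: (@filterS _ (nbhs u)) => v sv; rewrite /= scherk_immersion_psi.
by rewrite scherk_tower1// mxE; congr Re; ring.
Qed.

Lemma coef_neq0 i u : scherk_dom i u -> coef_f u != 0.
Proof.
by move=> /(slit_off pa_lt0 pc_gt0)/off_den d0; rewrite mulf_neq0 ?invr_eq0// kappa_neq0.
Qed.

Lemma hol_coef i u : scherk_dom i u -> exists f', hol coef_f u f'.
Proof.
move=> /(slit_off pa_lt0 pc_gt0)/off_den d0; have hz := hol_id u.
have hd := holM hz (holM (holB hz (hol_cst pa%:C u)) (holB hz (hol_cst pc%:C u))).
eexists; exact: (holZ kappa (holV d0 hd)).
Qed.

Lemma scherk_embedding i : open_embedding (scherk_dom i) (scherk_par i).
Proof. by have [rw ow] := chart_word i; exact: (psi_embedding pa_lt0 pc_gt0). Qed.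

Lemma scherk_cover (t : tree) : exists i, (scherk_par i @` scherk_dom i) t.
Proof.
have [j sj] := off_slit (off_proj t); have [w [rw ow] tE] := psi_surj pa_lt0 pc_gt0 sj.
have rwo : reduced w && ~~ odd (size w) by rewrite rw.
exists (exist (fun w => reduced w && ~~ odd (size w)) w rwo, j).
by exists (proj t).
Qed.

Lemma proj_par i u : scherk_dom i u -> proj (scherk_par i u) = u.
Proof. by have [rw ow] := chart_word i; exact: (proj_psi pa_lt0 pc_gt0). Qed.

Lemma path_connected_connected (T : topologicalType) :
  path_connected R T -> connected [set: T].
Proof.
move=> pT; have [[x _]|/set0P/negP/negPn/eqP->] := pselect ([set: T] !=set0); last exact: connected0.
rewrite (_ : [set: T] = \bigcup_(f in [set f : R -> T | {within `[0, 1], continuous f} /\ f 0 = x])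
  (f @` `[0, 1]%classic)).
  apply: bigcup_connected.
    by exists x => f [_ f0]; exists 0 => //=; rewrite in_itv /= lexx ler01.
  move=> f [cf _]; apply: connected_continuous_connected => //.
  exact: segment_connected.
apply/seteqP; split=> // y _; have [f [cf f0 f1]] := pT x y; exists f => //.
by exists 1 => //=; rewrite in_itv /= lexx ler01.
Qed.

Definition scherk : surface R := @Surface R tree scherk_immersion (fun t => nu (proj t))
  scherk_chart scherk_dom scherk_par
  (tree_hausdorff pa_lt0 pc_gt0)
  (path_connected_connected (tree_simply_connected pa_lt0 pc_gt0).1)
  scherk_embedding scherk_cover scherk_smooth
  (fun i u su => conformal_regular (@scherk_pd i) (@coef_neq0 i) su)
  (fun i u su => etrans (congr1 nu (proj_par su)) (esym (conformal_normal (@scherk_pd i) (@coef_neq0 i) su))).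

End Scherk.

(** * Topology of the complex plane *)

Section ComplexTopology.
Context {R : realType}.
Local Notation Re := complex.Re.
Local Notation Im := complex.Im.

Lemma normcE (z : R[i]) : `|z| = (modc z)%:C.
Proof. by case: z => x y; rewrite normc_def. Qed.

Lemma modc_ge_Re (z : R[i]) : `|Re z| <= modc z.
Proof.
rewrite -(@ler_pXn2r _ 2)// ?nnegrE ?normr_ge0 ?sqrtr_ge0// modc_sq real_normK ?num_real//.
by rewrite lerDl sqr_ge0.
Qed.

Lemma modc_ge_Im (z : R[i]) : `|Im z| <= modc z.
Proof.
rewrite -(@ler_pXn2r _ 2)// ?nnegrE ?normr_ge0 ?sqrtr_ge0// modc_sq real_normK ?num_real//.
by rewrite lerDr sqr_ge0.
Qed.

Lemma modc_le (z : R[i]) : modc z <= `|Re z| + `|Im z|.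
Proof.
rewrite -(@ler_pXn2r _ 2)// ?nnegrE ?addr_ge0 ?sqrtr_ge0// modc_sq sqrrD !real_normK ?num_real//.
by rewrite lerD// lerDl mulrn_wge0// mulr_ge0.
Qed.

Lemma continuous_complex (X : topologicalType) (f : X -> R[i]) x :
  {for x, continuous (fun y => Re (f y))} -> {for x, continuous (fun y => Im (f y))} ->
  {for x, continuous (f : X -> (R[i] : numFieldType))}.
Proof.
move=> cr ci; apply/cvgrPdist_lt => e e0.
have e0' := e0; rewrite ltcE /= in e0'; case/andP: e0' => /eqP eI eR.
have eE : e = (Re e)%:C by apply: eq_complexP.
have h0 : 0 < Re e / 2 by rewrite divr_gt0.
have Hr := ((cvgrPdist_lt _ _).1 cr) _ h0.
have Hi := ((cvgrPdist_lt _ _).1 ci) _ h0.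
near=> y; rewrite normcE eE ltcR.
apply: le_lt_trans (modc_le _) _; rewrite [ltRHS](_ : _ = Re e / 2 + Re e / 2); last by field.
rewrite cReD cReN cImD cImN; apply: ltrD.
  by near: y; exact: Hr.
by near: y; exact: Hi.
Unshelve. all: by end_near. Qed.

Lemma continuous_Re : continuous (fun z : (R[i] : numFieldType) => Re z : R).
Proof.
move=> z; apply: (cvgrPdist_lt (F := nbhs z) (FF := @nbhs_filter _ z) _ _).2 => e e0.
have e0' : 0 < e%:C :> R[i] by rewrite ltcE /= eqxx.
have : nbhs z (ball_ (fun x : R[i] => `|x|) z e%:C) by exists e%:C.
apply: (@filterS _ (nbhs z)) => w zw.
rewrite /= -cReN -cReD; apply: le_lt_trans (modc_ge_Re _) _.
by rewrite -ltcR -normcE.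
Qed.

Lemma continuous_Im : continuous (fun z : (R[i] : numFieldType) => Im z : R).
Proof.
move=> z; apply: (cvgrPdist_lt (F := nbhs z) (FF := @nbhs_filter _ z) _ _).2 => e e0.
have e0' : 0 < e%:C :> R[i] by rewrite ltcE /= eqxx.
have : nbhs z (ball_ (fun x : R[i] => `|x|) z e%:C) by exists e%:C.
apply: (@filterS _ (nbhs z)) => w zw.
rewrite /= -cImN -cImD; apply: le_lt_trans (modc_ge_Im _) _.
by rewrite -ltcR -normcE.
Qed.

Lemma cof_continuous : continuous (cof : 'rV[R]_2 -> (R[i] : numFieldType)).
Proof. by move=> u; apply: continuous_complex; exact: coord_continuous. Qed.

Lemma rof_continuous : continuous (rof : (R[i] : numFieldType) -> 'rV[R]_2).
Proof.
move=> z; apply: continuous_rV2 => k; case: (ord2P k) => ->.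
  by apply: continuous_near (@continuous_Re z); apply: filterE => y; rewrite mxE.
by apply: continuous_near (@continuous_Im z); apply: filterE => y; rewrite mxE.
Qed.

Lemma normc2_continuous : continuous (fun z : (R[i] : numFieldType) => normc2 z : R).
Proof.
move=> z; have cR := continuous_Re; have cI := continuous_Im.
by rewrite /normc2; apply: (@continuous_near _ _ (fun z : (R[i] : numFieldType) => Re z * Re z + Im z * Im z));
  [apply: filterE => y; rewrite !expr2|cont].
Qed.

Lemma compact_normc2_bounded (K : set (R[i] : numFieldType)) : compact K ->
  exists m : R, 0 < m /\ forall z, K z -> normc2 z <= m.
Proof.
move=> cK; have [K0|/set0P/negP/negPn/eqP->] := pselect (K !=set0); last by exists 1.
have [|z Kz Hz] := compact_EVT_max K0 cK (f := fun z : (R[i] : numFieldType) => normc2 z).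
  by apply: continuous_subspaceT; exact: normc2_continuous.
exists (normc2 z + 1); split; first by rewrite ltr_wpDl// addr_ge0 ?sqr_ge0.
by move=> w Kw; rewrite (le_trans (Hz w _)) ?lerDl ?inE.
Qed.

Lemma closed_normc2_disc (m : R) : closed [set z : (R[i] : numFieldType) | normc2 z <= m].
Proof.
apply: (closed_comp (f := fun z : (R[i] : numFieldType) => normc2 z) (D := [set x | x <= m])).
  by move=> z _; exact: normc2_continuous.
exact: closed_le.
Qed.

(** The complements of these discs serve as neighbourhoods of infinity on the sphere; compactness is
    transported from the real plane by [cof]. *)
Lemma compact_normc2_disc (m : R) : compact [set z : (R[i] : numFieldType) | normc2 z <= m].
Proof.
have cD : compact [set u : 'rV[R]_2 | normc2 (cof u) <= m].
  apply: bounded_closed_compact; last first.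
    apply: (closed_comp (f := cof : 'rV[R]_2 -> (R[i] : numFieldType)) (D := [set z | normc2 z <= m])).
      by move=> z _; exact: cof_continuous.
    exact: closed_normc2_disc.
  exists (m + 1); split=> [|M mM u /= um]; first exact: num_real.
  have H (x : R) : x ^+ 2 <= m -> `|x| <= M.
    move=> xm; apply: (@le_trans _ _ (m + 1)); last exact: ltW.
    have m0 : 0 <= m by rewrite (le_trans _ xm)// sqr_ge0.
    rewrite -(@ler_pXn2r _ 2)// ?nnegrE ?addr_ge0// real_normK ?num_real//.
    by rewrite (le_trans xm)// -subr_ge0 (_ : _ - _ = m ^+ 2 + m + 1) ?addr_ge0 ?sqr_ge0//; ring.
  apply: norm_le_coord; apply: H; apply: le_trans um; rewrite /normc2 /=.
    by rewrite lerDl sqr_ge0.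
  by rewrite lerDr sqr_ge0.
have := continuous_compact (f := cof : 'rV[R]_2 -> (R[i] : numFieldType)) _ cD.
have -> : cof @` [set u : 'rV[R]_2 | normc2 (cof u) <= m] = [set z : (R[i] : numFieldType) | normc2 z <= m].
  apply/seteqP; split=> [_ [u um <-]//|z zm]; exists (rof z); last exact: rofK.
  by rewrite /= rofK.
by apply; apply: continuous_subspaceT; exact: cof_continuous.
Qed.

Lemma covering_comp_embedding (T U W : topologicalType) (f : T -> U) (B : set U) (g : U -> W) :
  covering_map f B -> open_embedding B g -> covering_map (g \o f) (g @` B).
Proof.
move=> [cf rf ev] og; have [oB ig cg opg] := og.
have fB t : B (f t) by rewrite -rf; exists t.
split.
- by move=> t; apply: continuous_comp; [exact: cf|exact: cg].
- by rewrite -rf image_comp; apply/seteqP; split=> [_ [t _ <-]|_ [t _ <-]]; exists t.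
- move=> _ [y By <-]; have [N [oN Ny] [I [V [HV tV EV]]]] := ev y By.
  have NB i : f @` V i `<=` B by move=> _ [t _ <-].
  exists (g @` (N `&` B)).
    split; last by exists y.
    by apply: opg; [move=> ? []|exact: openI].
  exists I, V; split => //.
    move=> i; have [oe imV] := HV i; split.
      by apply: open_embedding_comp oe og _; exact: NB.
    rewrite -image_comp imV; apply/seteqP; split=> [_ [u Nu <-]|_ [u [Nu _] <-]]; exists u => //.
    by split=> //; move: (NB i); rewrite imV; apply.
  rewrite -EV; apply/seteqP; split=> [t [u [Nu Bu] gu]|t Nt] /=.
    by rewrite (_ : f t = u)//; apply: ig => //; rewrite inE.
  by exists (f t).
Qed.

End ComplexTopology.

(** * The Gauss map as a covering of the punctured sphere *)

Section GaussSphere.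
Context {R : realType}.
Variable th : R.
Hypothesis th_bounds : 0 < th < pi / 2.
Local Notation Re := complex.Re.
Local Notation Im := complex.Im.
Local Notation co := (cos th).
Local Notation si := (sin th).
Local Notation e := (expi th).
Local Notation mob := (mob th).
Local Notation C := (R[i] : numFieldType).
Local Notation off_punctures := (off_punctures (pa th) 0 (pc th)).
Local Notation sphere := (@riemann_sphere R).

(** [mob] with values in the sphere: z = - i is its pole, and the value - e^(i th) that it omits is
    the image of infinity, the fourth end. *)
Definition mobs (u : 'rV[R]_2) : sphere :=
  if 1 - 'i%C * cof u == 0 then None else Some (mob (cof u)).

Lemma mobsE u : mobs u = if 1 - 'i%C * cof u == 0 then None else Some (mob (cof u)).
Proof. by []. Qed.

Definition mobi (g : R[i]) : R[i] := - 'i%C * (g - e) / (g + e).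

Lemma expi_neq0 (t : R) : expi t != 0.
Proof. by rewrite complex_neq0 -/(normc2 _) normc2_expi. Qed.

Lemma ii : 'i%C * 'i%C = -1 :> R[i].
Proof. by apply: eq_complexP; rewrite ?(cReM, cImM)/=; ring. Qed.

Lemma mobDe z : 1 - 'i%C * z != 0 -> mob z + e = 2 * e / (1 - 'i%C * z).
Proof. by move=> z0; rewrite !mobE; field. Qed.

Lemma two_neq0 : 2 != 0 :> R[i].
Proof. by rewrite pnatr_eq0. Qed.

Lemma mobDe_neq0 z : 1 - 'i%C * z != 0 -> mob z + e != 0.
Proof. by move=> z0; rewrite mobDe// !mulf_neq0 ?invr_eq0 ?two_neq0 ?expi_neq0. Qed.

Lemma mobK z : 1 - 'i%C * z != 0 -> mobi (mob z) = z.
Proof.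
move=> z0; rewrite /mobi mobDe//.
have -> : mob z - e = 2 * e * 'i%C * z / (1 - 'i%C * z) by rewrite !mobE; field.
have e0 := expi_neq0 th; move: e0 (ii) z0; move: e 'i%C => e i e0 ii z0.
transitivity (- (i * i) * z); last by rewrite ii; ring.
by field; rewrite ?e0 ?z0 ?two_neq0.
Qed.

Lemma mobi_den g : g + e != 0 -> 1 - 'i%C * mobi g = 2 * e / (g + e).
Proof.
rewrite /mobi; move: (ii); move: e 'i%C => e i ii g0.
transitivity (1 + (i * i) * (g - e) / (g + e)); first by field.
by rewrite ii; field.
Qed.

Lemma mobiK g : g + e != 0 -> 1 - 'i%C * mobi g != 0 /\ mob (mobi g) = g.
Proof.
move=> g0; have H := mobi_den g0; split.
  by rewrite H !mulf_neq0 ?invr_eq0 ?two_neq0 ?expi_neq0.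
rewrite !mobE H (_ : 1 + 'i%C * mobi g = 2 - (1 - 'i%C * mobi g)); last by ring.
by rewrite H; field; rewrite ?g0 ?expi_neq0 ?two_neq0.
Qed.

Lemma pole_den : 1 - 'i%C * (- 'i%C) = 0 :> R[i].
Proof. by rewrite mulrN ii opprK subrr. Qed.

Lemma den_pole (z : R[i]) : 1 - 'i%C * z = 0 -> z = - 'i%C.
Proof.
move=> /eqP; rewrite subr_eq0 => /eqP E; rewrite -[z]mul1r.
by rewrite -[1]opprK -ii mulNr -mulrA -E mulr1.
Qed.

Lemma mobs_pole : mobs (rof (- 'i%C)) = None.
Proof. by rewrite /mobs rofK pole_den eqxx. Qed.

Lemma mobs_inj : injective mobs.
Proof.
move=> u v; rewrite /mobs; case: eqP => [/den_pole hu|/eqP hu]; case: eqP => [/den_pole hv|/eqP hv] //.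
  by move=> _; rewrite -[u]cofK hu -hv cofK.
by move=> E; have /(congr1 (fun g => mobi g)) : mob (cof u) = mob (cof v) := (f_equal (odflt 0) E);
  rewrite !mobK// => /(can_inj cofK).
Qed.

Lemma mobs_some g : g + e != 0 -> mobs (rof (mobi g)) = Some g.
Proof. by move=> /mobiK[h1 h2]; rewrite /mobs rofK (negbTE h1) h2. Qed.

Lemma mobs_neq u : mobs u != Some (- e) :> option R[i].
Proof.
rewrite /mobs; case: ifPn => // u0; apply/eqP => /(f_equal (odflt 0)) E.
by have := mobDe_neq0 u0; rewrite [mob _]E addNr eqxx.
Qed.

Lemma mobs_punctures :
  [/\ mobs (pnt 0 0) = Some e, mobs (pnt (pa th) 0) = Some (expi (- th))
    & mobs (pnt (pc th) 0) = Some (- expi (- th))].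
Proof.
have c0 := lt0r_neq0 (co_gt0 th_bounds); have s0 := lt0r_neq0 (si_gt0 th_bounds).
have n0 (x : R) : 1 - 'i%C * cof (pnt x 0) != 0.
  by rewrite /cof !pntE complex_neq0 ?(cReM, cImM, cReD, cImD, cReN, cImN)/= ltr_pwDl ?sqr_ge0// mulr0 mul0r !subr0 expr1n.
split; rewrite /mobs (negbTE (n0 _)) !mobE; congr Some.
- by rewrite /cof !pntE (_ : 0 +i* 0 = 0)// mulr0 addr0 subr0 divr1 mulr1.
- apply: (canLR (mulfK (n0 _))); rewrite /cof !pntE /expi /pa sinN cosN.
  by apply: eq_complexP; rewrite ?(cReM, cImM, cReD, cImD, cReN, cImN)/=; field: (cs th).
- apply: (canLR (mulfK (n0 _))); rewrite /cof !pntE /expi /pc sinN cosN.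
  by apply: eq_complexP; rewrite ?(cReM, cImM, cReD, cImD, cReN, cImN)/=; field.
Qed.

Lemma cdd_continuous (F : 'rV[R]_2 -> R[i]) u a : cdd F u a -> {for u, continuous (F : 'rV[R]_2 -> C)}.
Proof. by move=> [h1 h2]; apply: continuous_complex; [exact: dd_cont h1|exact: dd_cont h2]. Qed.

Lemma hol_mob_den (u : 'rV[R]_2) : hol (fun v => 1 - 'i%C * cof v) u (- 'i%C).
Proof. by apply: hol_ext (holB (hol_cst 1 u) (holZ 'i%C (hol_id u))) _; rewrite mulr1 sub0r. Qed.

Lemma hol_mob u : 1 - 'i%C * cof u != 0 ->
  hol (fun v => mob (cof v)) u (2 * 'i%C * e / (1 - 'i%C * cof u) ^+ 2).
Proof.
move=> z0; have hn := holZ e (holD (hol_cst 1 u) (holZ 'i%C (hol_id u))).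
apply: hol_ext (holM hn (holV z0 (hol_mob_den u))) _; rewrite mulr1 add0r.
by field.
Qed.

Lemma mobi_continuous g : g + e != 0 -> {for g, continuous (mobi : C -> C)}.
Proof.
move=> g0; have H : {for rof g, continuous (fun v => mobi (cof v) : C)}.
  have h0 : cof (rof g) + e != 0 by rewrite rofK.
  have hd := holD (hol_id (rof g)) (hol_cst e _).
  have hn := holB (hol_id (rof g)) (hol_cst e _).
  exact: cdd_continuous (holM (holZ (- 'i%C) hn) (holV h0 hd)).
have := continuous_comp (@rof_continuous R g) H.
by apply: continuous_near; apply: filterE => z; rewrite /= rofK.
Qed.

Lemma open_off : open [set u | off_punctures u].
Proof.
have h1 := pa_lt0 th_bounds; have h2 := pc_gt0 th_bounds.
rewrite (_ : mkset _ = \bigcup_j slit (pa th) 0 (pc th) j).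
  by apply: bigcup_open => j _; exact: open_slit.
by apply/seteqP; split=> [u /off_slit[j sj]|u [j _ /(slit_off h1 h2)]//]; exists j.
Qed.

Lemma normc2_triangle (x y : R[i]) : normc2 (x + y) <= 2 * normc2 x + 2 * normc2 y.
Proof.
rewrite -subr_ge0 (_ : _ - _ = normc2 (x - y)) ?addr_ge0 ?sqr_ge0//.
by rewrite /normc2 !cReD !cImD cReN cImN; ring.
Qed.

Lemma normc2V (x : R[i]) : normc2 x^-1 = (normc2 x)^-1.
Proof.
have [->|x0] := eqVneq x 0; first by rewrite invr0 /normc2 /= expr0n addr0 invr0.
have n0 : normc2 x != 0 by apply: lt0r_neq0; rewrite -complex_neq0.
by apply: (mulfI n0); rewrite -normc2M mulfV// divff// /normc2 /= expr1n expr0n addr0.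
Qed.

Lemma mobs_continuous u : {for u, continuous mobs}.
Proof.
have cden : {for u, continuous (fun v => normc2 (1 - 'i%C * cof v) : R)}.
  exact: continuous_comp (cdd_continuous (hol_mob_den u)) (@normc2_continuous R _).
have [u0|u0] := eqVneq (1 - 'i%C * cof u) 0; last first.
  have nE : \forall v \near u, 0 < normc2 (1 - 'i%C * cof v).
    by apply: (cvgr_gt _ cden); rewrite -complex_neq0.
  apply: (@continuous_near _ _ (fun v => Some (mob (cof v)) : sphere)).
    by move: nE; apply: (@filterS _ (nbhs u)) => v v0; rewrite /mobs ifN// complex_neq0.
  exact: (@continuous_comp _ _ _ _ (Some : C -> sphere) u (cdd_continuous (hol_mob u0))
    (@one_point_compactification_some_continuous C _)).
have cnum : {for u, continuous (fun v => normc2 (1 + 'i%C * cof v) : R)}.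
  have h := holD (hol_cst 1 u) (holZ 'i%C (hol_id u)).
  exact: continuous_comp (cdd_continuous h) (@normc2_continuous R _).
move=> A; rewrite {1}/mobs u0 eqxx => -[K [cK _] KA].
have [m [m0 Km]] := compact_normc2_bounded cK.
(* At the pole 1 + i z = 2, so the numerator keeps squared modulus above 1 while that of the
   denominator drops below 1 / m: the quotient leaves the disc that contains [K]. *)
have H1 : \forall v \near u, 1 < normc2 (1 + 'i%C * cof v).
  apply: (cvgr_gt _ cnum); rewrite (_ : 1 + _ = 2 - (1 - 'i%C * cof u)); last by ring.
  by rewrite u0 subr0 /normc2 /= addr0 expr0n addr0; lra.
have H2 : \forall v \near u, normc2 (1 - 'i%C * cof v) < m^-1.
  by apply: (cvgr_lt _ cden); rewrite u0 /normc2 /= expr0n addr0 invr_gt0.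
change (nbhs u (mobs @^-1` A)).
have := near_and H1 H2; apply: (@filterS _ (nbhs u)) => v [h1 h2]; apply: KA.
rewrite /mobs; case: ifPn => v0; [by right|left]; exists (mob (cof v)) => //.
move=> /Km; rewrite !mobE -mulrA normc2M normc2_expi mul1r normc2M normc2V.
have d0 : 0 < normc2 (1 - 'i%C * cof v) by rewrite -complex_neq0.
rewrite ler_pdivrMr// leNgt => /negP; apply; apply: le_lt_trans h1; apply: ltW.
by rewrite mulrC -ltr_pdivlMr// mul1r.
Qed.

Lemma mobs_open (W : set 'rV[R]_2) : open W -> open (mobs @` W).
Proof.
move=> oW; rewrite openE => _ [u Wu <-]; rewrite /interior.
have [u0|u0] := eqVneq (1 - 'i%C * cof u) 0; last first.
  have g0 := mobDe_neq0 u0; set g := mob (cof u) in g0 *.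
  have gu : mobs u = Some g by rewrite /mobs (negbTE u0).
  have cg := mobi_continuous g0.
  have WN : nbhs (rof (mobi g)) W by apply: open_nbhs_nbhs; rewrite mobK// cofK.
  have H1 : \forall h \near (g : C), W (rof (mobi h)).
    exact: (continuous_comp cg (@rof_continuous R _)).
  have H2 : \forall h \near (g : C), 0 < normc2 (h + e).
    have c2 : {for (g : C), continuous (fun h : C => normc2 (h + e) : R)}.
      apply: (@continuous_comp _ _ _ (fun h : C => h + e : C)); last exact: normc2_continuous.
      by apply: (@continuousD _ C); [exact: cvg_id|exact: cst_continuous].
    by apply: (cvgr_gt _ c2); rewrite -complex_neq0.
  rewrite gu; change (nbhs (g : C) ((Some : C -> sphere) @^-1` (mobs @` W))).
  move: (near_and H1 H2).
  apply: (@filterS C (nbhs (g : C)) (@nbhs_filter C g)) => h [Wh h0]; exists (rof (mobi h)) => //.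
  by rewrite mobs_some// complex_neq0.
have uE := den_pole u0; have uE' : u = rof (- 'i%C) by rewrite -uE cofK.
have [d d0 dW] := near_ball (open_nbhs_nbhs (conj oW Wu)).
rewrite uE' mobs_pole.
(* Outside this disc |g + e|^2 > 4 / d^2, and then mobi g + i = 2 i e / (g + e) has modulus less
   than [d]. *)
exists [set z : C | normc2 z <= 2 + 8 / d ^+ 2].
  by split; [exact: compact_normc2_disc|exact: closed_normc2_disc].
move=> _ [[g /negP gm <-]|->]; last by exists u; rewrite // uE' mobs_pole.
rewrite -ltNge in gm.
have d2 : 0 < d ^+ 2 by rewrite exprn_gt0.
have ge : 4 / d ^+ 2 < normc2 (g + e).
  have := normc2_triangle (g + e) (- e); rewrite addrK.
  have -> : normc2 (- e) = 1 by rewrite -mulN1r normc2M normc2_expi mulr1 /normc2 cReN cImN /= sqrrN expr1n oppr0 expr0n addr0.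
  move=> h; have E : 8 / d ^+ 2 = 2 * (4 / d ^+ 2) by ring.
  by move: h gm; rewrite E; move: (4 / d ^+ 2) => t *; lra.
have g0 : g + e != 0.
  by rewrite complex_neq0; apply: lt_trans ge; rewrite divr_gt0.
exists (rof (mobi g)); last exact: mobs_some.
apply: dW.
have nd : normc2 (mobi g + 'i%C) < d ^+ 2.
  rewrite (_ : mobi g + 'i%C = 2 * 'i%C * e / (g + e)); last by rewrite /mobi; field.
  rewrite !normc2M normc2_expi normc2V ltr_pdivrMr; last by rewrite -complex_neq0.
  rewrite -ltr_pdivrMl// mulrC; apply: le_lt_trans ge.
  by rewrite /normc2 /= addr0 expr0n addr0 add0r expr1n !mulr1 (_ : (1 + 1) ^+ 2 = 4) //; ring.
rewrite uE'; move: nd; move: (mobi g) => h nd.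
rewrite -ball_normE /ball_ /=; apply: (@le_lt_trans _ _ (modc (h + 'i%C))).
  apply: norm_le_coord; rewrite !mxE /= -normrN.
    by rewrite (_ : - (- 0 - Re h) = Re (h + 'i%C)) ?modc_ge_Re// cReD /=; ring.
  by rewrite (_ : - (- 1 - Im h) = Im (h + 'i%C)) ?modc_ge_Im// cImD /=; ring.
by rewrite -(@ltr_pXn2r _ 2)// ?nnegrE ?sqrtr_ge0 ?(ltW d0)// modc_sq.
Qed.

Lemma mobs_embedding : open_embedding [set u | off_punctures u] mobs.
Proof.
split; first exact: open_off.
- by move=> u v _ _; exact: mobs_inj.
- by move=> u _; exact: mobs_continuous.
- by move=> W _; exact: mobs_open.
Qed.

Lemma mobs_image : mobs @` [set u | off_punctures u] = ~` scherk_ends th.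
Proof.
have [m0 ma mc] := mobs_punctures.
have pun u : off_punctures u = ~~ [|| u == pnt (pa th) 0, u == pnt 0 0 | u == pnt (pc th) 0].
  have E x : (u == pnt x 0) = (u 0 0 == x) && (u 0 1 == 0).
    by apply/eqP/andP => [->|[/eqP h1 /eqP h2]]; rewrite ?pntE ?eqxx// -[u]pnt_eta h1 h2.
  by rewrite !E off_puncturesE !inE; case: (u 0 1 == 0); rewrite ?andbT ?andbF.
apply/seteqP; split=> [_ [u /= ou <-]|y yn].
  move: ou; rewrite pun !negb_or => /and3P[ua u0 uc]; case=> [|[|[|]]].
  - by rewrite -m0 => /mobs_inj /eqP; rewrite (negbTE u0).
  - by move/eqP; rewrite (negbTE (mobs_neq u)).
  - by rewrite -ma => /mobs_inj /eqP; rewrite (negbTE ua).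
  - by rewrite -mc => /mobs_inj /eqP; rewrite (negbTE uc).
case: y yn => [g|] yn; last first.
  exists (rof (- 'i%C)); last exact: mobs_pole.
  by rewrite /= off_puncturesE mxE /= oppr_eq0 oner_eq0.
have g0 : g + e != 0.
  by apply: contra_notN yn; rewrite addr_eq0 => /eqP ->; right; left.
exists (rof (mobi g)); last exact: mobs_some.
rewrite /= pun; apply/negP; have gE := mobs_some g0.
case/or3P => /eqP E; move: gE; rewrite E ?ma ?m0 ?mc => gE; apply: yn; rewrite -gE.
- by right; right; left.
- by left.
- by right; right; right.
Qed.

End GaussSphere.

(** * Weierstrass data of the Scherk surface *)

Section ScherkMember.
Context {R : realType}.
Variables th rho Th : R.
Hypotheses (th_bounds : 0 < th < pi / 2) (rho0 : 0 < rho).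
Local Notation Re := complex.Re.
Local Notation Im := complex.Im.
Local Notation co := (cos th).
Local Notation si := (sin th).
Local Notation e := (expi th).
Local Notation nu := (nu th).
Local Notation nullv := (nullv th).
Local Notation rev := (rev th).
Local Notation mob := (mob th).
Local Notation mobs := (mobs th).
Local Notation scherk := (scherk Th th_bounds rho0).
Local Notation pa := (pa th).
Local Notation pc := (pc th).

Lemma expiE (t : R) : expi t = (cos t)%:C + 'i%C * (sin t)%:C.
Proof. by apply: eq_complexP; rewrite ?(cReM, cImM, cReD, cImD)/=; ring. Qed.

Lemma expiN (t : R) : expi (- t) = (cos t)%:C - 'i%C * (sin t)%:C.
Proof. by rewrite expiE cosN sinN rmorphN /= mulrN. Qed.

Lemma i2 : 'i%C ^+ 2 = -1 :> R[i].
Proof. by rewrite expr2 ii. Qed.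

Lemma co_complex_neq0 : co%:C != 0 :> R[i].
Proof. by rewrite eq_complex /= eqxx andbT gt_eqF// co_gt0. Qed.

Lemma si_complex_neq0 : si%:C != 0 :> R[i].
Proof. by rewrite eq_complex /= eqxx andbT gt_eqF// si_gt0. Qed.

Lemma nullv2 (z : R[i]) : nullv z 2 = 'i%C * ((1 + 'i%C * z) * (1 - 'i%C * z)).
Proof. by rewrite !nullvE /=; congr (_ * _); ring: (i2). Qed.

Lemma mob_neq0 (z : R[i]) : mob z != 0 -> 1 + 'i%C * z != 0.
Proof. by apply: contraNneq => z0; rewrite !mobE z0 mulr0 mul0r. Qed.

Lemma expi_inv (t : R) : (expi t)^-1 = expi (- t).
Proof.
apply: (mulfI (expi_neq0 t)); rewrite mulfV ?expi_neq0//.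
by rewrite -expi_add subrr expi0.
Qed.

Lemma mob_inv_nullv2 (z : R[i]) : 1 - 'i%C * z != 0 -> 1 + 'i%C * z != 0 ->
  (mob z)^-1 * nullv z 2 = 'i%C * expi (- th) * (1 - 'i%C * z) ^+ 2.
Proof.
move=> h1 h2; rewrite nullv2 !mobE -expi_inv.
by have := expi_neq0 th; move: h1 h2; move: e 'i%C => e i *; field; apply/and3P.
Qed.

Lemma mob_nullv2 (z : R[i]) : 1 - 'i%C * z != 0 ->
  mob z * nullv z 2 = 'i%C * e * (1 + 'i%C * z) ^+ 2.
Proof. by move=> h1; rewrite nullv2 !mobE; field. Qed.

Lemma nullv0_mob (z : R[i]) : 1 - 'i%C * z != 0 -> 1 + 'i%C * z != 0 ->
  nullv z 0 = 2^-1 * ((mob z)^-1 - mob z) * nullv z 2.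
Proof.
move=> h1 h2; rewrite -mulrA mulrBl mob_inv_nullv2// mob_nullv2// expiN expiE !nullvE /= rmorphM /=.
have -> : (2 : R)%:C = 2 :> R[i] by rewrite rmorphMn.
by apply: (mulfI two_neq0); rewrite mulrA divff ?two_neq0// mul1r; ring: (i2).
Qed.

Lemma nullv1_mob (z : R[i]) : 1 - 'i%C * z != 0 -> 1 + 'i%C * z != 0 ->
  nullv z 1 = 'i%C / 2 * ((mob z)^-1 + mob z) * nullv z 2.
Proof.
move=> h1 h2; rewrite -mulrA mulrDl mob_inv_nullv2// mob_nullv2// expiN expiE !nullvE /= rmorphM /=.
have -> : (2 : R)%:C = 2 :> R[i] by rewrite rmorphMn.
apply: (mulfI two_neq0); rewrite [RHS]mulrA (_ : 2 * ('i%C / 2) = 'i%C); last by field.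
by ring: (i2).
Qed.

(** The four linear factors in G vanish at the ends z = 0, infinity, [pa] and [pc]. The one that
    vanishes at infinity has constant numerator, and the other three make up [den]. *)
Lemma mob_polynomial (z : R[i]) : 1 - 'i%C * z != 0 ->
  (mob z ^+ 2 - expi (2 * th)) * (mob z ^+ 2 - expi (- (2 * th))) =
  16 * e ^+ 2 * si%:C * co%:C * den th z / (1 - 'i%C * z) ^+ 4.
Proof.
move=> h1; have c0 := co_complex_neq0; have s0 := si_complex_neq0.
rewrite (_ : 2 * th = th + th) ?opprD ?expi_add -?expr2; last by ring.
have -> : mob z ^+ 2 - e ^+ 2 = 4 * 'i%C * z * e ^+ 2 / (1 - 'i%C * z) ^+ 2.
  by rewrite !mobE; field.
have E1 : mob z - expi (- th) = 2 * 'i%C * co%:C * (z - pa%:C) / (1 - 'i%C * z).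
  rewrite !mobE !paE rmorphN fmorph_div /= expiN expiE; apply: (mulIf h1); rewrite divfK// mulrBl divfK//.
  move: c0; move: (co%:C) (si%:C) => c s c0; rewrite opprK.
  have -> : 2 * 'i%C * c * (z + s / c) = 2 * 'i%C * (c * z + s) by field.
  by ring: (i2).
have E2 : mob z + expi (- th) = - 2 * si%:C * (z - pc%:C) / (1 - 'i%C * z).
  rewrite !mobE !pcE fmorph_div /= expiN expiE; apply: (mulIf h1); rewrite divfK// mulrDl divfK//.
  move: s0; move: (co%:C) (si%:C) => c s s0.
  have -> : - 2 * s * (z - c / s) = - 2 * (s * z - c) by field.
  by ring: (i2).
rewrite subr_sqr E1 E2 /den; move: (z - pa%:C) (z - pc%:C) (co%:C) (si%:C) => p q c s.
transitivity (- ('i%C ^+ 2) * 16 * e ^+ 2 * s * c * (z * (p * q)) / (1 - 'i%C * z) ^+ 4).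
  by field.
by rewrite i2 opprK mul1r.
Qed.

(** Complex linearity with respect to X |-> n x X forces this imaginary part on a form with real
    part dx_3. *)
Definition scherk_dh (t : scherk) (X : 'rV[R]_3) : R[i] :=
  X 0 2 +i* (- cross (normal t) X 0 2).

Lemma scherk_dh_rev (t : scherk) w : scherk_dh t (rev w (proj t)) = w * nullv (cof (proj t)) 2.
Proof.
apply: eq_complexP; rewrite /= ?cross_nu_rev mxE//.
by rewrite -mulrA cReM /=; ring.
Qed.

Lemma tangent_rev (t : scherk) X : tangent t X -> X = rev (unrev th X (proj t)) (proj t).
Proof. by rewrite /tangent dotC => tX; apply: rev_unrev. Qed.

(** In a chart the coefficients are [dir k] times the holomorphic function [coef_f * nullv _ 2], so
    closedness is the Cauchy-Riemann equation; the formulas for dx_1 and dx_2 are [nullv0_mob] and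
    [nullv1_mob]. *)
Lemma scherk_weierstrass : weierstrass_data scherk_dh.
Proof.
split; [split|by move=> t X _|].
- move=> t a X Y _ _; rewrite /scherk_dh; apply: eq_complexP;
      by rewrite ?(cReM, cImM, cReD, cImD)/= ?crossE !rowE; ring.
- move=> t X /tangent_rev ->; rewrite /= cross_nu_rev !scherk_dh_rev; ring.
- move=> i u du coef.
    have [f' hf] := hol_coef rho Th th_bounds du.
    have [n' hn] : exists n', hol (fun v => nullv (cof v) 2) u n'.
      have hz := hol_id u; eexists.
      exact: (holZ 'i%C (holD (hol_cst 1 u) (holM hz hz))).
    have nD : \forall v \near u, dom i v.
      by apply: open_nbhs_nbhs; split=> //; exact: open_slit.
    have H k : hol (coef k) u (dir k * (f' * nullv (cof u) 2 + coef_f th rho Th u * n')).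
      apply: hol_near (holZ (dir k) (holM hf hn)).
      move: nD; apply: (@filterS _ (nbhs u)) => v dv.
      have pv : proj (par i v : scherk) = v by exact: (proj_par th_bounds dv).
      rewrite /coef; have -> : pd k (@immersion R scherk \o par i) v = rev (coef_f th rho Th v * dir k) (proj (par i v : scherk)).
        by rewrite pv; exact: (scherk_pd rho Th th_bounds k dv).
      by rewrite scherk_dh_rev pv; ring.
    have H' k := cdd_cpd (H k).
    split=> [k|]; first by have [] := H' k.
    by rewrite (H' 1).2 (H' 0).2; ring.
- move=> t X /tangent_rev -> G n1 G0.
have z1 : 1 - 'i%C * cof (proj t) != 0 by move: n1; rewrite /= nu2_eq1.
have GE : G = mob (cof (proj t)) by rewrite /G /gauss_value /= gauss_nu.
rewrite scherk_dh_rev; have z2 : 1 + 'i%C * cof (proj t) != 0.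
  by apply: mob_neq0; rewrite -GE.
have rE k : rev (unrev th X (proj t)) (proj t) 0 k = Re (unrev th X (proj t) * nullv (cof (proj t)) k).
  by rewrite mxE.
rewrite GE !rE; split; congr Re.
  by rewrite (nullv0_mob z1 z2); ring.
by rewrite (nullv1_mob z1 z2); ring.
Qed.

Lemma scherk_minimal : minimal scherk.
Proof.
move=> i u du; apply: (@conformal_minimal _ th (@dom R scherk i) _ (coef_f th rho Th)) du.
- by have [] := par_embedding i.
- by move=> v k; exact: scherk_pd.
- exact: coef_neq0.
- exact: hol_coef.
Qed.

Lemma scherk_gauss_map : @gauss_map R scherk = mobs \o (@proj R pa 0 pc).
Proof.
apply/funext => t; rewrite /gauss_map /= mobsE nu2_eq1; case: ifPn => // z1.
by rewrite /gauss_value /= gauss_nu// nu2_eq1.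
Qed.

Lemma scherk_is_member : scherk_member scherk th rho Th.
Proof.
have h1 := pa_lt0 th_bounds; have h2 := pc_gt0 th_bounds.
split; first exact: scherk_minimal.
- exact: tree_simply_connected.
- rewrite scherk_gauss_map -mobs_image//; apply: covering_comp_embedding.
    exact: proj_covering.
  exact: mobs_embedding.
exists scherk_dh; first exact: scherk_weierstrass.
move=> i u k du p G n1 G0.
have pu : proj p = u by rewrite /p /= proj_par.
have z1 : 1 - 'i%C * cof u != 0 by move: n1; rewrite /= -/p pu nu2_eq1.
have GE : G = mob (cof u) by rewrite /G /gauss_value /= -/p pu gauss_nu// nu2_eq1.
have z2 : 1 + 'i%C * cof u != 0 by apply: mob_neq0; rewrite -GE.
have -> : cpd k (@gauss_value R scherk \o par i) u = 2 * 'i%C * e / (1 - 'i%C * cof u) ^+ 2 * dir k.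
  suff /cdd_cpd[_ ->] : hol (@gauss_value R scherk \o par i) u (2 * 'i%C * e / (1 - 'i%C * cof u) ^+ 2) by [].
  apply: hol_near (hol_mob th z1).
  have nD : \forall v \near u, dom i v.
    by apply: open_nbhs_nbhs; split=> //; exact: open_slit.
  have nz : \forall v \near u, 0 < normc2 (1 - 'i%C * cof v).
    have cden := continuous_comp (cdd_continuous (hol_mob_den u)) (@normc2_continuous R _).
    by apply: (cvgr_gt _ cden); rewrite -complex_neq0.
  move: (near_and nD nz); apply: (@filterS _ (nbhs u)) => v [dv v0].
  by rewrite /gauss_value /= proj_par// gauss_nu// nu2_eq1 complex_neq0.
have -> : pd k (@immersion R scherk \o par i) u = rev (coef_f th rho Th u * dir k) (proj p).
  by rewrite pu; exact: scherk_pd.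
rewrite scherk_dh_rev GE mob_polynomial// pu mulrCA mob_inv_nullv2// /coef_f /kappa.
have d0 : den th (cof u) != 0 := off_den (slit_off h1 h2 du).
have c0 := co_complex_neq0; have s0 := si_complex_neq0; have e0 := expi_neq0 th.
rewrite -expi_inv fmorph_div /= !rmorphM /= (_ : (8 : R)%:C = 8); last by rewrite rmorphMn.
move: (den th (cof u)) d0 (co%:C) c0 (si%:C) s0 e e0 (1 - 'i%C * cof u) z1 => d d0 c c0 s s0 e e0 z z0.
by field; rewrite ?d0 ?c0 ?s0 ?e0 ?z0.
Qed.

End ScherkMember.

(** * Twice differentiable functions and vector fields *)

Section TwiceDifferentiable.
Context {R : realType}.
Variable D : set 'rV[R]_2.
Hypothesis oD : open D.
Implicit Types (f g : 'rV[R]_2 -> R) (u v : 'rV[R]_2).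

(** Differentiable first partials are what [schwarz] uses, and the notion is stable under the
    algebraic operations and square roots from which the normal is built. *)
Definition c2_with f (a : 'I_2 -> 'rV[R]_2 -> R) :=
  forall u, D u -> dd f u (a^~ u) /\ forall k, exists b, dd (a k) u b.

Definition c2 f := exists a, c2_with f a.

Lemma near_open u (P : set 'rV[R]_2) : (forall v, D v -> P v) -> D u -> \forall v \near u, P v.
Proof.
move=> DP Du; have : \forall v \near u, D v by apply: open_nbhs_nbhs.
by apply: (@filterS _ (nbhs u)).
Qed.

Lemma c2_sym f a : c2_with f a -> forall u, D u ->
  exists b : 'I_2 -> 'I_2 -> R, (forall k, dd (a k) u (b^~ k)) /\ b 0 1 = b 1 0.
Proof.
move=> fa u Du; have [_ da] := fa u Du.
have [b0 h0] := da 0; have [b1 h1] := da 1.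
exists (fun m k => if k == 0 then b0 m else b1 m); split=> [k|/=].
  by case: (ord2P k) => ->.
have E k b : dd (a k) u b -> dd (pd k f) u b.
  apply: dd_near; apply: near_open Du => v Dv.
  by have [[_ ->]] := fa v Dv.
have df : \forall v \near u, differentiable f v.
  by apply: near_open Du => v Dv; have [[]] := fa v Dv.
have [E0 e0] := E _ _ h0; have [E1 e1] := E _ _ h1.
by rewrite -e0 -e1 (schwarz df E0 E1).
Qed.

Lemma c2_cst (c : R) : c2 (fun=> c).
Proof.
by exists (fun _ _ => 0) => u _; split=> [|k]; [exact: dd_cst|exists (fun=> 0); exact: dd_cst].
Qed.

Lemma c2D f g : c2 f -> c2 g -> c2 (fun v => f v + g v).
Proof.
move=> [a fa] [b gb]; exists (fun k v => a k v + b k v) => u Du.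
have [h1 h2] := fa u Du; have [h3 h4] := gb u Du; split; first exact: ddD.
by move=> k; have [p hp] := h2 k; have [q hq] := h4 k; eexists; exact: ddD hp hq.
Qed.

Lemma c2N f : c2 f -> c2 (fun v => - f v).
Proof.
move=> [a fa]; exists (fun k v => - a k v) => u Du.
have [h1 h2] := fa u Du; split; first exact: ddN.
by move=> k; have [p hp] := h2 k; eexists; exact: ddN hp.
Qed.

Lemma c2M f g : c2 f -> c2 g -> c2 (fun v => f v * g v).
Proof.
move=> [a fa] [b gb]; exists (fun k v => a k v * g v + f v * b k v) => u Du.
have [h1 h2] := fa u Du; have [h3 h4] := gb u Du.
split; first by apply: dd_ext (ddM h1 h3) _ => k; ring.
by move=> k; have [p hp] := h2 k; have [q hq] := h4 k; eexists; exact: ddD (ddM hp h3) (ddM h1 hq).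
Qed.

Lemma c2V f : (forall u, D u -> f u != 0) -> c2 f -> c2 (fun v => (f v)^-1).
Proof.
move=> f0 [a fa]; exists (fun k v => - a k v * ((f v)^-1 * (f v)^-1)) => u Du.
have [h1 h2] := fa u Du; have hV := ddV (f0 u Du) h1.
split; first by apply: dd_ext hV _ => k; rewrite -expr2 exprVn.
by move=> k; have [p hp] := h2 k; eexists; exact: ddM (ddN hp) (ddM hV hV).
Qed.

Lemma c2_sqrt f : (forall u, D u -> 0 < f u) -> c2 f -> c2 (fun v => Num.sqrt (f v)).
Proof.
move=> f0 [a fa]; exists (fun k v => a k v * (2 * Num.sqrt (f v))^-1) => u Du.
have [h1 h2] := fa u Du; have hs := dd_sqrt (f0 u Du) h1.
split; first exact: hs.
have s0 : 2 * Num.sqrt (f u) != 0 by rewrite mulf_neq0 ?pnatr_eq0// gt_eqF// sqrtr_gt0 f0.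
by move=> k; have [p hp] := h2 k; eexists; exact: ddM hp (ddV s0 (ddM (dd_cst 2 u) hs)).
Qed.

Lemma c2_fun f g : f =1 g -> c2 f -> c2 g.
Proof. by move=> /funext ->. Qed.

End TwiceDifferentiable.

Section VectorCalculus.
Context {R : realType}.
Implicit Types (F G : 'rV[R]_2 -> 'rV[R]_3) (u v : 'rV[R]_2) (a b : 'I_2 -> 'rV[R]_3).

Definition vdd F u a := forall l, dd (fun v => F v 0 l) u (fun k => a k 0 l).

Lemma vdd_pd F u : differentiable F u <-> vdd F u (fun k => pd k F u).
Proof.
split=> [dF l|H]; last by apply/differentiable_row => l; have [] := H l.
have := (differentiable_row F u).1 dF l => dl; split=> // k.
by rewrite pd_row.
Qed.

Lemma vdd_diff F u a : vdd F u a -> differentiable F u.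
Proof. by move=> H; apply/differentiable_row => l; have [] := H l. Qed.

Lemma vddE F u a : vdd F u a -> forall k, pd k F u = a k.
Proof.
move=> H k; apply/rowP => l; rewrite pd_row; last exact: vdd_diff H.
by have [_ ->] := H l.
Qed.

Lemma vdd_near F G u a : (\forall v \near u, F v = G v) -> vdd F u a -> vdd G u a.
Proof. by move=> FG H l; apply: dd_near (H l); move: FG; apply: (@filterS _ (nbhs u)) => v ->. Qed.

Lemma vdd_dot F G u a b : vdd F u a -> vdd G u b ->
  dd (fun v => dot (F v) (G v)) u (fun k => dot (a k) (G u) + dot (F u) (b k)).
Proof.
move=> hF hG; apply: dd_ext (dd_near _ (ddD (ddD (ddM (hF 0) (hG 0)) (ddM (hF 1) (hG 1))) (ddM (hF 2) (hG 2)))) _.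
  by apply: filterE => v; rewrite dot3.
by move=> k; rewrite !dot3; ring.
Qed.

Lemma vdd_cst (c : 'rV[R]_3) u : vdd (fun=> c) u (fun=> 0).
Proof. by move=> l; apply: dd_ext (dd_cst _ u) _ => k; rewrite mxE. Qed.

End VectorCalculus.

Section Matrix22.
Context {F : fieldType}.
Implicit Types A B : 'M[F]_2.

Lemma det22 A : \det A = A 0 0 * A 1 1 - A 0 1 * A 1 0.
Proof.
rewrite (expand_det_row _ 0) sum2 /cofactor !det_mx11 !mxE /=.
have -> : lift 0 0 = 1 :> 'I_2 by exact/val_inj.
have -> : lift 1 0 = 0 :> 'I_2 by exact/val_inj.
by rewrite expr0 mul1r (_ : (0 + 1 %% 2)%N = 1%N)// expr1 mulN1r mulrN.
Qed.

Lemma trace_mul_inv22 A B : \det B != 0 ->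
  \tr (A *m invmx B) * \det B =
  A 0 0 * B 1 1 - A 0 1 * B 1 0 - A 1 0 * B 0 1 + A 1 1 * B 0 0.
Proof.
move=> B0; pose C : 'M[F]_2 := \matrix_(i, j) (if i == j then B (1 - i) (1 - j) else - B i j).
have o0 : (1 - 0 : 'I_2) = 1 by exact/val_inj.
have o1 : (1 - 1 : 'I_2) = 0 by exact/val_inj.
have BC : B *m C = (\det B)%:M.
  apply/matrixP => i j; rewrite !mxE sum2 !mxE det22.
  by case: (ord2P i) => ->; case: (ord2P j) => ->; rewrite /= ?o0 ?o1 ?mulr1n ?mulr0n; ring.
have -> : invmx B = (\det B)^-1 *: C.
  have uB : B \in unitmx by rewrite unitmxE unitfE.
  have : B *m ((\det B)^-1 *: C) = 1%:M by rewrite -scalemxAr BC scale_scalar_mx mulVf.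
  by move=> /(congr1 (mulmx (invmx B))); rewrite mulKmx// mulmx1.
rewrite -scalemxAr mxtraceZ mulrAC mulVf// mul1r /mxtrace sum2 !mxE !sum2 !mxE /= o0 o1.
ring.
Qed.

End Matrix22.

(** * Minimal patches *)

Section Patch.
Context {R : realType}.
Variables (D : set 'rV[R]_2) (r : 'rV[R]_2 -> 'rV[R]_3).
Hypotheses (oD : open D) (sr : smooth_on D r).
Hypothesis mean0 : forall u, D u -> patch_mean_curvature r u = 0.
Hypothesis gauss_lt0 : forall u, D u -> patch_gauss_curvature r u < 0.
Implicit Types (u v : 'rV[R]_2).
Local Notation n := (patch_normal r).
Local Notation g := (first_form r).
Local Notation h := (second_form r).

Lemma patch_vdd u : D u -> vdd r u (fun k => pd k r u).
Proof. by move=> Du; apply/vdd_pd; exact: (sr [::]). Qed.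

Lemma patch_vdd1 k u : D u -> vdd (pd k r) u (fun m => pd m (pd k r) u).
Proof. by move=> Du; apply/vdd_pd; exact: (sr [:: k]). Qed.

Lemma patch_vdd2 m k u : D u -> exists a, vdd (pd m (pd k r)) u a.
Proof. by move=> Du; eexists; apply/vdd_pd; exact: (sr [:: m; k]). Qed.

Lemma patch_sym u : D u -> pd 0 (pd 1 r) u = pd 1 (pd 0 r) u.
Proof.
move=> Du; apply/rowP => l.
have [|b [hb b01]] := @c2_sym _ D oD (fun v => r v 0 l) (fun k v => pd k r v 0 l) _ u Du.
  move=> v Dv; split; first exact: patch_vdd.
  by move=> k; eexists; exact: (patch_vdd1 k Dv l).
have [_ h0] := hb 0; have [_ h1] := hb 1.
have [_ e0] := patch_vdd1 0 Du l; have [_ e1] := patch_vdd1 1 Du l.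
exact: etrans (esym (e1 0)) (etrans (h1 0) (etrans b01 (etrans (esym (h0 1)) (e0 1)))).
Qed.

Lemma patch_c2 k l : c2 D (fun v => pd k r v 0 l).
Proof.
exists (fun m v => pd m (pd k r) v 0 l) => u Du; split; first exact: patch_vdd1.
by move=> m; have [a ha] := patch_vdd2 m k Du; eexists; exact: (ha l).
Qed.

Lemma gE u i j : g u i j = dot (pd i r u) (pd j r u).
Proof. by rewrite mxE. Qed.

Lemma hE u i j : h u i j = dot (pd i (pd j r) u) (n u).
Proof. by rewrite mxE. Qed.

Lemma dot_cross (x y : 'rV[R]_3) : dot (cross x y) (cross x y) = dot x x * dot y y - dot x y ^+ 2.
Proof. by rewrite !dot3 !crossE; ring. Qed.

Lemma patch_dets u : D u -> \det (g u) != 0 /\ \det (h u) != 0.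
Proof.
move=> /gauss_lt0; rewrite /patch_gauss_curvature /shape_operator det_mulmx => K0.
have [g0|g0] := eqVneq (\det (g u)) 0.
  (* On a singular matrix [invmx] is the identity, so a degenerate metric would have curvature 0. *)
  have : (invmx (g u)) = g u by rewrite /invmx unitmxE unitfE g0 eqxx.
  by move=> E; move: K0; rewrite E g0 mulr0 ltxx.
by split=> //; apply: contraTneq K0 => ->; rewrite mul0r ltxx.
Qed.

Lemma patch_gaussE u : patch_gauss_curvature r u = \det (h u) / \det (g u).
Proof. by rewrite /patch_gauss_curvature /shape_operator det_mulmx det_inv. Qed.

Lemma patch_cross_gt0 u : D u -> 0 < dot (cross (pd 0 r u) (pd 1 r u)) (cross (pd 0 r u) (pd 1 r u)).
Proof.
move=> Du; rewrite lt0r dot_ge0 andbT dot_cross.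
have [g0 _] := patch_dets Du; move: g0; rewrite det22 !gE.
by move: (pd 0 r u) (pd 1 r u) => x y; rewrite (dotC y x) expr2.
Qed.

Lemma patch_normalE u : n u = (Num.sqrt (dot (cross (pd 0 r u) (pd 1 r u)) (cross (pd 0 r u) (pd 1 r u))))^-1 *: cross (pd 0 r u) (pd 1 r u).
Proof. by []. Qed.

Lemma patch_normal_unit u : D u -> dot (n u) (n u) = 1.
Proof.
move=> /patch_cross_gt0; rewrite patch_normalE; set w := cross _ _ => w0.
rewrite dotZl dotC dotZl mulrA -expr2 exprVn sqr_sqrtr ?ltW// mulVf// gt_eqF//.
Qed.

Lemma patch_normal_orth u k : dot (n u) (pd k r u) = 0.
Proof.
rewrite patch_normalE dotZl; suff -> : dot (cross (pd 0 r u) (pd 1 r u)) (pd k r u) = 0 by rewrite mulr0.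
by case: (ord2P k) => ->; move: (pd 0 r u) (pd 1 r u) => x y; rewrite !dot3 !crossE; ring.
Qed.

Lemma patch_normal_c2 l : c2 D (fun v => n v 0 l).
Proof.
pose w v := cross (pd 0 r v) (pd 1 r v).
have cw i : c2 D (fun v => w v 0 i).
  have H a b c d : c2 D (fun v => pd 0 r v 0 a * pd 1 r v 0 b + - (pd 0 r v 0 c * pd 1 r v 0 d)).
    by apply: c2D; [|apply: c2N]; apply: c2M; exact: patch_c2.
  by rewrite /w; case: (ord3P i) => ->; [apply: c2_fun (H 1 2 2 1)|apply: c2_fun (H 2 0 0 2)|
    apply: c2_fun (H 0 1 1 0)] => v; rewrite crossE.
apply: (c2_fun (f := fun v => (Num.sqrt (w v 0 0 * w v 0 0 + w v 0 1 * w v 0 1 + w v 0 2 * w v 0 2))^-1 * w v 0 l)).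
  by move=> v; rewrite patch_normalE rowE dot3.
have p u : D u -> 0 < w u 0 0 * w u 0 0 + w u 0 1 * w u 0 1 + w u 0 2 * w u 0 2.
  by move=> /patch_cross_gt0; rewrite dot3.
apply: c2M (cw l); apply: c2V => [u Du|]; first by rewrite gt_eqF// sqrtr_gt0 p.
by apply: c2_sqrt => //; do 2?apply: c2D; apply: c2M.
Qed.

(** Differentiate <n, r_j> = 0. *)
Lemma weingarten u b k j : D u -> vdd n u b -> dot (b k) (pd j r u) = - h u k j.
Proof.
move=> Du hn; have [_ /(_ k)] := vdd_dot hn (patch_vdd1 j Du).
have [_ ->] : dd (fun v => dot (n v) (pd j r v)) u (fun=> 0).
  by apply: dd_near (dd_cst 0 u); apply: filterE => v; rewrite patch_normal_orth.
by move=> E; rewrite hE [dot (pd _ _ _) _]dotC; apply/eqP; rewrite -addr_eq0 E.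
Qed.

Lemma patch_normal_vdd : exists b : 'I_2 -> 'rV[R]_2 -> 'rV[R]_3,
  forall u, D u -> vdd n u (b^~ u).
Proof.
have [a0 h0] := patch_normal_c2 0; have [a1 h1] := patch_normal_c2 1; have [a2 h2] := patch_normal_c2 2.
exists (fun k v => vec3 (a0 k v) (a1 k v) (a2 k v)) => u Du l.
have [d0 _] := h0 u Du; have [d1 _] := h1 u Du; have [d2 _] := h2 u Du.
by case: (ord3P l) => ->; [apply: dd_ext d0 _|apply: dd_ext d1 _|apply: dd_ext d2 _] => k; rewrite vec3E.
Qed.

Lemma patch_trace u : D u ->
  h u 0 0 * g u 1 1 - h u 0 1 * g u 1 0 - h u 1 0 * g u 0 1 + h u 1 1 * g u 0 0 = 0.
Proof.
move=> Du; have [g0 _] := patch_dets Du; have := mean0 Du.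
rewrite -trace_mul_inv22// /patch_mean_curvature /shape_operator => /eqP.
by rewrite mulf_eq0 invr_eq0 pnatr_eq0 orbF => /eqP ->; rewrite mul0r.
Qed.

Lemma dot_cts (F G : 'rV[R]_2 -> 'rV[R]_3) u a b : vdd F u a -> vdd G u b ->
  {for u, continuous (fun v => dot (F v) (G v))}.
Proof. by move=> hF hG; exact: dd_cont (vdd_dot hF hG). Qed.

Lemma dot_sub (x y : 'rV[R]_3) : dot (x - y) (x - y) = dot x x + dot y y - 2 * dot x y.
Proof. by rewrite !dot3 !rowE; ring. Qed.

Lemma unit_dot1 (x y : 'rV[R]_3) : dot x x = 1 -> dot y y = 1 -> dot x y ^+ 2 = 1 -> x = y \/ x = - y.
Proof.
move=> xx yy /eqP; rewrite sqrf_eq1 => /orP[] /eqP E; [left|right].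
  by apply/eqP; rewrite -subr_eq0 -dot_eq0 dot_sub xx yy E; apply/eqP; ring.
by apply/eqP; rewrite -subr_eq0 -dot_eq0 dot_sub dotNl !dotNr opprK xx yy E; apply/eqP; ring.
Qed.

(* Where [P] vanishes, the relation persists in the limit with [K != 0] unless
   the normal is locally constant, which would also force [K = 0]. *)
Lemma normal_avoids (V1 V2 : 'rV[R]_3) (c : R) : dot V1 V1 = 1 -> dot V2 V2 = 1 -> 0 < c ->
  let P u := (1 - dot (n u) V1 ^+ 2) * (1 - dot (n u) V2 ^+ 2) in
  (forall u, D u -> P u != 0 -> P u ^+ 2 = c * patch_gauss_curvature r u ^+ 2) ->
  forall u, D u -> P u != 0.
Proof.
move=> V11 V22 c0 P hP u Du; apply/negP => /eqP Pu.
have [b hb] := patch_normal_vdd; have hbu := hb u Du.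
have cn V : {for u, continuous (fun v => dot (n v) V)} by exact: (dot_cts hbu (vdd_cst V u)).
have cP : {for u, continuous P}.
  rewrite /P; apply: (@continuous_near _ _ (fun v => (1 - dot (n v) V1 * dot (n v) V1) * (1 - dot (n v) V2 * dot (n v) V2))).
    by apply: filterE => v; rewrite !expr2.
  by have cn1 := cn V1; have cn2 := cn V2; cont.
have cg i j : {for u, continuous (fun v => g v i j)}.
  by apply: continuous_near (dot_cts (patch_vdd1 i Du) (patch_vdd1 j Du)); apply: filterE => v; rewrite gE.
have ch i j : {for u, continuous (fun v => h v i j)}.
  have [a ha] := patch_vdd2 i j Du.
  by apply: continuous_near (dot_cts ha hbu); apply: filterE => v; rewrite hE.
have cdg : {for u, continuous (fun v => \det (g v))}.
  apply: (@continuous_near _ _ (fun v => g v 0 0 * g v 1 1 - g v 0 1 * g v 1 0)).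
    by apply: filterE => v; rewrite det22.
  have c1 := cg 0 0; have c2 := cg 1 1; have c3 := cg 0 1; have c4 := cg 1 0.
  by apply: cont_add; [|apply: cont_opp]; apply: cont_mul.
have cdh : {for u, continuous (fun v => \det (h v))}.
  apply: (@continuous_near _ _ (fun v => h v 0 0 * h v 1 1 - h v 0 1 * h v 1 0)).
    by apply: filterE => v; rewrite det22.
  have c1 := ch 0 0; have c2 := ch 1 1; have c3 := ch 0 1; have c4 := ch 1 0.
  by apply: cont_add; [|apply: cont_opp]; apply: cont_mul.
have [_ h0] := patch_dets Du.
(* At [u] this is c (det h)^2 > 0, whereas the relation makes it 0 wherever [P] does not vanish;
   hence [P] vanishes near [u]. *)
have H0 : \forall v \near u, 0 < c * (\det (h v) * \det (h v)) - (P v * \det (g v)) * (P v * \det (g v)).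
  have cF : {for u, continuous (fun v => c * (\det (h v) * \det (h v)) - (P v * \det (g v)) * (P v * \det (g v)))}.
    apply: cont_add; first by apply: cont_mul; [exact: cont_cst|exact: cont_mul].
    by apply: cont_opp; apply: cont_mul; apply: cont_mul.
  by apply: (cvgr_gt _ cF); rewrite Pu !mul0r subr0 mulr_gt0// -expr2 lt0r sqr_ge0 sqrf_eq0 h0.
have P0 : \forall v \near u, D v /\ P v = 0.
  move: (near_and (near_open oD (fun v Dv => Dv) Du) H0); apply: (@filterS _ (nbhs u)) => v [Dv Hv].
  split; first exact: Dv.
  have [g0 _] := patch_dets Dv; have := hP v Dv; rewrite patch_gaussE.
  move: (P v) (\det (g v)) (\det (h v)) g0 Hv => p dg dh g0 Hv E.
  apply/eqP; apply: contraTT Hv => p0; rewrite -leNgt -!expr2 exprMn E//.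
  by rewrite exprMn exprVn -!mulrA mulVf ?sqrf_eq0// mulr1 subrr.
have dist V : dot V V = 1 -> n u = V \/ \forall v \near u, n v <> V.
  move=> VV; have [->|nV] := pselect (n u = V); [by left|right].
  have h1 : dot (n u) V < 1.
    rewrite lt_neqAle; apply/andP; split.
      apply/eqP => E; apply: nV; apply/eqP; rewrite -subr_eq0 -dot_eq0 dot_sub.
      by rewrite VV patch_normal_unit// E; apply/eqP; ring.
    rewrite -subr_ge0 -(pmulr_rge0 _ (ltr0Sn R 1)).
    rewrite (_ : _ * _ = dot (n u - V) (n u - V)) ?dot_ge0// dot_sub.
    by rewrite VV patch_normal_unit//; ring.
  have : \forall v \near u, dot (n v) V < 1 by exact: (cvgr_lt _ (cn V)).
  by apply: (@filterS _ (nbhs u)) => v + E; rewrite E VV ltxx.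
have cases v : D v -> P v = 0 -> [\/ n v = V1, n v = - V1, n v = V2 | n v = - V2].
  move=> Dv /eqP; rewrite mulf_eq0 !subr_eq0 ![1 == _]eq_sym => /orP[] /eqP /unit_dot1 [|//|E|E].
  - exact: patch_normal_unit.
  - by constructor 1.
  - by constructor 2.
  - exact: patch_normal_unit.
  - by constructor 3.
  - by constructor 4.
have NV (V : 'rV[R]_3) : dot V V = 1 -> dot (- V) (- V) = 1 by rewrite dotNl dotNr opprK.
(* Near [u] the normal takes values in a finite set, so by continuity it keeps the value that it has
   at [u]. *)
have key V : dot V V = 1 -> \forall v \near u, n v = V -> n v = n u.
  move=> /dist[<-|]; first by apply: filterE => v.
  by apply: (@filterS _ (nbhs u)) => v nv E; case: (nv E).
have nc : \forall v \near u, n v = n u.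
  have k1 := key V1 V11; have k2 := key (- V1) (NV V1 V11).
  have k3 := key V2 V22; have k4 := key (- V2) (NV V2 V22).
  move: (near_and P0 (near_and (near_and k1 k2) (near_and k3 k4))).
  by apply: (@filterS _ (nbhs u)) => v [[Dv Pv] [[l1 l2] [l3 l4]]]; case: (cases v Dv Pv).
have bz : vdd n u (fun=> 0).
  apply: vdd_near (vdd_cst (n u) u); move: nc; apply: (@filterS _ (nbhs u)) => v E.
  exact: esym E.
have hz i j : h u i j = 0.
  by apply/eqP; rewrite -oppr_eq0 -(weingarten i j Du bz) dot3 !mxE !mul0r !addr0.
by move: h0; rewrite det22 !hz mul0r subrr eqxx.
Qed.

End Patch.

(** * Algebra of the Gauss map of a minimal surface *)

Section HopfAlgebra.
Context {R : realType}.
Implicit Types (b w q : R[i]).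
Local Notation Re := complex.Re.
Local Notation Im := complex.Im.

Lemma normc2_gt0 (z : R[i]) : z != 0 -> 0 < normc2 z.
Proof. by rewrite complex_neq0. Qed.

Lemma mul_conj (z : R[i]) : z * z^*%C = (normc2 z)%:C.
Proof. by case: z => x y; apply: eq_complexP; rewrite ?(cReM, cImM) /normc2 /=; ring. Qed.

(** Solves [w = f * b] for [f] by projection onto the pair [b]; unlike a quotient of components, it
    depends differentiably on the data wherever [b] is nonzero as a pair. *)
Definition quot b0 b1 w0 w1 : R[i] :=
  (w0 * b0^*%C + w1 * b1^*%C) * ((normc2 b0 + normc2 b1)^-1)%:C.

(* With tangent vectors [rev (w k)] and normal derivatives
   [-2 / rad ^ 2 *: rev (conj (b k))], the symmetry of the second form and
   the vanishing of the mean curvature say that [b0 * w1 - b1 * w0] has zero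
   real and imaginary part. *)
Lemma hopf b0 b1 w0 w1 (d : R) :
  let g x y := d * (Re x * Re y + Im x * Im y) in
  let h x y := 2 * Re (x * y) in
  let dg := g w0 w0 * g w1 w1 - g w0 w1 * g w1 w0 in
  let dh := h b0 w0 * h b1 w1 - h b0 w1 * h b1 w0 in
  dg != 0 -> dh != 0 -> h b0 w1 = h b1 w0 ->
  h b0 w0 * g w1 w1 - h b0 w1 * g w1 w0 - h b1 w0 * g w0 w1 + h b1 w1 * g w0 w0 = 0 ->
  let f := quot b0 b1 w0 w1 in
  [/\ w0 = f * b0, w1 = f * b1, Im (b0^*%C * b1) != 0, f != 0
    & dh * (d ^+ 2 * normc2 f) = - 4 * dg].
Proof.
move=> g h dg dh dg0 dh0 sym tr f.
have bn0 : normc2 b0 + normc2 b1 != 0.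
  apply: contra_neq dh0 => /eqP; rewrite paddr_eq0 ?addr_ge0 ?sqr_ge0// => /andP[z0 z1].
  have Z b : normc2 b == 0 -> b = 0.
    by move=> z; apply/eqP; apply: contraTT z => /normc2_gt0 /lt0r_neq0.
  by rewrite /dh /h (Z _ z0) (Z _ z1) !mul0r /=; ring.
have J0 : Re w0 * Im w1 - Im w0 * Re w1 != 0.
  apply: contra_neq dg0 => J.
  by transitivity (d ^+ 2 * (Re w0 * Im w1 - Im w0 * Re w1) ^+ 2); [rewrite /dg /g; ring|rewrite J; ring].
have d0 : d != 0 by apply: contra_neq dg0 => E; rewrite /dg /g E; ring.
have cross : b0 * w1 = b1 * w0.
  apply: eq_complexP; first by apply: (mulfI (_ : 2 != 0)); [rewrite pnatr_eq0|exact: sym].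
  (* The trace expression is 2 d times the imaginary part of b0 w1 - b1 w0 times the determinant in
     [J0]. *)
  apply/eqP; rewrite -subr_eq0; apply/eqP; apply: (mulIf J0); rewrite mul0r.
  apply: (mulfI d0); apply: (mulfI (_ : 2 != 0)); first by rewrite pnatr_eq0.
  rewrite !mulr0 -tr /h /g !(cReM, cImM).
  case: b0 b1 w0 w1 {bn0 sym tr f dg dh dg0 dh0 g h J0} => x0 y0 [x1 y1] [p0 q0] [p1 q1] /=; ring.
have fE b w : b * w0 = b0 * w -> b * w1 = b1 * w -> w = f * b.
  move=> E0 E1; have sE : (b0 * b0^*%C + b1 * b1^*%C) * ((normc2 b0 + normc2 b1)^-1)%:C = 1.
    by rewrite !mul_conj -rmorphD -rmorphM /= divff.
  rewrite /f /quot; move: sE; move: (_%:C) => s sE.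
  transitivity (((b * w0) * b0^*%C + (b * w1) * b1^*%C) * s); last by ring.
  by rewrite E0 E1; transitivity ((b0 * b0^*%C + b1 * b1^*%C) * s * w); [rewrite sE mul1r|ring].
have w0E : w0 = f * b0 by apply: fE; rewrite // cross.
have w1E : w1 = f * b1 by apply: fE; rewrite // -cross.
have dhE : dh = - 4 * normc2 f * (Im (b0^*%C * b1)) ^+ 2.
  rewrite /dh /h w0E w1E /normc2 !(cReM, cImM) /=.
  by case: b0 b1 f {bn0 sym tr dg dh dg0 dh0 g h J0 cross fE w0E w1E} => x0 y0 [x1 y1] [p q] /=; ring.
have dgE : dg = d ^+ 2 * normc2 f ^+ 2 * (Im (b0^*%C * b1)) ^+ 2.
  rewrite /dg /g w0E w1E /normc2 !(cReM, cImM) /=.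
  by case: b0 b1 f {bn0 sym tr dg dh dg0 dh0 g h J0 cross fE w0E w1E dhE} => x0 y0 [x1 y1] [p q] /=; ring.
split=> //.
- by apply: contra_neq dh0; rewrite dhE => ->; ring.
- by apply: contra_neq dh0; rewrite dhE => ->; rewrite /normc2 /=; ring.
- by rewrite dhE dgE; ring.
Qed.

(** The numbers conj(q) q_k are i t_k with t_k real, and the equation becomes t0 b1 = t1 b0, while
    b0 and b1 are independent over the reals. *)
Lemma unit_modulus_derivative q q0 q1 b0 b1 : q != 0 -> Im (b0^*%C * b1) != 0 ->
  q0 * b1 = q1 * b0 -> Re (q^*%C * q0) = 0 -> Re (q^*%C * q1) = 0 -> q0 = 0 /\ q1 = 0.
Proof.
move=> q_neq0 J0 E r0 r1; have n0 : (normc2 q)%:C != 0 :> R[i].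
  by rewrite eq_complex /= eqxx andbT gt_eqF// normc2_gt0.
have H z : q^*%C * z = 0 -> z = 0.
  move=> /(congr1 (fun x => q * x)); rewrite mulr0 mulrA mul_conj => /eqP.
  by rewrite mulf_eq0 (negbTE n0) => /eqP.
have E' : q^*%C * q0 * b1 = q^*%C * q1 * b0 by rewrite -!mulrA E.
have := H q0; have := H q1; move: r0 r1 E'; move: (q^*%C * q0) (q^*%C * q1) => [p0 t0] [p1 t1] /= -> -> E' h1 h0.
have h b0' b1' s0 s1 : Im (b0'^*%C * b1') != 0 -> (0 +i* s0) * b1' = (0 +i* s1) * b0' -> s0 = 0.
  move=> I0 Eb; apply/eqP; rewrite -[_ == _]orbF -(negbTE I0) -mulf_eq0; apply/eqP.
  have := congr1 (@complex.Re R) Eb; have := congr1 (@complex.Im R) Eb.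
  rewrite !(cReM, cImM) /=; case: b0' b1' {I0 Eb} => x0 y0 [x1 y1] /= e1 e2.
  transitivity (x0 * (s0 * y1) - y0 * (s0 * x1)); first by ring.
  by move: e1 e2; rewrite !mul0r !sub0r !add0r => -> /oppr_inj ->; ring.
have t0z : t0 = 0 by exact: h J0 E'.
have t1z : t1 = 0.
  apply: (h b1 b0 _ t0) => //.
  apply: contra_neq J0; rewrite !cImM /=; case: (b0) (b1) => [x0 y0] [x1 y1] /= e.
  by apply: oppr_inj; rewrite oppr0 -e; ring.
by rewrite t0z in h0; rewrite t1z in h1; split; [exact: h0|exact: h1].
Qed.

End HopfAlgebra.

(** * The Weierstrass representation in an arbitrary chart *)

Section LocalAnalysis.
Context {R : realType}.
Variables (th : R) (D : set 'rV[R]_2) (r : 'rV[R]_2 -> 'rV[R]_3) (c : R).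
Hypotheses (th_bounds : 0 < th < pi / 2) (oD : open D) (sr : smooth_on D r) (c0 : 0 < c).
Hypothesis mean0 : forall u, D u -> patch_mean_curvature r u = 0.
Hypothesis gauss_lt0 : forall u, D u -> patch_gauss_curvature r u < 0.
Local Notation Re := complex.Re.
Local Notation Im := complex.Im.
Local Notation co := (cos th).
Local Notation si := (sin th).
Local Notation n := (patch_normal r).
Local Notation nu := (nu th).
Local Notation nullv := (nullv th).
Local Notation rev := (rev th).
Local Notation unrev := (unrev th).
Local Notation den := (den th).
Let A1 (x : 'rV[R]_3) := co * x 0 0 + si * x 0 1.
Let A2 (x : 'rV[R]_3) := co * x 0 0 - si * x 0 1.
Let P u := (1 - A1 (n u) ^+ 2) * (1 - A2 (n u) ^+ 2).
Hypothesis hP : forall u, D u -> P u != 0 -> P u ^+ 2 = c * patch_gauss_curvature r u ^+ 2.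
Implicit Types (u v : 'rV[R]_2).

Definition zeta u := zet th (n u).
Local Notation Z u := (cof (zeta u)).

Lemma P_neq0 u : D u -> P u != 0.
Proof.
have cs1 := cos2Dsin2 th.
have h1 x : dot x (vec3 co si 0) = A1 x by rewrite dot3 !vec3E /A1; ring.
have h2 x : dot x (vec3 co (- si) 0) = A2 x by rewrite dot3 !vec3E /A2; ring.
pose V1 : 'rV[R]_3 := vec3 co si 0; pose V2 : 'rV[R]_3 := vec3 co (- si) 0.
have v11 : dot V1 V1 = 1 by rewrite dot3 !vec3E -cs1; ring.
have v22 : dot V2 V2 = 1 by rewrite dot3 !vec3E -cs1; ring.
have E v : (1 - dot (n v) V1 ^+ 2) * (1 - dot (n v) V2 ^+ 2) = P v.
  by rewrite /P; move: (n v) => x; rewrite h1 h2.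
move=> Du; rewrite -E; apply: (@normal_avoids _ D r oD sr gauss_lt0 V1 V2 c v11 v22 c0 _ u Du) => v Dv.
by rewrite E; exact: hP.
Qed.

Lemma south_neq0 u : D u -> 1 + A1 (n u) != 0.
Proof.
move=> /P_neq0; apply: contra_neq => E; rewrite /P.
move: (A1 (n u)) (A2 (n u)) E => x y E.
by transitivity ((1 + x) * ((1 - x) * (1 - y ^+ 2))); [ring|rewrite E mul0r].
Qed.

Lemma nu_zeta u : D u -> nu (zeta u) = n u.
Proof.
move=> Du; apply: nu_zet; last exact: south_neq0.
exact: (patch_normal_unit gauss_lt0).
Qed.

Lemma zeta_c2 i : c2 D (fun v => zeta v 0 i).
Proof.
have cn l := patch_normal_c2 sr gauss_lt0 l.
have d1 a b : c2 D (fun v => a * n v 0 0 + b * n v 0 1).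
  by apply: c2D; apply: c2M => //; exact: c2_cst.
have dV : c2 D (fun v => (1 + (co * n v 0 0 + si * n v 0 1))^-1).
  by apply: c2V => [u /south_neq0//|]; apply: c2D (d1 _ _); exact: c2_cst.
case: (ord2P i) => ->.
  by apply: c2_fun (c2M (d1 (- si) co) dV) => v; rewrite /zeta /zet pntE; congr (_ / _); ring.
by apply: c2_fun (c2M (c2N (cn 2)) dV) => v; rewrite /zeta /zet pntE.
Qed.

Lemma dd_rev w (Y : 'rV[R]_2 -> 'rV[R]_2) u b : cdd (fun v => cof (Y v)) u b ->
  exists a, vdd (fun v => rev w (Y v)) u a.
Proof.
move=> hY; have H l : exists a, dd (fun v => rev w (Y v) 0 l) u a.
  have [n' hn] := hol_nullv th (Y u) l; have [h _] := cddZ w (hol_comp hn hY).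
  by eexists; apply: dd_near h; apply: filterE => v; rewrite mxE.
have [a0 h0] := H 0; have [a1 h1] := H 1; have [a2 h2] := H 2.
exists (fun k => vec3 (a0 k) (a1 k) (a2 k)) => l.
by case: (ord3P l) => ->; [apply: dd_ext h0 _|apply: dd_ext h1 _|apply: dd_ext h2 _] => k; rewrite vec3E.
Qed.

Lemma cdd_unrev (F : 'rV[R]_2 -> 'rV[R]_3) (Y : 'rV[R]_2 -> 'rV[R]_2) u a b :
  vdd F u a -> cdd (fun v => cof (Y v)) u b -> exists a', cdd (fun v => unrev (F v) (Y v)) u a'.
Proof.
move=> hF hY; have [a1 h1] := dd_rev 1 hY; have [ai hi] := dd_rev 'i%C hY.
have [dx dy] := hY; rewrite /= in dx dy.
have drad : dd (fun v => rad (Y v) * rad (Y v)) u _ :=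
  ddM (ddD (ddD (dd_cst 1 u) (ddM dx dx)) (ddM dy dy)) (ddD (ddD (dd_cst 1 u) (ddM dx dx)) (ddM dy dy)).
have dV := ddV (mulf_neq0 (rad_neq0 (Y u)) (rad_neq0 (Y u))) drad.
have H G g : vdd G u g -> exists a', dd (fun v => dot (F v) (G v) / rad (Y v) ^+ 2) u a'.
  move=> hG; eexists; apply: dd_near (ddM (vdd_dot hF hG) dV).
  by apply: filterE => v; rewrite expr2.
have [p hp] := H _ _ h1; have [q hq] := H _ _ hi.
by exists (fun k => p k +i* q k); split.
Qed.

Lemma cdd_quot F0 F1 G0 G1 u f0 f1 g0 g1 : normc2 (F0 u) + normc2 (F1 u) != 0 ->
  cdd F0 u f0 -> cdd F1 u f1 -> cdd G0 u g0 -> cdd G1 u g1 ->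
  exists a, cdd (fun v => quot (F0 v) (F1 v) (G0 v) (G1 v)) u a.
Proof.
move=> n0 h0 h1 k0 k1.
have conj F f : cdd F u f -> cdd (fun v => (F v)^*%C) u (fun k => (f k)^*%C).
  move=> [x y]; split; first by apply: dd_ext (dd_near _ x) _; [apply: filterE => v; case: (F v)|move=> k; case: (f k)].
  by apply: dd_ext (dd_near _ (ddN y)) _; [apply: filterE => v; case: (F v)|move=> k; case: (f k)].
have nrm F f : cdd F u f -> exists a, dd (fun v => normc2 (F v)) u a.
  by move=> [x y]; eexists; exact: ddD (ddM x x) (ddM y y).
have [a0 e0] := nrm _ _ h0; have [a1 e1] := nrm _ _ h1.
have rV : cdd (fun v => ((normc2 (F0 v) + normc2 (F1 v))^-1)%:C) u (fun k => (- (a0 k + a1 k) / (normc2 (F0 u) + normc2 (F1 u)) ^+ 2)%:C).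
  by split; [exact: ddV n0 (ddD e0 e1)|exact: dd_cst].
by eexists; exact: cddM (cddD (cddM k0 (conj _ _ h0)) (cddM k1 (conj _ _ h1))) rV.
Qed.

(** [b] is dz, and [w k] is the [rev]-coordinate of the k-th partial of the immersion. By [dd_nu]
    and the Weingarten equations the second form is 2 Re (b_i w_j), so [hopf] factors w as f b; the
    formula [quot] makes [f] differentiable. *)
Lemma weierstrass_rep : exists (b : 'I_2 -> 'rV[R]_2 -> R[i]) (f : 'rV[R]_2 -> R[i]),
  forall u, D u ->
  [/\ cdd (fun v => Z v) u (b^~ u),
      exists b' : 'I_2 -> 'I_2 -> R[i], (forall k, cdd (b k) u (b'^~ k)) /\ b' 0 1 = b' 1 0,
      forall k, pd k r u = rev (f u * b k u) (zeta u),
      Im ((b 0 u)^*%C * b 1 u) != 0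
    & [/\ f u != 0, patch_gauss_curvature r u * (rad (zeta u) ^+ 4 * normc2 (f u)) = - 4
      & exists f', cdd f u f'] ].
Proof.
have [a0 h0] := zeta_c2 0; have [a1 h1] := zeta_c2 1.
pose b k v : R[i] := a0 k v +i* a1 k v.
pose w k v := unrev (pd k r v) (zeta v).
exists b, (fun v => quot (b 0 v) (b 1 v) (w 0 v) (w 1 v)) => u Du.
have hb : cdd (fun v => Z v) u (b^~ u) by split; [exact: (h0 u Du).1|exact: (h1 u Du).1].
have [b0' [hb0 sb0]] := c2_sym oD h0 Du; have [b1' [hb1 sb1]] := c2_sym oD h1 Du.
have rw k v : D v -> pd k r v = rev (w k v) (zeta v).
  by move=> Dv; apply: rev_unrev; rewrite nu_zeta// dotC patch_normal_orth.
have hw k : exists a, cdd (w k) u a by exact: cdd_unrev (patch_vdd1 sr k Du) hb.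
have hn : vdd n u (fun k => (- 2 / rad (zeta u) ^+ 2) *: rev (b k u)^*%C (zeta u)).
  have : vdd (fun v => nu (zeta v)) u (fun k => (- 2 / rad (zeta u) ^+ 2) *: rev (b k u)^*%C (zeta u)).
    by move=> l; apply: dd_ext (dd_nu th l hb) _ => k; rewrite rowE.
  apply: vdd_near; move: (near_open oD (fun v Dv => Dv) Du); apply: (@filterS _ (nbhs u)) => v Dv.
  exact: nu_zeta.
have rd0 := rad_neq0 (zeta u).
have hh k j : second_form r u k j = 2 * Re (b k u * w j u).
  have := weingarten sr k j Du hn; rewrite (rw j u Du) dotZl dot_rev => /(congr1 -%R); rewrite opprK => <-.
  by move: (b k u) (w j u) rd0 => [x y] [p q]; move: (rad _) => d d0 /=; rewrite ?(cReM, cImM)/=; field.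
have gg i j : first_form r u i j = rad (zeta u) ^+ 2 * (Re (w i u) * Re (w j u) + Im (w i u) * Im (w j u)).
  by rewrite gE (rw i u Du) (rw j u Du) dot_rev.
have [dg dh] := patch_dets gauss_lt0 Du.
have tr := patch_trace mean0 gauss_lt0 Du.
have sym : second_form r u 0 1 = second_form r u 1 0.
  by rewrite !hE (patch_sym oD sr Du).
have KE := patch_gaussE r u.
rewrite !det22 in dg dh KE.
rewrite !hh !gg in dg dh tr sym KE.
have [w0E w1E J0 f0 Kf] := hopf dg dh sym tr.
have bn0 : normc2 (b 0 u) + normc2 (b 1 u) != 0.
  have b00 : b 0 u != 0 by apply: contra_neq J0 => ->; rewrite cImM /=; ring.
  apply: lt0r_neq0; apply: (ltr_pwDl (normc2_gt0 b00)).
  exact: addr_ge0 (sqr_ge0 _) (sqr_ge0 _).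
have hbk k : cdd (b k) u (fun m => b0' m k +i* b1' m k) by split; [exact: hb0|exact: hb1].
split.
- exact: hb.
- exists (fun m k => b0' m k +i* b1' m k); split; first exact: hbk.
  by rewrite sb0 sb1.
- by move=> k; rewrite (rw k u Du); congr (rev _ _); case: (ord2P k) => ->.
- exact: J0.
- split; first exact: f0.
    rewrite KE; move: Kf dg; move: (_ - _) (_ - _) => x y E y0.
    by apply: (mulfI y0); rewrite [RHS]mulrC -E; field.
  have [p hp] := hw 0; have [q hq] := hw 1.
  exact: cdd_quot bn0 (hbk 0) (hbk 1) hp hq.
Qed.

(** The powers of [si] and [co] come from clearing denominators in pa = - si / co and pc = co /
    si. *)
Lemma P_formula u : D u ->
  P u = 16 * si ^+ 2 * co ^+ 2 * normc2 (den (Z u)) / rad (zeta u) ^+ 4.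
Proof.
move=> Du; have r0 := rad_neq0 (zeta u); have c1 := lt0r_neq0 (co_gt0 th_bounds); have s1 := lt0r_neq0 (si_gt0 th_bounds).
rewrite /P -(nu_zeta Du); move: (zeta u) r0 => z r0.
have E1 : 1 - A1 (nu z) ^+ 2 = 4 * normc2 (cof z) / rad z ^+ 2.
  rewrite /A1 !nuE; transitivity ((rad z ^+ 2 - (co * nun th z 0 0 + si * nun th z 0 1) ^+ 2) / rad z ^+ 2); first by field.
  by congr (_ / _); rewrite !nunE /rad /normc2 /=; ring: (cs th).
have E2 : 1 - A2 (nu z) ^+ 2 = 4 * normc2 ((co%:C * cof z + si%:C) * (si%:C * cof z - co%:C)) / rad z ^+ 2.
  rewrite /A2 !nuE; transitivity ((rad z ^+ 2 - (co * nun th z 0 0 - si * nun th z 0 1) ^+ 2) / rad z ^+ 2); first by field.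
  by congr (_ / _); rewrite normc2M !nunE /rad /normc2 !(cReD, cImD, cReN, cImN, cReM, cImM) /=; ring: (cs th).
have E3 : normc2 ((co%:C * cof z + si%:C) * (si%:C * cof z - co%:C)) =
   si ^+ 2 * co ^+ 2 * normc2 ((cof z - (pa th)%:C) * (cof z - (pc th)%:C)).
  rewrite !normc2M /normc2 !(cReD, cImD, cReN, cImN, cReM, cImM) /= /pa /pc.
  by field; rewrite c1 s1.
rewrite E1 E2 E3 !denE [normc2 (cof z * _)]normc2M.
move: (normc2 (cof z)) (normc2 (_ * _)) => x y; field; exact: r0.
Qed.

Lemma den_neq0 u : D u -> den (Z u) != 0.
Proof.
move=> Du; have := P_neq0 Du; rewrite (P_formula Du); apply: contra_neq => ->.
by rewrite /normc2 /= !expr0n /= addr0 mulr0 mul0r.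
Qed.

(** Insert K = - 4 / (rad^4 |f|^2) and [P_formula] into P^2 = c K^2: the powers of [rad] cancel, and
    both sides are squares of nonnegative numbers. *)
Lemma modulus_q u (f : R[i]) : D u ->
  patch_gauss_curvature r u * (rad (zeta u) ^+ 4 * normc2 f) = - 4 ->
  normc2 (f * den (Z u)) = Num.sqrt c / (4 * si ^+ 2 * co ^+ 2).
Proof.
move=> Du KE; have r0 := rad_neq0 (zeta u); have c1 := lt0r_neq0 (co_gt0 th_bounds); have s1 := lt0r_neq0 (si_gt0 th_bounds).
have := hP Du (P_neq0 Du); rewrite (P_formula Du) normc2M.
have nf : 0 <= normc2 f by rewrite addr_ge0 ?sqr_ge0.
have nd : 0 <= normc2 (den (Z u)) by rewrite addr_ge0 ?sqr_ge0.
move: KE r0 nf nd; move: (patch_gauss_curvature r u) (rad (zeta u)) (normc2 f) (normc2 (den (Z u))) => K rd x y KE r0 x0 y0 E.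
have scE : 0 <= 16 * si ^+ 2 * co ^+ 2 * (x * y).
  by apply: mulr_ge0 (mulr_ge0 x0 y0); apply: mulr_ge0 (sqr_ge0 _); apply: mulr_ge0 (sqr_ge0 _).
have H : (16 * si ^+ 2 * co ^+ 2 * (x * y)) ^+ 2 = (4 * Num.sqrt c) ^+ 2.
  rewrite [RHS]exprMn sqr_sqrtr ?(ltW c0)//.
  transitivity ((16 * si ^+ 2 * co ^+ 2 * y / rd ^+ 4) ^+ 2 * rd ^+ 8 * x ^+ 2); first by field.
  rewrite E; transitivity (c * (K * (rd ^+ 4 * x)) ^+ 2); first by ring.
  by rewrite KE; ring.
have /eqP : 16 * si ^+ 2 * co ^+ 2 * (x * y) = 4 * Num.sqrt c.
  by apply/eqP; rewrite -(@eqrXn2 _ 2)//; first exact/eqP.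
move: (Num.sqrt c) => sc /eqP E'.
apply: (mulfI (_ : 16 * si ^+ 2 * co ^+ 2 != 0)); first by rewrite !mulf_neq0 ?expf_neq0// pnatr_eq0.
by rewrite E'; field; rewrite s1 c1.
Qed.

Lemma sub_swap (x y z t : R) : x - z = y - t -> x - y = z - t.
Proof. by move=> /(congr1 (fun w => w + z - y)); rewrite subrK => ->; ring. Qed.

Lemma polar (z : R[i]) : normc2 z = 1 -> exists2 t : R, 0 <= t <= 2 * pi & z = expi t.
Proof.
case: z => x y; rewrite /normc2 /= => xy; have p0 := pi_ge0 R.
have x1 : -1 <= x <= 1.
  by rewrite -ler_norml -(@ler_pXn2r _ 2)// ?nnegrE// real_normK ?num_real// expr1n -xy lerDl sqr_ge0.
have a0 := acos_ge0 x1; have ap := acos_lepi x1.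
have cx : cos (acos x) = x by apply: acosK; rewrite in_itv.
have sx : sin (acos x) = `|y| by rewrite sin_acos// -xy addrAC subrr add0r sqrtr_sqr.
have [y0|y0] := leP 0 y.
  by exists (acos x); [apply/andP; split; lra|rewrite /expi cx sx ger0_norm].
exists (2 * pi - acos x); first by apply/andP; split; lra.
have E : 2 * pi - acos x = - acos x + pi *+ 2 by rewrite mulr2n; ring.
by rewrite /expi E cosD2pi sinD2pi cosN sinN cx sx ltr0_norm// opprK.
Qed.

Lemma kappa_surjective (q : R[i]) : q != 0 ->
  exists rho Th, [/\ 0 < rho, 0 <= Th <= 2 * pi & kappa th rho Th = q].
Proof.
move=> q0; have c1 := co_gt0 th_bounds; have s1 := si_gt0 th_bounds.
have m0 := modc_gt0 q0; have mE := modc_sq q; have m1 : (modc q)%:C != 0 :> R[i].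
  by rewrite eq_complex /= eqxx andbT gt_eqF.
have [|t tb tE] := @polar (q / (modc q)%:C).
  rewrite normc2M normc2V {1}/normc2 -mE /normc2 /= expr0n addr0 mulfV// sqrf_eq0 gt_eqF//.
exists (8 * si * co * modc q), t; split=> //; first by rewrite !mulr_gt0.
rewrite /kappa -tE (_ : 8 * si * co * modc q / (8 * si * co) = modc q); last by field; rewrite !gt_eqF.
by rewrite mulrCA mulfV// mulr1.
Qed.

Lemma zeta_open_embedding u : D u -> exists2 d, 0 < d & ball u d `<=` D /\ open_embedding (ball u d) zeta.
Proof.
move=> Du; have [b [f H]] := weierstrass_rep; have [_ _ _ J0 _] := H u Du.
have hb v : D v -> cdd (fun w => cof (zeta w)) v (b^~ v) by move=> /H[].
have pdE i k : \forall v \near u, (if i == 0 then Re (b k v) else Im (b k v)) = pd k (fun w => zeta w 0 i) v.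
  apply: near_open Du => // v /hb[[_ e0] [_ e1]].
  by case: (ord2P i) => ->; rewrite /= ?e0 ?e1.
apply: local_diffeo => //.
- by move=> v /hb[[d0 _] [d1 _]] i; case: (ord2P i) => ->.
- move=> i k; change {for u, continuous (pd k (fun w => zeta w 0 i))}; refine (continuous_near (pdE i k) _).
  have [b' [hb' _]] : exists b' : 'I_2 -> 'I_2 -> R[i], (forall k, cdd (b k) u (b'^~ k)) /\ b' 0 1 = b' 1 0.
    by have [] := H u Du.
  have [h1 h2] := hb' k.
  by case: (ord2P i) => -> /=; [exact: dd_cont h1|exact: dd_cont h2].
have [[_ e0] [_ e1]] := hb u Du.
move: (e0 0) (e0 1) (e1 0) (e1 1) => /= -> -> -> ->; apply: contra_neq J0 => E.
rewrite cImM -[RHS]E; case: (b 0 u) (b 1 u) => [x0 y0] [x1 y1] /=; ring.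
Qed.

(** In the equality of the mixed partials of the immersion the terms with derivatives of [nullv] and
    of [b] are symmetric and cancel; what is left is [rev (f' 0 * b1 - f' 1 * b0) = 0], and [rev] is
    injective. The conclusion says that [f] is holomorphic in z. *)
Lemma closed_coef b0 b1 u (b : 'I_2 -> 'rV[R]_2 -> R[i]) (f : 'rV[R]_2 -> R[i])
    (b' : 'I_2 -> 'I_2 -> R[i]) (f' : 'I_2 -> R[i]) : D u ->
  b 0 u = b0 -> b 1 u = b1 ->
  (forall k v, D v -> pd k r v = rev (f v * b k v) (zeta v)) ->
  cdd (fun v => Z v) u (b^~ u) -> (forall k, cdd (b k) u (b'^~ k)) -> b' 0 1 = b' 1 0 ->
  cdd f u f' -> f' 0 * b1 = f' 1 * b0.
Proof.
move=> Du E0 E1 rE hZ hb sb hf; apply/eqP; rewrite -subr_eq0; apply/eqP.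
apply: (@rev_eq0 _ th _ (zeta u)); apply/rowP => l; rewrite !mxE.
have [n' hn] := hol_nullv th (zeta u) l; have hN := hol_comp hn hZ.
have H m k : pd m (pd k r) u 0 l = Re ((f' m * b k u + f u * b' m k) * nullv (Z u) l + f u * b k u * (n' * b m u)).
  have [h _] := cddM (cddM hf (hb k)) hN.
  have h2 : dd (fun v => pd k r v 0 l) u (fun m => Re ((f' m * b k u + f u * b' m k) * nullv (Z u) l + f u * b k u * (n' * b m u))).
    apply: dd_near h; move: (near_open oD (fun v Dv => Dv) Du); apply: (@filterS _ (nbhs u)) => v Dv.
    by rewrite rE// mxE.
  have [_ e1] := patch_vdd1 sr k Du l; have [_ e2] := h2.
  exact: etrans (esym (e1 m)) (e2 m).
have S := etrans (esym (H 0 1)) (etrans (congr1 (fun x : 'rV[R]_3 => x 0 l) (patch_sym oD sr Du)) (H 1 0)).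
rewrite E0 E1 sb in S.
have := esym (congr1 (fun x => x - Re ((f' 1 * b0 + f u * b' 1 0) * nullv (Z u) l + f u * b0 * (n' * b1))) S).
rewrite subrr -cReN -cReD => ->; congr Re; ring.
Qed.

Lemma hol_den u : exists d', hol (fun v => den (cof v)) u d'.
Proof.
have hz := hol_id u.
eexists; exact: holM hz (holM (holB hz (hol_cst (pa th)%:C u)) (holB hz (hol_cst (pc th)%:C u))).
Qed.

Lemma weierstrass_coef : exists (b : 'I_2 -> 'rV[R]_2 -> R[i]) (f : 'rV[R]_2 -> R[i]),
  forall u, D u ->
  [/\ cdd (fun v => Z v) u (b^~ u), forall k, pd k r u = rev (f u * b k u) (zeta u),
      f u != 0 & cdd (fun v => f v * den (Z v)) u (fun=> 0)].
Proof.
have [b [f H]] := weierstrass_rep; exists b, f => u Du.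
have [hZ [b' [hb sb]] rE J0 [f0 KE [f' hf]]] := H u Du; split=> //.
have rE' k v : D v -> pd k r v = rev (f v * b k v) (zeta v) by move=> /H[].
have E := closed_coef Du erefl erefl rE' hZ hb sb hf.
have [d' hd] := hol_den (zeta u); pose q v := f v * den (Z v); pose q' k := f' k * den (Z u) + f u * (d' * b k u).
have hq : cdd q u q' := cddM hf (hol_comp hd hZ).
have q0 : q u != 0 by rewrite /q mulf_neq0// den_neq0.
have [hqr hqi] := hq; have q'E k : q' k = f' k * den (Z u) + f u * (d' * b k u) by [].
(* By [modulus_q] the modulus of [q] is the same at all points of [D]. *)
have nq : dd (fun v => normc2 (q v)) u (fun=> 0).
  apply: (dd_near _ (dd_cst (normc2 (q u)) u)).
  move: (near_open oD (fun v Dv => Dv) Du); apply: (@filterS _ (nbhs u)) => v Dv.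
  have [_ _ _ _ [_ KE' _]] := H v Dv.
  exact: etrans (modulus_q Du KE) (esym (modulus_q Dv KE')).
clearbody q'; have nq' := ddD (ddM hqr hqr) (ddM hqi hqi).
have re0 k : Re ((q u)^*%C * q' k) = 0.
  have [_ /(_ k) e1] := nq; have [_ /(_ k) e2] := nq'.
  have := etrans (esym e2) e1; rewrite cReM; case: (q u) (q' k) => x y [x' y'] /= e.
  apply: (mulfI (_ : 2 != 0)); first by rewrite pnatr_eq0.
  by rewrite mulr0 -e; ring.
have [|z0 z1] := unit_modulus_derivative q0 J0 _ (re0 0) (re0 1).
  by rewrite !q'E !mulrDl mulrAC E mulrAC; congr (_ + _); ring.
by apply: cdd_ext hq _ => k; case: (ord2P k) => ->.
Qed.

(** On a small ball f den equals its value [kappa] at the centre, so the immersion and the Scherk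
    immersion composed with [zeta] have equal partials; both facts are integrated along segments.
    The chart [i] is arbitrary because the Scherk immersion has the same partials in all charts. *)
Lemma patch_scherk u : D u -> exists rho Th, [/\ 0 < rho, 0 <= Th <= 2 * pi
  & forall i, scherk_dom th i (zeta u) -> \forall v \near u,
    r v - r u = @scherk_immersion R th rho Th (scherk_par th i (zeta v)) - scherk_immersion rho Th (scherk_par th i (zeta u))].
Proof.
move=> Du; have [b [f H]] := weierstrass_coef.
have [_ _ f0 _] := H u Du.
have [rho [Th [rho0 Thb kE]]] := kappa_surjective (mulf_neq0 f0 (den_neq0 Du)).
exists rho, Th; split=> // i zi.
have hZ v : D v -> cdd (fun w => Z w) v (b^~ v) by move=> /H[].
have cz : {for u, continuous zeta}.
  have [hx hy] := hZ u Du.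
  by apply: continuous_rV2 => k; case: (ord2P k) => ->; [exact: dd_cont hx|exact: dd_cont hy].
have nd : \forall v \near u, scherk_dom th i (zeta v).
  apply: cz; apply: open_nbhs_nbhs; split; last exact: zi.
  by have [] := scherk_embedding th_bounds i.
have [d d0 dD] := near_ball (near_and (near_open oD (fun v Dv => Dv) Du) nd).
have ud : ball u d u by exact: ballxx.
have qE w : ball u d w -> f w * den (Z w) = kappa th rho Th.
  move=> wd; rewrite kE; apply: eq_complexP;
    apply: (zero_pd_segment (f := fun v => _ (f v * den (Z v)))) => t t01;
    have [Dt _] := dD _ (ball_segment ud wd t01); have [_ _ _ [h1 h2]] := H _ Dt;
    by [exact: h1|exact: h2].
have : \forall v \near u, ball u d v by exact: nbhsx_ballx.
apply: (@filterS _ (nbhs u)) => v vd.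
suff E l : r v 0 l - (scherk_immersion rho Th (scherk_par th i (zeta v))) 0 l = r u 0 l - (scherk_immersion rho Th (scherk_par th i (zeta u))) 0 l.
  apply/rowP => l; rewrite !row_addE !row_oppE; exact: sub_swap (E l).
apply: (zero_pd_segment (f := fun v => r v 0 l - (scherk_immersion rho Th (scherk_par th i (zeta v))) 0 l)) => t t01.
have wd := ball_segment ud vd t01; have [Dw sw] := dD _ wd.
move: (u + _) wd Dw sw => w wd Dw sw.
have [hZw rE _ _] := H w Dw; have [hx hy] := hZw.
have hI : dd (fun z => (scherk_immersion rho Th \o scherk_par th i) z 0 l) (zeta w)
    (fun k => rev (coef_f th rho Th (zeta w) * dir k) (zeta w) 0 l).
  have hv := (vdd_pd _ _).1 (scherk_diff rho Th th_bounds sw).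
  by apply: dd_ext (hv l) _ => k; rewrite (scherk_pd rho Th th_bounds k sw).
have hIZ := dd_comp2 hI (b := fun j k => if j == 0 then Re (b k w) else Im (b k w)).
have {}hIZ := hIZ (fun j => _).
apply: dd_ext (ddB (patch_vdd sr Dw l) (hIZ _)) _.
  by move=> j; case: (ord2P j) => ->; [exact: hx|exact: hy].
move=> k; rewrite rE /coef_f -(qE w wd) mulfK ?den_neq0//=.
rewrite !mxE; case: (b k w) => x y; rewrite /dir /= !(cReM, cImM) /=; ring.
Qed.

End LocalAnalysis.

(** * Adapted frames *)

Section Frame.
Context {R : realType}.
Implicit Types (x y : 'rV[R]_3) (r : 'rV[R]_2 -> 'rV[R]_3).

Lemma cross_cross x y : cross y (cross x y) = dot y y *: x - dot x y *: y.
Proof. by apply: row3P; rewrite !rowE !crossE !dot3; ring. Qed.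

Lemma cross_cross' x y : cross (cross x y) x = dot x x *: y - dot x y *: x.
Proof. by apply: row3P; rewrite !rowE !crossE !dot3; ring. Qed.

Lemma dot_cross_cross x y z w :
  dot (cross x y) (cross z w) = dot x z * dot y w - dot x w * dot y z.
Proof. by rewrite !dot3 !crossE; ring. Qed.

Variables e1 e2 : 'rV[R]_3.
Hypotheses (e11 : dot e1 e1 = 1) (e22 : dot e2 e2 = 1) (e12 : dot e1 e2 = 0).
Let e3 := cross e1 e2.

(** With [cross e1 e2] as third axis this is a rotation, so cross products, and hence normals, are
    preserved as well as lengths. *)
Definition frame x : 'rV[R]_3 := vec3 (dot x e1) (dot x e2) (dot x e3).

Lemma frame_e23 : cross e2 e3 = e1.
Proof. by rewrite /e3 cross_cross e22 e12 scale1r scale0r subr0. Qed.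

Lemma frame_e31 : cross e3 e1 = e2.
Proof. by rewrite /e3 cross_cross' e11 e12 scale1r scale0r subr0. Qed.

Lemma frameD x y : frame (x + y) = frame x + frame y.
Proof. by apply: row3P; rewrite rowE !vec3E dotDl. Qed.

Lemma frameZ (k : R) x : frame (k *: x) = k *: frame x.
Proof. by apply: row3P; rewrite rowE !vec3E dotZl. Qed.

Lemma frameB x y : frame (x - y) = frame x - frame y.
Proof. by rewrite frameD -scaleN1r frameZ scaleN1r. Qed.

Lemma frame_cross x y : cross (frame x) (frame y) = frame (cross x y).
Proof.
apply: row3P; rewrite !crossE !vec3E.
- transitivity (dot (cross x y) (cross e2 e3)); last by rewrite frame_e23.
  by rewrite dot_cross_cross; ring.
- transitivity (dot (cross x y) (cross e3 e1)); last by rewrite frame_e31.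
  by rewrite dot_cross_cross; ring.
- by rewrite [in RHS]dot_cross_cross; ring.
Qed.

Lemma dot_frame x y : dot (frame x) (frame y) = dot x y.
Proof.
have e33 : dot e3 e3 = 1 by rewrite /e3 dot_cross_cross e11 e22 e12 !mul0r subr0 mulr1.
have e13 : dot e1 e3 = 0 by rewrite dot3 /e3 !crossE; ring.
have e23 : dot e2 e3 = 0 by rewrite dot3 /e3 !crossE; ring.
pose M : 'M[R]_3 := \matrix_(i, j) (if i == 0 then e1 0 j else if i == 1 then e2 0 j else e3 0 j).
have fM z : frame z = z *m M^T.
  by apply: row3P; rewrite vec3E dot3 [RHS]mxE sum3 ![M^T _ _]mxE ![M _ _]mxE.
have dM (z w : 'rV[R]_3) : dot z w = (z *m w^T) 0 0.
  by rewrite /dot mxE; apply: eq_bigr => k _; rewrite mxE.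
have MM : M *m M^T = 1%:M.
  apply/matrixP => i j; rewrite !mxE sum3 ![M^T _ _]mxE ![M _ _]mxE.
  have d21 := dotC e2 e1; have d31 := dotC e3 e1; have d32 := dotC e3 e2.
  rewrite e12 e13 e23 in d21 d31 d32.
  move: e11 e22 e33 e12 e13 e23 d21 d31 d32; rewrite !dot3 => *.
  by case: (ord3P i) => ->; case: (ord3P j) => ->.
(* Orthonormal rows of a square matrix give orthonormal columns. *)
by rewrite !dM !fM trmx_mul trmxK -mulmxA (mulmxA M^T) (mulmx1C MM) mul1mx.
Qed.

Lemma enorm_frame x : enorm (frame x) = enorm x.
Proof. by rewrite /enorm dot_frame. Qed.

Lemma frame_isometry (a : 'rV[R]_3) : Defs.isometry (fun x => frame x + a).
Proof.
by move=> x y; rewrite opprD addrACA subrr addr0 -frameB enorm_frame.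
Qed.

Lemma vdd_frame F u a : vdd F u a -> vdd (fun v => frame (F v)) u (fun k => frame (a k)).
Proof.
move=> hF l; have H e : dd (fun v => dot (F v) e) u (fun k => dot (a k) e).
  apply: dd_ext (vdd_dot hF (vdd_cst e u)) _ => k.
  by rewrite [X in _ + X](_ : _ = 0) ?addr0// dot3 !mxE !mulr0 !addr0.
case: (ord3P l) => ->; [apply: dd_ext (dd_near _ (H e1)) _|apply: dd_ext (dd_near _ (H e2)) _|
  apply: dd_ext (dd_near _ (H e3)) _]; by [apply: filterE => v; rewrite vec3E|move=> k; rewrite vec3E].
Qed.

Variables (D : set 'rV[R]_2) (r : 'rV[R]_2 -> 'rV[R]_3).
Hypotheses (oD : open D) (sr : smooth_on D r).

Lemma frame_iterated s u : D u ->
  foldr (fun k g => pd k g) (frame \o r) s u = frame (foldr (fun k g => pd k g) r s u).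
Proof.
elim: s u => [//|k s IH] u Du /=.
suff H : vdd (foldr (fun k g => pd k g) (frame \o r) s) u (fun k => frame (pd k (foldr (fun k g => pd k g) r s) u)).
  exact: (vddE H k).
have := vdd_frame ((vdd_pd _ _).1 (sr s Du)); apply: vdd_near.
move: (near_open oD (fun v Dv => Dv) Du); apply: (@filterS _ (nbhs u)) => v Dv.
exact: esym (IH v Dv).
Qed.

Lemma frame_smooth : smooth_on D (frame \o r).
Proof.
move=> s u Du; have := vdd_frame ((vdd_pd _ _).1 (sr s Du)) => H.
apply: (@vdd_diff _ _ _ (fun k => frame (pd k (foldr (fun k g => pd k g) r s) u))).
apply: vdd_near H; move: (near_open oD (fun v Dv => Dv) Du); apply: (@filterS _ (nbhs u)) => v Dv.
exact: esym (frame_iterated s Dv).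
Qed.

Lemma frame_pd k u : D u -> pd k (frame \o r) u = frame (pd k r u).
Proof. exact: (frame_iterated [:: k]). Qed.

Lemma frame_pd2 i j u : D u -> pd i (pd j (frame \o r)) u = frame (pd i (pd j r) u).
Proof. exact: (frame_iterated [:: i; j]). Qed.

Lemma frame_normal u : D u -> patch_normal (frame \o r) u = frame (patch_normal r u).
Proof.
by move=> Du; rewrite /patch_normal !frame_pd// frame_cross enorm_frame frameZ.
Qed.

Lemma frame_shape u : D u -> shape_operator (frame \o r) u = shape_operator r u.
Proof.
move=> Du; have h : second_form (frame \o r) u = second_form r u.
  apply/matrixP => i j; rewrite [LHS]mxE [RHS]mxE.
  by rewrite (frame_pd2 i j Du) (frame_normal Du) dot_frame.
have g : first_form (frame \o r) u = first_form r u.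
  apply/matrixP => i j; rewrite [LHS]mxE [RHS]mxE.
  by rewrite (frame_pd i Du) (frame_pd j Du) dot_frame.
by rewrite /shape_operator h g.
Qed.

End Frame.

Section AdaptedFrame.
Context {R : realType}.
Variables V1 V2 : 'rV[R]_3.
Hypotheses (hV1 : enorm V1 = 1) (hV2 : enorm V2 = 1) (hV12 : V1 != V2) (hV12' : V1 != - V2).

Lemma dot_add (x y : 'rV[R]_3) : dot (x + y) (x + y) = dot x x + dot y y + 2 * dot x y.
Proof. by rewrite !dot3 !rowE; ring. Qed.

Lemma acos_pihalf (x : R) : 0 < x < 1 -> 0 < acos x < pi / 2.
Proof.
move=> /andP[x0 x1]; have xb : -1 <= x <= 1 by apply/andP; split; lra.
have cx : cos (acos x) = x by apply: acosK; rewrite in_itv.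
rewrite acos_gt0 /=; last by apply/andP; split; lra.
rewrite ltNge; apply: contraTN x0 => h; rewrite -leNgt -cx.
have ap := acos_lepi xb; have p0 := pi_gt0 R.
rewrite (_ : acos x = (acos x - pi / 2) + pi / 2); last by ring.
by rewrite cosDpihalf oppr_le0 sin_ge0_pi//; apply/andP; split; lra.
Qed.

(* [V1] and [V2] make the angle [2 * th], bisected by [e1]. *)
Lemma adapted_frame : exists (th : R) (e1 e2 : 'rV[R]_3),
  [/\ 0 < th < pi / 2, [/\ dot e1 e1 = 1, dot e2 e2 = 1 & dot e1 e2 = 0],
      V1 = cos th *: e1 + sin th *: e2 & V2 = cos th *: e1 - sin th *: e2].
Proof.
have v1 := (enorm1 V1).1 hV1; have v2 := (enorm1 V2).1 hV2.
have [d dE] : exists d, d = dot V1 V2 by eexists.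
have dm : dot (V1 - V2) (V1 - V2) = 2 - 2 * d by rewrite dot_sub v1 v2 -dE; ring.
have dp : dot (V1 + V2) (V1 + V2) = 2 + 2 * d by rewrite dot_add v1 v2 -dE; ring.
have d1 : 0 < 2 - 2 * d by rewrite -dm lt0r dot_ge0 andbT dot_eq0 subr_eq0.
have d2 : 0 < 2 + 2 * d by rewrite -dp lt0r dot_ge0 andbT dot_eq0 addr_eq0.
(* Half-angle formulas: the cosine and sine of half the angle whose cosine is [d]. *)
pose a := Num.sqrt (2 + 2 * d) / 2; pose b := Num.sqrt (2 - 2 * d) / 2.
have a2 : a ^+ 2 = (1 + d) / 2 by rewrite /a exprMn sqr_sqrtr ?ltW//; field.
have b2 : b ^+ 2 = (1 - d) / 2 by rewrite /b exprMn sqr_sqrtr ?ltW//; field.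
have a0 : 0 < a by rewrite divr_gt0// sqrtr_gt0.
have b0 : 0 < b by rewrite divr_gt0// sqrtr_gt0.
have a1 : a < 1.
  rewrite -(@ltr_pXn2r _ 2)// ?nnegrE ?(ltW a0)// a2 expr1n; lra.
have ab : -1 <= a <= 1 by apply/andP; split; lra.
have co : cos (acos a) = a by apply: acosK; rewrite in_itv.
have si : sin (acos a) = b.
  rewrite sin_acos// a2 (_ : 1 - _ = b ^+ 2); last by rewrite b2; field.
  by rewrite sqrtr_sqr ger0_norm ?ltW.
have an := lt0r_neq0 a0; have bn := lt0r_neq0 b0.
exists (acos a), ((2 * a)^-1 *: (V1 + V2)), ((2 * b)^-1 *: (V1 - V2)); rewrite co si.
clearbody a b; split.
- by apply: acos_pihalf; rewrite a0.
- split.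
  + rewrite dotZl dotC dotZl dp (_ : 2 + 2 * d = 4 * a ^+ 2); last by rewrite a2; field.
    by field.
  + rewrite dotZl dotC dotZl dm (_ : 2 - 2 * d = 4 * b ^+ 2); last by rewrite b2; field.
    by field.
  + rewrite dotZl dotC dotZl [dot _ _](_ : _ = 0) ?mulr0//.
    by rewrite dotC; move: v1 v2; rewrite !dot3 !rowE => v1 v2; rewrite -[RHS](subrr 1) -{1}v1 -v2; ring.
- by apply: row3P; rewrite !rowE; field; apply/andP.
- by apply: row3P; rewrite !rowE; field; apply/andP.
Qed.

End AdaptedFrame.

(** * The given surface *)

(** For a parametrization [f] and its Gauss coordinate [h], this carries the embedding property from
    the chart to the surface. *)
Lemma open_embedding_cancel (X Y Z : topologicalType) (B : set X) (f : X -> Y) (g : Y -> Z) (h : X -> Z) :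
  open_embedding B f -> open_embedding B h -> (forall x, B x -> g (f x) = h x) ->
  open_embedding (f @` B) g.
Proof.
move=> ef [oB ih ch oh] gf; have [_ _ cf of_f] := ef; split.
- by apply: of_f.
- move=> _ _ /set_mem[x Bx <-] /set_mem[y By <-]; rewrite !gf// => /ih -> //; exact: mem_set.
- move=> _ [x Bx <-]; apply: (continuous_open_embedding ef Bx).
  refine (continuous_near _ (ch x Bx)).
  by move: (open_nbhs_nbhs (conj oB Bx)); apply: (@filterS _ (nbhs x)) => y By /=; rewrite gf.
- move=> W WB oW.
  have -> : g @` W = h @` (B `&` f @^-1` W).
    apply/seteqP; split=> [_ [y Wy <-]|_ [x [Bx Wx] <-]]; last by exists (f x); rewrite ?gf.
    by have [x Bx fx] := WB y Wy; exists x; [split=> //; rewrite /= fx|rewrite -gf// fx].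
  apply: oh => [x []//|]; rewrite openE => x [Bx Wx].
  have : nbhs x (f @^-1` W) by apply: (cf x Bx); exact: open_nbhs_nbhs.
  by move: (open_nbhs_nbhs (conj oB Bx)) => h1 h2; exact: filterI.
Qed.

Lemma near_embedding (X Y : topologicalType) (B : set X) (f : X -> Y) x (P : Y -> Prop) :
  open_embedding B f -> B x -> (\forall y \near x, P (f y)) -> \forall y \near f x, P y.
Proof.
move=> [oB _ _ opf] Bx H; have : nbhs x (B `&` f @^-1` P).
  by apply: filterI; [exact: open_nbhs_nbhs|exact: H].
rewrite nbhsE => -[W [oW Wx] WB]; have : nbhs (f x) (f @` W).
  by apply: open_nbhs_nbhs; split; [apply: opf => // y /WB[]|exists x].
by apply: (@filterS _ (nbhs (f x))) => _ [y /WB[_ ?] <-].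
Qed.

Lemma sub_eq_add (V : zmodType) (x y x' y' : V) : x - y = x' - y' -> x = x' + (y - y').
Proof. by move=> /eqP; rewrite subr_eq => /eqP ->; rewrite addrAC addrA. Qed.

Lemma sub_rebase (V : zmodType) (x y z x' y' z' : V) :
  x - z = x' - z' -> y - z = y' - z' -> x - y = x' - y'.
Proof.
have E (a b d : V) : a - b = (a - d) - (b - d) by rewrite opprB addrA subrK.
by move=> h1 h2; rewrite (E x y z) (E x' y' z') h1 h2.
Qed.

Section SurfaceAnalysis.
Context {R : realType}.
Variables (S : surface R) (K : S -> R) (V1 V2 : 'rV[R]_3).
Hypotheses (hmin : minimal S) (hK : is_gauss_curvature K) (hKneg : forall p, K p < 0).
Hypotheses (V11 : dot V1 V1 = 1) (V22 : dot V2 V2 = 1).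
Variable c : R.
Hypothesis hc : forall p : S,
  (forall V, V \in [:: V1; - V1; V2; - V2] -> 0 < 1 - dot (normal p) V) ->
  chern_ricci K [:: V1; - V1; V2; - V2] p = c.

Lemma normal_unit (p : S) : dot (normal p) (normal p) = 1.
Proof.
have [i [u du <-]] := par_cover p; rewrite Defs.normalE//.
by apply: (patch_normal_unit (D := dom i)) => // v dv; rewrite -hK.
Qed.

Lemma lt1_dot (x V : 'rV[R]_3) : dot x x = 1 -> dot V V = 1 -> 1 - dot x V ^+ 2 != 0 ->
  0 < 1 - dot x V /\ 0 < 1 + dot x V.
Proof.
move=> xx VV; rewrite (_ : 1 - _ ^+ 2 = (1 - dot x V) * (1 + dot x V)); last by ring.
rewrite mulf_eq0 negb_or => /andP[h1 h2].
have := dot_ge0 (x - V); have := dot_ge0 (x + V); rewrite dot_sub dot_add xx VV => g1 g2.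
by split; rewrite lt0r ?h1 ?h2 /=; move: g1 g2; move: (dot x V) => d; lra.
Qed.

(** For unit vectors [P != 0] means that all four quantities 1 - <n,V> are positive; there the
    exponential of the sum of logarithms is P^2 / K^2. *)
Lemma curvature_relation (p : S) :
  let P := (1 - dot (normal p) V1 ^+ 2) * (1 - dot (normal p) V2 ^+ 2) in
  P != 0 -> P ^+ 2 = expR c * K p ^+ 2.
Proof.
move=> P; rewrite /P mulf_eq0 negb_or => /andP[h1 h2].
have nn := normal_unit p.
have [a0 a0'] := lt1_dot nn V11 h1; have [b0 b0'] := lt1_dot nn V22 h2.
have k0 : 0 < - K p by rewrite oppr_gt0.
have s0 : 0 < Num.sqrt (- K p) by rewrite sqrtr_gt0.
have ss : Num.sqrt (- K p) ^+ 2 = - K p by rewrite sqr_sqrtr// ltW.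
rewrite -(@hc p); last first.
  by move=> V; rewrite !inE => /or4P[] /eqP ->; rewrite ?dotNr ?opprK.
rewrite /chern_ricci !big_cons big_nil !dotNr !opprK addr0 !expRD.
move: a0 a0' b0 b0' s0 ss; move: (dot _ V1) (dot _ V2) (Num.sqrt _) => a b s a0 a0' b0 b0' s0 ss.
rewrite !lnK ?posrE ?divr_gt0 ?exprn_gt0//.
rewrite -[K p]opprK -ss sqrrN; field; exact: lt0r_neq0.
Qed.

Variables (th : R) (e1 e2 : 'rV[R]_3).
Hypotheses (th_bounds : 0 < th < pi / 2).
Hypotheses (e11 : dot e1 e1 = 1) (e22 : dot e2 e2 = 1) (e12 : dot e1 e2 = 0).
Hypotheses (V1E : V1 = cos th *: e1 + sin th *: e2) (V2E : V2 = cos th *: e1 - sin th *: e2).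
Local Notation A := (frame e1 e2).
Local Notation off_punctures := (off_punctures (pa th) 0 (pc th)).

Definition gauss_coord (p : S) : 'rV[R]_2 := zet th (A (normal p)).

Let rf (i : chart S) := A \o (@immersion R S \o par i).

Lemma dom_open (i : chart S) : open (dom i).
Proof. by have [] := par_embedding i. Qed.

Lemma rf_smooth i : smooth_on (dom i) (rf i).
Proof. apply: frame_smooth; [exact: dom_open|exact: immersion_smooth]. Qed.

Lemma rf_normal i u : dom i u -> patch_normal (rf i) u = A (normal (par i u)).
Proof.
move=> du; rewrite Defs.normalE//.
exact: (frame_normal e11 e22 e12 (@dom_open i) (@immersion_smooth _ _ i) du).
Qed.

Lemma rf_shape i u : dom i u -> shape_operator (rf i) u = shape_operator (@immersion R S \o par i) u.
Proof.
exact: (frame_shape e11 e22 e12 (@dom_open i) (@immersion_smooth _ _ i)).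
Qed.

Lemma rf_mean i u : dom i u -> patch_mean_curvature (rf i) u = 0.
Proof.
by move=> du; have := hmin du; rewrite /patch_mean_curvature (rf_shape du).
Qed.

Lemma rf_gauss i u : dom i u -> patch_gauss_curvature (rf i) u = K (par i u).
Proof.
by move=> du; rewrite (hK du) /patch_gauss_curvature (rf_shape du).
Qed.

Lemma rf_gauss_lt0 i u : dom i u -> patch_gauss_curvature (rf i) u < 0.
Proof. by move=> du; rewrite rf_gauss. Qed.

Lemma rf_relation i u : dom i u ->
  let n := patch_normal (rf i) u in
  let P := (1 - (cos th * n 0 0 + sin th * n 0 1) ^+ 2) * (1 - (cos th * n 0 0 - sin th * n 0 1) ^+ 2) in
  P != 0 -> P ^+ 2 = expR c * patch_gauss_curvature (rf i) u ^+ 2.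
Proof.
move=> du n; rewrite /n rf_normal// rf_gauss// !vec3E.
have := @curvature_relation (par i u); move: (normal _) (K _) => m k.
rewrite [dot m V1](_ : _ = cos th * dot m e1 + sin th * dot m e2); last by rewrite V1E !dot3 !rowE; ring.
by rewrite [dot m V2](_ : _ = cos th * dot m e1 - sin th * dot m e2); last by rewrite V2E !dot3 !rowE; ring.
Qed.

Lemma gauss_coord_par i u : dom i u -> gauss_coord (par i u) = zeta th (rf i) u.
Proof. by move=> du; rewrite /gauss_coord /zeta rf_normal. Qed.

Lemma gauss_coord_off p : off_punctures (gauss_coord p).
Proof.
have [i [u du <-]] := par_cover p; rewrite gauss_coord_par//; apply: den_off.
exact: (den_neq0 th_bounds (@dom_open i) (@rf_smooth i) (expR_gt0 c) (@rf_gauss_lt0 i) (@rf_relation i) du).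
Qed.

(** Connectedness of [N] is what keeps a local lift within one component of the fibre product. *)
Lemma gauss_coord_embedding p (W : set S) : open W -> W p -> exists N,
  [/\ N p, N `<=` W, connected N & open_embedding N gauss_coord].
Proof.
have [i [u du <-]] := par_cover p => oW Wp.
have [d d0 [dD ed]] := zeta_open_embedding (@dom_open i) (@rf_smooth i) (expR_gt0 c)
  (@rf_mean i) (@rf_gauss_lt0 i) (@rf_relation i) du.
have [_ _ cp _] := par_embedding i.
have nW : \forall v \near u, W (par i v) by apply: (cp u du); exact: open_nbhs_nbhs.
have [d' d'0 dW] := near_ball nW.
have [d'' [d''0 dd' dd'']] : exists d'', [/\ 0 < d'', d'' <= d & d'' <= d'].
  by exists (Num.min d d'); split; rewrite ?lt_min ?d0// ge_min lexx ?orbT.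
have bd : ball u d'' `<=` ball u d by exact: le_ball.
have ob : open (ball u d'') by exact: ball_open.
exists (par i @` ball u d''); split.
- by exists u => //; exact: ballxx.
- by move=> _ [v vd <-]; apply: dW; exact: le_ball vd.
- apply: connected_continuous_connected.
    rewrite (_ : ball u d'' = \bigcup_(v in ball u d'') [set u + t *: (v - u) | t in `[0, 1]%classic]).
      apply: bigcup_connected.
        exists u => v _; exists 0; last by rewrite scale0r addr0.
        by rewrite /= in_itv /= lexx ler01.
      move=> v _; apply: connected_continuous_connected; first exact: segment_connected.
      apply: continuous_subspaceT => t; apply: continuous_rV2 => k.
      apply: (@continuous_near _ _ (fun t : R => u 0 k + t * (v - u) 0 k)); first by apply: filterE => t'; rewrite !mxE.
      by cont.
    apply/seteqP; split=> [v vd|_ [v vd [t t01 <-]]].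
      exists v => //; exists 1; first by rewrite /= in_itv /= lexx ler01.
      by rewrite scale1r addrC subrK.
    have t01' : 0 <= t <= 1 by move: t01; rewrite /= in_itv.
    exact: (ball_segment (ballxx u d''0) vd t01').
  apply: continuous_in_subspaceT => v /set_mem vd; apply: cp; apply: dD; exact: bd.
- apply: (open_embedding_cancel (h := zeta th (rf i))).
  + by apply: open_embedding_sub (par_embedding i) => // v /bd/dD.
  + exact: open_embedding_sub ob bd ed.
  + by move=> v /bd/dD dv; rewrite gauss_coord_par.
Qed.

(* Near [p] the surface is, up to a translation, the chart [i] of the Scherk
   surface read in the coordinate [gauss_coord]. *)
Definition matches p rho Th i := \forall p' \near p,
  A (immersion p') - A (immersion p) =
  @scherk_immersion R th rho Th (scherk_par th i (gauss_coord p'))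
  - scherk_immersion rho Th (scherk_par th i (gauss_coord p)).

Lemma local_match p : exists rho Th, [/\ 0 < rho, 0 <= Th <= 2 * pi
  & forall i, scherk_dom th i (gauss_coord p) -> matches p rho Th i].
Proof.
have [i [u du <-]] := par_cover p.
have [rho [Th [rho0 Thb H]]] := patch_scherk th_bounds (@dom_open i) (@rf_smooth i) (expR_gt0 c)
  (@rf_mean i) (@rf_gauss_lt0 i) (@rf_relation i) du.
exists rho, Th; split=> // j; rewrite gauss_coord_par// => /H {}H.
apply: (near_embedding (par_embedding i) du).
move: (near_and (near_open (@dom_open i) (fun v Dv => Dv) du) H); apply: (@filterS _ (nbhs u)) => v [dv].
by rewrite !gauss_coord_par.
Qed.

(** Near one value of z the two Scherk immersions differ by a constant, so their partials, and hence
    [kappa / den], agree. The parameters themselves cannot be compared, as [Th] matters only modulo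
    2 pi. *)
Lemma match_kappa p rho Th rho' Th' i : scherk_dom th i (gauss_coord p) ->
  matches p rho Th i -> matches p rho' Th' i -> kappa th rho Th = kappa th rho' Th'.
Proof.
move=> di m m'; have [N [Np _ _ eN]] := @gauss_coord_embedding p setT openT I.
pose C : 'rV[R]_3 := scherk_immersion rho Th (scherk_par th i (gauss_coord p))
  - scherk_immersion rho' Th' (scherk_par th i (gauss_coord p)).
have near_eq : \forall z \near gauss_coord p, @scherk_immersion R th rho Th (scherk_par th i z) =
    @scherk_immersion R th rho' Th' (scherk_par th i z) + C.
  apply: (near_embedding eN Np); move: (near_and m m'); apply: (@filterS _ (nbhs p)) => q [E1 E2].
  exact: sub_eq_add (etrans (esym E1) E2).
have hI := (vdd_pd _ _).1 (scherk_diff rho Th th_bounds di).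
have hI' := (vdd_pd _ _).1 (scherk_diff rho' Th' th_bounds di).
have hE : vdd (fun z => @scherk_immersion R th rho' Th' (scherk_par th i z) + C) (gauss_coord p)
    (fun k => pd k (@scherk_immersion R th rho' Th' \o scherk_par th i) (gauss_coord p)).
  move=> l; apply: dd_ext (dd_near _ (ddD (hI' l) (dd_cst (C 0 l) _))) _ => [|k]; last by rewrite addr0.
  by apply: filterE => z; rewrite [RHS]row_addE.
have := vddE (vdd_near near_eq hI) 0; rewrite (vddE hE 0).
rewrite (scherk_pd rho Th th_bounds 0 di) (scherk_pd rho' Th' th_bounds 0 di).
move=> /(congr1 (fun X => unrev th X (gauss_coord p))); rewrite !unrev_rev /dir /= !mulr1 /coef_f => E.
have d0 := off_den (gauss_coord_off p).
by apply: (mulIf (invr_neq0 d0)); rewrite E.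
Qed.

Lemma kappa_immersion rho Th rho' Th' : kappa th rho Th = kappa th rho' Th' ->
  @scherk_immersion R th rho Th = scherk_immersion rho' Th'.
Proof. by move=> E; apply/funext => t; rewrite /scherk_immersion E. Qed.

Lemma chart_at p : exists i, scherk_dom th i (gauss_coord p).
Proof.
have [j sj] := off_slit (gauss_coord_off p).
have h : reduced [::] && ~~ odd (size ([::] : seq 'I_4)) by [].
by exists (exist (fun w => reduced w && ~~ odd (size w)) [::] h, j).
Qed.

(** All charts at once, since a point of the fibre product over [p] may lie on any sheet of the
    tree. *)
Definition matches_all rho Th p := forall i, scherk_dom th i (gauss_coord p) -> matches p rho Th i.

Lemma matches_all_kappa p rho Th rho' Th' : matches_all rho Th p -> matches_all rho' Th' p ->
  kappa th rho Th = kappa th rho' Th'.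
Proof.
by move=> m m'; have [i di] := chart_at p; exact: match_kappa di (m i di) (m' i di).
Qed.

Lemma kappa_matches p rho Th rho' Th' : kappa th rho Th = kappa th rho' Th' ->
  matches_all rho Th p -> matches_all rho' Th' p.
Proof. by move=> /kappa_immersion E m i /m; rewrite /matches E. Qed.

(** A point [q] near [p] has parameters of its own; the germ at [p], rebased at [q], shows that they
    have the same [kappa]. *)
Lemma matches_open rho Th : open [set p | matches_all rho Th p].
Proof.
rewrite openE => p mp; have [i di] := chart_at p.
have [N [Np _ _ eN]] := @gauss_coord_embedding p setT openT I.
have [oN _ cN _] := eN.
have dN : \forall q \near p, scherk_dom th i (gauss_coord q).
  apply: (cN p Np); apply: open_nbhs_nbhs; split; last exact: di.
  by have [] := scherk_embedding th_bounds i.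
have mN := nbhs_interior (mp i di).
move: (near_and dN mN); apply: (@filterS _ (nbhs p)) => q [dq mq].
have [rho' [Th' [_ _ m']]] := local_match q.
refine (kappa_matches (match_kappa dq (m' i dq) _) m').
have Eq := nbhs_singleton mq.
move: mq; apply: (@filterS _ (nbhs q)) => q' E'.
exact: sub_rebase E' Eq.
Qed.

(** The points matched by fixed parameters form an open set, and so does the complement: around each
    of its points other parameters match, with a different [kappa]. *)
Lemma global_match : S -> exists rho Th, [/\ 0 < rho, 0 <= Th <= 2 * pi & forall p, matches_all rho Th p].
Proof.
move=> p0; have [rho [Th [rho0 Thb m0]]] := local_match p0; exists rho, Th; split=> //.
have E : [set p | matches_all rho Th p] = [set: S].
  have := @surface_connected R S; apply.
  - by exists p0.
  - by exists [set p | matches_all rho Th p]; [exact: matches_open|rewrite setTI].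
  - exists [set p | matches_all rho Th p]; last by rewrite setTI.
    rewrite -openC openE => p np; have [rho' [Th' [_ _ m']]] := local_match p.
    have := open_nbhs_nbhs (conj (@matches_open rho' Th') m'); apply: (@filterS _ (nbhs p)) => q m1 m2.
    by apply: np; exact: kappa_matches (matches_all_kappa m1 m2) m'.
by move=> p; have : [set: S] p by []; rewrite -E.
Qed.

End SurfaceAnalysis.

(** * Components of a fibre product with a covering *)

Section PullbackCover.
Variables (S T U : topologicalType) (g : S -> U) (f : T -> U) (B : set U).
Hypotheses (cS : connected [set: S]) (cov : covering_map f B) (gB : forall p, B (g p)).
Hypothesis locg : forall p (W : set S), open W -> W p -> exists N,
  [/\ N p, N `<=` W, connected N & open_embedding N g].
Variables (p0 : S) (t0 : T).
Hypothesis gf0 : g p0 = f t0.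

(** [g] embeds the connected open set [N] into an evenly covered set, and [s i] is the lift of [g]
    through the sheet [V i]. *)
Lemma pullback_sheets p : exists (N : set S) (I : Type) (V : I -> set T) (s : I -> S -> T),
  [/\ N p, connected N, open_embedding N g, trivIset setT V & forall i,
      [/\ open_embedding (V i) f, forall q, N q -> V i (s i q) /\ f (s i q) = g q
        & forall q, N q -> {for q, continuous (s i)}] ] /\
  (forall q t, N q -> f t = g q -> exists i, V i t).
Proof.
have [_ _ /(_ _ (gB p))[N0 [oN0 N0p] [I [V [HV tV EV]]]]] := cov.
have [N1 [N1p _ _ [oN1 _ cN1 _]]] := locg openT (p := p) Logic.I.
have oW : open (N1 `&` g @^-1` N0).
  rewrite openE => q [N1q N0q]; apply: filterI; first exact: open_nbhs_nbhs.
  by apply: (cN1 q N1q); exact: open_nbhs_nbhs.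
have [N [Np NW cN eN]] := locg oW (conj N1p N0p).
have [_ _ cgN _] := eN.
exists N, I, V, (fun i q => xget t0 [set t | V i t /\ f t = g q]).
have sP i q : N q -> V i (xget t0 [set t | V i t /\ f t = g q]) /\ f (xget t0 [set t | V i t /\ f t = g q]) = g q.
  move=> Nq; have := @xgetPex _ t0 [set t | V i t /\ f t = g q]; apply.
  have [_ N0q] := NW q Nq.
  have [_ imV] := HV i; have : (f @` V i) (g q) by rewrite imV.
  by case=> t Vt ft; exists t.
split; last first.
  move=> q t Nq ft; have : (f @^-1` N0) t by rewrite /= ft; have [] := NW q Nq.
  by rewrite EV => -[i _ Vt]; exists i.
split=> // i; have [eV imV] := HV i; split=> //; first exact: sP.
move=> q Nq O'; rewrite nbhs_simpl /= nbhsE => -[Q [oQ Qs] QO].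
have [oV inj _ opV] := eV; have [Vs fs] := sP i q Nq.
have oF : open (f @` (Q `&` V i)) by apply: opV; [move=> ? []|exact: openI].
have H1 : \forall q' \near q, (f @` (Q `&` V i)) (g q').
  apply: (cgN q Nq); apply: open_nbhs_nbhs; split=> //.
  by rewrite -fs; eexists; [split; [exact: Qs|exact: Vs]|].
have H2 : \forall q' \near q, N q' by apply: open_nbhs_nbhs; split=> //; have [] := eN.
move: (near_and H1 H2); apply: (@filterS _ (nbhs q)) => q' [[t [Qt Vt] ft] Nq']; apply: QO.
have [Vs' fs'] := sP i q' Nq'.
by rewrite (_ : xget _ _ = t)//; apply: inj; rewrite ?inE// ft.
Qed.

Let F : set (S * T) := [set x | g x.1 = f x.2].
Let comp := connected_component F (p0, t0).

(* A component of the fibre product; its topology is that of a subspace. *)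
Definition pullback : topologicalType := set_type comp.
Definition pr1 (c : pullback) : S := (\val c).1.
Definition pr2 (c : pullback) : T := (\val c).2.

Definition pullback_mk x (cx : comp x) : pullback := exist (fun x => x \in comp) x (mem_set cx).

Lemma pullback_inj (c d : pullback) : \val c = \val d -> c = d.
Proof. exact: (@val_inj _ _ (set_type comp)). Qed.

Lemma pullbackE (c : pullback) : g (pr1 c) = f (pr2 c).
Proof. by have := set_valP c => /connected_component_sub. Qed.

Lemma val_continuous : continuous (fun c : pullback => \val c : S * T).
Proof. exact: initial_continuous. Qed.

Lemma pr1_continuous : continuous pr1.
Proof. by move=> c; apply: (@cont_fst _ _ _ _ (fun c : pullback => \val c)); exact: val_continuous. Qed.

Lemma pr2_continuous : continuous pr2.
Proof. by move=> c; apply: (@cont_snd _ _ _ _ (fun c : pullback => \val c)); exact: val_continuous. Qed.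

Lemma pullback_open (W : set pullback) : open W -> exists2 Q : set (S * T), open Q & W = (fun c : pullback => \val c) @^-1` Q.
Proof. by move=> [Q oQ <-]; exists Q. Qed.

Lemma pullback_connected : connected [set: pullback].
Proof.
move=> W [c Wc] [Q0 oQ0 WQ] [K0 cK0 WK].
rewrite setTI in WQ; rewrite setTI in WK.
have [Q oQ QE] := pullback_open oQ0; have [K oK KE] := pullback_open (closed_openC cK0).
rewrite -WQ in QE.
have : (fun c : pullback => \val c) @` W = comp.
  apply: (@component_connected _ F (p0, t0)).
  - by exists (\val c), c.
  - exists Q => //; apply/seteqP; split=> [_ [d Wd <-]|x [cx Qx]].
      by split; [exact: set_valP|move: Wd; rewrite QE].
    by exists (pullback_mk cx) => //; rewrite QE.
  - exists (~` K); first exact: open_closedC.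
    apply/seteqP; split=> [_ [d Wd <-]|x [cx Kx]].
      by split; [exact: set_valP|move=> Kd; have nK : (~` K0) d by [rewrite KE]; apply: nK; rewrite -WK].
    exists (pullback_mk cx) => //; rewrite WK; apply: contrapT => nK.
    by apply: Kx; have : (~` K0) (pullback_mk cx) by []; rewrite KE.
move=> WE; apply/seteqP; split=> // d _.
have : forall x, comp x -> ((fun c : pullback => \val c) @` W) x by rewrite WE.
move=> /(_ _ (set_valP d))[d' Wd' E]; have <- : d' = d := pullback_inj E.
exact: Wd'.
Qed.

Section Sheets.
Variables (N : set S) (I : Type) (V : I -> set T) (s : I -> S -> T).
Hypotheses (cN : connected N) (eN : open_embedding N g) (tV : trivIset setT V).
Hypothesis sV : forall i, [/\ open_embedding (V i) f, forall q, N q -> V i (s i q) /\ f (s i q) = g q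
        & forall q, N q -> {for q, continuous (s i)}].
Hypothesis fV : forall q t, N q -> f t = g q -> exists i, V i t.

Definition sheet_over i : set pullback := [set c | N (pr1 c) /\ V i (pr2 c)].

Lemma section_eq i q t : N q -> V i t -> f t = g q -> t = s i q.
Proof.
move=> Nq Vt ft; have [[_ inj _ _] sP _] := sV i; have [Vs fs] := sP q Nq.
by apply: inj; rewrite ?inE// ft fs.
Qed.

Lemma pr2_section i c : sheet_over i c -> pr2 c = s i (pr1 c).
Proof. by move=> [Nc Vc]; apply: section_eq => //; rewrite pullbackE. Qed.

(** The graph of [s i] over the connected set [N] is connected, so it stays in one component. *)
Lemma section_comp i q q' : N q -> N q' -> comp (q, s i q) -> comp (q', s i q').
Proof.
move=> Nq Nq' cq; rewrite /comp (same_connected_component cq).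
have [_ sP cs] := sV i.
apply: (@connected_component_max _ F ((fun x => (x, s i x)) @` N)).
- by exists q.
- by move=> _ [x Nx <-]; rewrite /F /=; have [_ ->] := sP x Nx.
- apply: connected_continuous_connected => //; apply: continuous_in_subspaceT => x /set_mem Nx.
  by apply: cont_pair; [exact: cvg_id|exact: cs].
- by exists q'.
Qed.

Lemma sheet_open i : open (sheet_over i).
Proof.
have [[oV _ _ _] _ _] := sV i; have [oN _ _ _] := eN.
apply: (openI (A := pr1 @^-1` N) (B := pr2 @^-1` V i)).
  by apply: open_comp => // c _; exact: pr1_continuous.
by apply: open_comp => // c _; exact: pr2_continuous.
Qed.

Lemma sheet_embedding i : open_embedding (sheet_over i) pr1.
Proof.
split; first exact: sheet_open.
- move=> c d /set_mem hc /set_mem hd E; apply: pullback_inj.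
  rewrite [LHS]surjective_pairing [RHS]surjective_pairing -/(pr1 c) -/(pr1 d) -/(pr2 c) -/(pr2 d).
  by rewrite (pr2_section hc) (pr2_section hd) E.
- by move=> c _; exact: pr1_continuous.
- move=> W WV oW; have [Q oQ WQ] := pullback_open oW.
  rewrite openE => _ [c Wc <-]; have hc := WV _ Wc; have [Nc Vc] := hc.
  have [_ sP cs] := sV i; have [oN _ _ _] := eN.
  have Qc : Q (pr1 c, s i (pr1 c)).
    by rewrite -(pr2_section hc) -surjective_pairing; move: Wc; rewrite WQ.
  have H1 : \forall q \near pr1 c, Q (q, s i q).
    have cp : {for pr1 c, continuous (fun q => (q, s i q))} by apply: cont_pair; [exact: cvg_id|exact: cs].
    by apply: cp; exact: open_nbhs_nbhs.
  have H2 : \forall q \near pr1 c, N q by exact: open_nbhs_nbhs.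
  move: (near_and H1 H2); apply: (@filterS _ (nbhs (pr1 c))) => q [Qq Nq].
  have cq : comp (q, s i q).
    apply: (section_comp Nc Nq); rewrite -(pr2_section hc) -surjective_pairing; exact: set_valP.
  by exists (pullback_mk cq) => //; rewrite WQ.
Qed.

Lemma sheet_image i q : N q -> comp (q, s i q) -> pr1 @` sheet_over i = N.
Proof.
move=> Nq cq; apply/seteqP; split=> [_ [c [Nc _] <-]//|q' Nq'].
have cq' := section_comp Nq Nq' cq; exists (pullback_mk cq') => //.
by split=> //=; have [_ sP _] := sV i; have [] := sP q' Nq'.
Qed.

Lemma sheet_section i c q : sheet_over i c -> N q -> comp (q, s i q).
Proof.
move=> hc Nq; have [Nc _] := hc; apply: (section_comp Nc Nq).
by rewrite -(pr2_section hc) -surjective_pairing; exact: set_valP.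
Qed.

(** On the sheet f o pr2 = g o pr1 is an open embedding, and [f] is injective on [V i]. *)
Lemma pr2_embedding i : open_embedding (sheet_over i) pr2.
Proof.
have [ef sP _] := sV i; have [oV injf cf opf] := ef.
have efg : open_embedding (sheet_over i) (g \o pr1).
  by apply: open_embedding_comp (sheet_embedding i) eN _ => _ [c [Nc _] <-].
have [_ injg _ opg] := efg.
split; first exact: sheet_open.
- by move=> c d hc hd E; apply: injg => //=; rewrite !pullbackE E.
- by move=> c _; exact: pr2_continuous.
- move=> W WV oW; have -> : pr2 @` W = V i `&` f @^-1` ((g \o pr1) @` W).
    apply/seteqP; split=> [_ [c Wc <-]|t [Vt [c Wc /= E]]].
      by have [_ Vc] := WV _ Wc; split=> //; exists c => //=; rewrite pullbackE.
    exists c => //; have [_ Vc] := WV _ Wc; apply: injf; rewrite ?inE//.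
    by rewrite -pullbackE E.
  rewrite openE => t [Vt Wt]; apply: filterI; first exact: open_nbhs_nbhs.
  by apply: (cf t Vt); apply: open_nbhs_nbhs; split=> //; exact: opg.
Qed.

End Sheets.

Lemma pr2_local_homeo : local_homeo pr2.
Proof.
move=> c; have [N [I [V [s [[Nc cN eN tV sV] fV]]]]] := pullback_sheets (pr1 c).
have [i Vi] := fV _ _ Nc (esym (pullbackE c)).
by exists (sheet_over N V i); [split|exact: pr2_embedding].
Qed.

(** The sheets over [N] are the sections that lie in the chosen component. Since a section over [N]
    lies in it entirely or not at all, the image of [pr1] is open and closed, hence all of the
    connected [S]. *)
Lemma pr1_covering : covering_map pr1 setT.
Proof.
have c0 : comp (p0, t0) by apply: connected_component_refl; rewrite /F /= gf0.
have opr p : range pr1 p -> nbhs p (range pr1).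
  move=> [c _ <-]; have [N [I [V [s [[Nc cN eN tV sV] fV]]]]] := pullback_sheets (pr1 c).
  have [i Vi] := fV _ _ Nc (esym (pullbackE c)).
  have [oN _ _ _] := eN; apply: (@filterS _ (nbhs (pr1 c)) _ N); last exact: open_nbhs_nbhs.
  have hc : sheet_over N V i c by split.
  rewrite -(sheet_image cN sV Nc (sheet_section cN sV hc Nc)) => _ [d _ <-]; by exists d.
have clr p : ~ range pr1 p -> nbhs p (~` range pr1).
  move=> np; have [N [I [V [s [[Np cN eN tV sV] fV]]]]] := pullback_sheets p.
  have [oN _ _ _] := eN; apply: (@filterS _ (nbhs p) _ N); last exact: open_nbhs_nbhs.
  move=> q Nq [c _ E]; apply: np; rewrite -E in Nq.
  have [i Vi] := fV _ _ Nq (esym (pullbackE c)).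
  have cp := @sheet_section N I V s cN sV i c p (conj Nq Vi) Np.
  by exists (pullback_mk cp).
split; first exact: pr1_continuous.
  apply: cS.
  - by exists p0, (pullback_mk c0).
  - by exists (range pr1); rewrite ?setTI// openE => p /opr.
  - by exists (range pr1); rewrite ?setTI// -openC openE => p /clr.
move=> p _; have [N [I [V [s [[Np cN eN tV sV] fV]]]]] := pullback_sheets p.
have [oN _ _ _] := eN; exists N => //.
exists {i : I | comp (p, s i p)}, (fun i => sheet_over N V (proj1_sig i)); split.
- move=> [i ci] /=; split; first exact: sheet_embedding.
  exact: sheet_image ci.
- move=> [i ci] [j cj] _ _ [c [/= [_ Vi] [_ Vj]]].
  have ij : i = j by apply: (tV i j) => //; exists (pr2 c).
  by subst j; congr exist; exact: Prop_irrelevance.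
- apply/seteqP; split=> [c Nc|c [i _ []]//].
  have [i Vi] := fV _ _ Nc (esym (pullbackE c)).
  have ci := @sheet_section N I V s cN sV i c p (conj Nc Vi) Np.
  by exists (exist _ i ci).
Qed.

End PullbackCover.

Lemma locally_constant (X : topologicalType) (Y : Type) (h : X -> Y) : connected [set: X] ->
  (forall x, \forall y \near x, h y = h x) -> forall x y, h x = h y.
Proof.
move=> cX lh x y; have E : [set z | h z = h y] = [set: X].
  apply: cX.
  - by exists y.
  - exists [set z | h z = h y]; rewrite ?setTI// openE => z <-; exact: lh.
  - exists [set z | h z = h y]; rewrite ?setTI// -openC openE => z nz.
    by move: (lh z); apply: (@filterS _ (nbhs z)) => w E E'; apply: nz; exact: etrans (esym E) E'.
by have : [set: X] x by []; rewrite -E.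
Qed.

(** * From matching germs to a congruence *)

Section Congruence.
Context {R : realType}.
Variables (S : surface R) (K : S -> R) (V1 V2 : 'rV[R]_3) (c : R).
Hypotheses (hmin : minimal S) (hK : is_gauss_curvature K) (hKneg : forall p, K p < 0).
Hypotheses (V11 : dot V1 V1 = 1) (V22 : dot V2 V2 = 1).
Hypothesis hc : forall p : S,
  (forall V, V \in [:: V1; - V1; V2; - V2] -> 0 < 1 - dot (normal p) V) ->
  chern_ricci K [:: V1; - V1; V2; - V2] p = c.
Variables (th : R) (e1 e2 : 'rV[R]_3).
Hypotheses (th_bounds : 0 < th < pi / 2).
Hypotheses (e11 : dot e1 e1 = 1) (e22 : dot e2 e2 = 1) (e12 : dot e1 e2 = 0).
Hypotheses (V1E : V1 = cos th *: e1 + sin th *: e2) (V2E : V2 = cos th *: e1 - sin th *: e2).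

Lemma empty_congruent (S' : surface R) : (S -> False) -> congruent_to_part S S'.
Proof.
move=> S0; exists id; first by [].
exists (S : topologicalType), id, (fun p => False_rect S' (S0 p)); split.
- exact: surface_connected.
- split=> [p|//|p]; [by case: (S0 p)| |by case: (S0 p)].
  by rewrite image_id.
- by move=> p; case: (S0 p).
- by move=> p; case: (S0 p).
Qed.

Lemma match_congruent rho Th (rho0 : 0 < rho) (p0 : S) :
  (forall p : S, matches_all th e1 e2 rho Th p) -> congruent_to_part S (scherk Th th_bounds rho0).
Proof.
move=> M; pose g : S -> 'rV[R]_2 := gauss_coord th e1 e2.
have cov := @proj_covering R _ _ _ (pa_lt0 th_bounds) (pc_gt0 th_bounds).
have gB p : [set u | off_punctures (pa th) 0 (pc th) u] (g p).
  exact: (gauss_coord_off hK hKneg V11 V22 hc th_bounds e11 e22 e12 V1E V2E).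
have locg p (W : set S) : open W -> W p -> exists N, [/\ N p, N `<=` W, connected N & open_embedding N g].
  exact: (gauss_coord_embedding hmin hK hKneg V11 V22 hc e11 e22 e12 V1E V2E).
have [t0 gf0] : exists t0 : tree (pa th) 0 (pc th), g p0 = proj t0.
  have [_ rp _] := cov; have := gB p0; rewrite -rp => -[t _ <-]; by exists t.
have cC : connected [set: pullback g (@proj R (pa th) 0 (pc th)) p0 t0] by exact: pullback_connected.
(* The difference of the rotated immersion and the Scherk immersion on the fibre product. It is
   locally constant by [M], and its constant value is subtracted by the isometry. *)
pose h (q : pullback g (@proj R (pa th) 0 (pc th)) p0 t0) : 'rV[R]_3 :=
  frame e1 e2 (immersion (pr1 q)) - scherk_immersion rho Th (pr2 q).
have lh q : \forall q' \near q, h q' = h q.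
  have [i [u du ut]] := scherk_cover th_bounds (pr2 q).
  have oP : open (scherk_par th i @` scherk_dom th i).
    by have [oD _ _ oi] := scherk_embedding th_bounds i; apply: oi.
  have pE (t : tree (pa th) 0 (pc th)) : (scherk_par th i @` scherk_dom th i) t ->
      scherk_dom th i (proj t) /\ scherk_par th i (proj t) = t.
    by move=> [v dv <-]; rewrite (proj_par th_bounds dv).
  have [d2 e2'] := pE (pr2 q) (ex_intro2 _ _ u du ut).
  have H1 : \forall q' \near q, (scherk_par th i @` scherk_dom th i) (pr2 q').
    by apply: (@pr2_continuous _ _ _ g (@proj R (pa th) 0 (pc th)) p0 t0 q); apply: open_nbhs_nbhs; split=> //; exists u.
  have dg : scherk_dom th i (g (pr1 q)) by rewrite pullbackE.
  have H2 : \forall q' \near q, frame e1 e2 (immersion (pr1 q')) - frame e1 e2 (immersion (pr1 q)) =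
      scherk_immersion rho Th (scherk_par th i (g (pr1 q'))) - scherk_immersion rho Th (scherk_par th i (g (pr1 q))).
    exact: (@pr1_continuous _ _ _ g (@proj R (pa th) 0 (pc th)) p0 t0 q _ (M (pr1 q) i dg)).
  move: (near_and H1 H2); apply: (@filterS _ (nbhs q)) => q' [h1 E].
  have [_ eq'] := pE _ h1.
  rewrite !pullbackE eq' e2' in E; rewrite /h (sub_eq_add E).
  by rewrite addrAC subrr add0r.
have kE := locally_constant cC lh.
have c0 : connected_component [set x | g x.1 = @proj R (pa th) 0 (pc th) x.2] (p0, t0) (p0, t0).
  exact: connected_component_refl.
exists (fun x => frame e1 e2 x + - h (pullback_mk c0)); first exact: frame_isometry.
exists (pullback g (@proj R (pa th) 0 (pc th)) p0 t0), (@pr1 _ _ _ _ _ p0 t0), (@pr2 _ _ _ _ _ p0 t0); split.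
- exact: cC.
- exact: (pr1_covering (@surface_connected R S) cov gB locg gf0).
- exact: (pr2_local_homeo cov gB locg).
- by move=> q; rewrite -(kE q) /h opprB addrC subrK.
Qed.

End Congruence.

Theorem theorem5p3 (R : realType) (S : surface R) (K : S -> R)
    (V1 V2 : 'rV[R]_3)
    (hmin : minimal S)
    (hK : is_gauss_curvature K)
    (hKneg : forall p, K p < 0)
    (hV1 : enorm V1 = 1) (hV2 : enorm V2 = 1)
    (hV12 : V1 != V2) (hV12' : V1 != - V2)
    (hconst : exists c : R, forall p : S,
       (forall V, V \in [:: V1; - V1; V2; - V2] -> 0 < 1 - dot (normal p) V) ->
       chern_ricci K [:: V1; - V1; V2; - V2] p = c) :
  exists theta rho Theta : R,
    [/\ 0 < theta < pi / 2, 0 < rho, 0 <= Theta <= 2 * pi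
      & exists2 S' : surface R,
          scherk_member S' theta rho Theta & congruent_to_part S S'].
Proof.
have [c hc] := hconst.
have v1 := (enorm1 V1).1 hV1; have v2 := (enorm1 V2).1 hV2.
have [th [e1 [e2 [thb [e11 e22 e12] V1E V2E]]]] := adapted_frame hV1 hV2 hV12 hV12'.
(* An empty carrier counts as connected; it is a part of any member, here the one of scale 1 and
   phase 0. *)
have [[p0 _]|S0] := pselect (exists p : S, True); last first.
  exists th, 1, 0; split=> //; first by rewrite lexx mulr_ge0// pi_ge0.
  exists (scherk 0 thb ltr01); first exact: scherk_is_member.
  by apply: empty_congruent => p; apply: S0; exists p.
have [rho [Th [rho0 Thb M]]] := global_match hmin hK hKneg v1 v2 hc thb e11 e22 e12 V1E V2E p0.
exists th, rho, Th; split=> //.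
exists (scherk Th thb rho0); first exact: scherk_is_member.
exact: (match_congruent hmin hK hKneg v1 v2 hc thb e11 e22 e12 V1E V2E rho0 p0 M).
Qed.
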